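(* Let $(A,B,P)$ be a tetrablock contraction on a Hilbert space $\mathcal{H}$ with fundamental operators $F_1,F_2\in\mathcal{B}(\mathcal{D}_P)$, and suppose $$[F_1,F_2]=0\quad\text{and}\quad [F_1,F_1^*]=[F_2,F_2^*].$$ Let $G_1,G_2\in\mathcal{B}(\mathcal{D}_{P^*})$ be the fundamental operators of the tetrablock contraction $(A^*,B^*,P^* )$. Let $\tilde{\mathcal{H}}=\mathcal{H}\oplus l^2(\mathcal{D}_P)$ and define operators $V_1,V_2,V_3$ on $\tilde{\mathcal{H}}$ by $$V_1(h\oplus(a_0,a_1,a_2,\dots))=Ah\oplus(F_2^*D_Ph+F_1a_0,\;F_2^*a_0+F_1a_1,\;F_2^*a_1+F_1a_2,\dots),$$ $$V_2(h\oplus(a_0,a_1,a_2,\dots))=Bh\oplus(F_1^*D_Ph+F_2a_0,\;F_1^*a_0+F_2a_1,\;F_1^*a_1+F_2a_2,\dots),$$ $$V_3(h\oplus(a_0,a_1,a_2,\dots))=Ph\oplus(D_Ph,a_0,a_1,a_2,\dots).$$ Let $\mathcal{K}=\tilde{\mathcal{H}}\oplus l^2(\mathcal{D}_{P^*})$. Define $C_1,C_2,C_3:l^2(\mathcal{D}_{P^*})\to\tilde{\mathcal{H}}$ by $$C_1(a_0,a_1,a_2,\dots)=D_{P^*}G_2a_0\oplus(-F_2^*P^*a_0,0,0,\dots),$$ $$C_2(a_0,a_1,a_2,\dots)=D_{P^*}G_1a_0\oplus(-F_1^*P^*a_0,0,0,\dots),$$ $$C_3(a_0,a_1,a_2,\dots)=D_{P^*}a_0\oplus(-P^*a_0,0,0,\dots),$$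 and $D_1,D_2,D_3:l^2(\mathcal{D}_{P^*})\to l^2(\mathcal{D}_{P^*})$ by $$D_1(a_0,a_1,a_2,\dots)=(G_1^*a_0+G_2a_1,\;G_1^*a_1+G_2a_2,\;G_1^*a_2+G_2a_3,\dots),$$ $$D_2(a_0,a_1,a_2,\dots)=(G_2^*a_0+G_1a_1,\;G_2^*a_1+G_1a_2,\;G_2^*a_2+G_1a_3,\dots),$$ $$D_3(a_0,a_1,a_2,\dots)=(a_1,a_2,a_3,\dots).$$ Finally let $R_1,R_2,U$ be the operators on $\mathcal{K}$ whose block matrices with respect to the decomposition $\mathcal{K}=\tilde{\mathcal{H}}\oplus l^2(\mathcal{D}_{P^*})$ are $$R_1=\begin{pmatrix}V_1&C_1\\0&D_1\end{pmatrix},\qquad R_2=\begin{pmatrix}V_2&C_2\\0&D_2\end{pmatrix},\qquad U=\begin{pmatrix}V_3&C_3\\0&D_3\end{pmatrix}.$$ Then the triple $(R_1,R_2,U)$ is a tetrablock unitary dilation of $(A,B,P)$.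
   Context: All Hilbert spaces are complex. The tetrablock is the domain $E=\{(a_{11},a_{22},\det A): A=\begin{pmatrix}a_{11}&a_{12}\\ a_{21}&a_{22}\end{pmatrix},\ \|A\|<1\}\subset\mathbb{C}^3$; $\overline{E}$ is polynomially convex, and $bE$ denotes its distinguished (Shilov) boundary, i.e. the smallest closed subset of $\overline{E}$ on which every function continuous on $\overline{E}$ and holomorphic on $E$ attains its maximum modulus. A triple $(A,B,P)$ of commuting bounded operators on a Hilbert space is a tetrablock contraction if its joint spectrum is contained in $\overline{E}$ and $\|f(A,B,P)\|\le\sup_{\overline{E}}|f|$ for every polynomial $f$ in three variables. Then $P$ is a contraction and $(A^*,B^*,P^* )$ is also a tetrablock contraction. For a contraction $P$ on $\mathcal{H}$: $D_P=(I-P^*P)^{1/2}$, $D_{P^*}=(I-PP^* )^{1/2}$, $\mathcal{D}_P=\overline{\mathrm{Ran}}\,D_P$, $\mathcal{D}_{P^*}=\overline{\mathrm{Ran}}\,D_{P^*}$. Fundamental operators of a tetrablock contraction $(A,B,P)$: the (known to exist and be unique) bounded operators $F_1,F_2$ on $\mathcal{D}_P$ with $A-B^*P=D_PF_1D_P$ and $B-A^*P=D_PF_2D_P$. Correspondingly, the fundamental operators $G_1,G_2\in\mathcal{B}(\mathcal{D}_{P^*})$ of $(A^*,B^*,P^* )$ satisfy $A^*-BP^*=D_{P^*}G_1D_{P^*}$ and $B^*-AP^*=D_{P^*}G_2D_{P^*}$. Notation: $[X,Y]=XY-YX$; $l^2(\mathcal{E})$ is the space of square-summable sequences $(a_0,a_1,\dots)$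 in $\mathcal{E}$. A tetrablock unitary is a triple of commuting bounded normal operators whose Taylor joint spectrum is contained in $bE$. A tetrablock unitary dilation of $(A,B,P)$ on $\mathcal{H}$ is a tetrablock unitary $(N_1,N_2,N_3)$ on a Hilbert space $\mathcal{K}\supseteq\mathcal{H}$ such that $A^mB^nP^l=P_{\mathcal{H}}N_1^mN_2^nN_3^l|_{\mathcal{H}}$ for all integers $m,n,l\ge0$, where $P_{\mathcal{H}}$ is the orthogonal projection onto $\mathcal{H}$. Here $\mathcal{H}$ is identified with the first summand of $\tilde{\mathcal{H}}=\mathcal{H}\oplus l^2(\mathcal{D}_P)\subseteq\mathcal{K}$. *)

(* Defs.v *)
From HB Require Import structures.
From mathcomp Require Import all_boot all_order all_algebra.
From mathcomp Require Import complex.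
From mathcomp Require Import all_classical all_reals all_analysis.
From mathcomp Require mpoly.
From mathcomp Require Import ring lra.
Set Implicit Arguments.
Unset Strict Implicit.
Unset Printing Implicit Defensive.
Import Order.TTheory GRing.Theory Num.Theory.
Import numFieldNormedType.Exports.
Local Open Scope classical_set_scope.
Local Open Scope ring_scope.

Section preHilbert.
Context (C : numClosedFieldType) (V : lmodType C) (d : V -> V -> C).
Hypothesis dP : forall a x y z, d (a *: x + y) z = a * d x z + d y z.
Hypothesis dC : forall x y, d x y = (d y x)^*.
Hypothesis d0 : forall x, 0 <= d x x.
Hypothesis d_eq0 : forall x, d x x = 0 -> x = 0.

Lemma pre_dot0l y : d 0 y = 0.
Proof. by have := dP (-1) 0 0 y; rewrite scaler0 addr0 mulN1r addNr. Qed.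
Lemma pre_dot0r y : d y 0 = 0.
Proof. by rewrite dC pre_dot0l conjC0. Qed.
Lemma pre_dotDl x y z : d (x + y) z = d x z + d y z.
Proof. by have := dP 1 x y z; rewrite scale1r mul1r. Qed.
Lemma pre_dotZl a x z : d (a *: x) z = a * d x z.
Proof. by have := dP a x 0 z; rewrite addr0 pre_dot0l addr0. Qed.
Lemma pre_dotDr x y z : d z (x + y) = d z x + d z y.
Proof. by rewrite dC pre_dotDl rmorphD/= -!dC. Qed.
Lemma pre_dotZr a x z : d z (a *: x) = a^* * d z x.
Proof. by rewrite dC pre_dotZl rmorphM/= -dC. Qed.

Lemma pre_CS x y : `|d x y| ^+ 2 <= d x x * d y y.
Proof.
have [y0|y0] := eqVneq (d y y) 0.
  by rewrite (d_eq0 y0) !pre_dot0r normr0 expr0n mulr0.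
have yp : 0 < d y y by rewrite lt0r y0 d0.
have := d0 (d y y *: x + (- d x y) *: y).
rewrite !(pre_dotDl, pre_dotDr, pre_dotZl, pre_dotZr) (dC y x) -(dC y y) rmorphN/=.
rewrite normCK => h.
rewrite -subr_ge0 -(pmulr_rge0 _ yp); apply: le_trans h _.
rewrite le_eqVlt; apply/orP; left; apply/eqP; ring.
Qed.

Lemma pre_triangle x y :
  sqrtC (d (x + y) (x + y)) <= sqrtC (d x x) + sqrtC (d y y).
Proof.
rewrite -ler_sqr ?nnegrE ?addr_ge0 ?sqrtC_ge0// sqrrD !sqrtCK.
rewrite pre_dotDl !pre_dotDr (dC y x).
have -> : d x x + d x y + ((d x y)^* + d y y) =
  d x x + (d x y + (d x y)^*) + d y y by ring.
rewrite !lerD2r lerD2l.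
have -> : d x y + (d x y)^* = 'Re (d x y) *+ 2.
  by rewrite ReE -mulr_natr divfK// pnatr_eq0.
rewrite lerMn2r/=; apply: (le_trans (leif_Re_Creal (d x y)).1).
rewrite -ler_sqr ?nnegrE ?mulr_ge0 ?sqrtC_ge0// exprMn !sqrtCK.
exact: pre_CS.
Qed.

Lemma pre_normZ a x : sqrtC (d (a *: x) (a *: x)) = `|a| * sqrtC (d x x).
Proof.
rewrite pre_dotZl pre_dotZr mulrA -normCK sqrtCM ?nnegrE ?exprn_ge0//.
by rewrite sqrCK.
Qed.

Lemma pre_norm_eq0 x : sqrtC (d x x) = 0 -> x = 0.
Proof. by move/eqP; rewrite sqrtC_eq0 => /eqP/d_eq0. Qed.
End preHilbert.

(* Complex Hilbert spaces. As in the rest of the library for normed modules over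
   R[i], norms are R[i]-valued; the inner product is linear on the left. *)
HB.mixin Record isHilbert (R : realType) V & CompleteNormedModule R[i] V := {
  dot : V -> V -> R[i];
  dot_linearl : forall a x y z, dot (a *: x + y) z = a * dot x z + dot y z;
  dotC : forall x y, dot x y = (dot y x)^*;
  dotE : forall x, dot x x = `|x| ^+ 2 }.

#[short(type="hilbertType")]
HB.structure Definition Hilbert (R : realType) :=
  {V of isHilbert R V & CompleteNormedModule R[i] V}.

HB.factory Record Lmodule_isHilbert (R : realType) V & GRing.Lmodule R[i] V := {
  dot : V -> V -> R[i];
  dot_linearl : forall a x y z, dot (a *: x + y) z = a * dot x z + dot y z;
  dotC : forall x y, dot x y = (dot y x)^*;
  dot_ge0 : forall x, 0 <= dot x x;
  dot_eq0 : forall x, dot x x = 0 -> x = 0;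
  dot_complete : forall u : nat -> V,
    (forall e : R, 0 < e -> exists N, forall m n, (N <= m)%N -> (N <= n)%N ->
       complex.Re (dot (u m - u n) (u m - u n)) <= e) ->
    exists l, forall e : R, 0 < e -> exists N, forall n, (N <= n)%N ->
       complex.Re (dot (u n - l) (u n - l)) <= e }.

HB.builders Context (R : realType) V & Lmodule_isHilbert R V.

Let norm (x : V) : R[i] := sqrtC (dot x x).
HB.instance Definition _ := Lmodule_isNormed.Build R[i] V
  (pre_triangle dot_linearl dotC dot_ge0 dot_eq0)
  (pre_normZ dot_linearl dotC dot_ge0)
  (pre_norm_eq0 dot_eq0).

Let normE (x : V) : `|x| ^+ 2 = dot x x.
Proof. by rewrite [LHS]sqrtCK. Qed.

Let normRe (x : V) : `|x| ^+ 2 = (complex.Re (dot x x))%:C%C.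
Proof.
rewrite normE; have := dot_ge0 x; case: (dot x x) => a b.
by rewrite lecE/= => /andP[/eqP-> _].
Qed.

Let real_gt0 (e : R[i]) : 0 < e -> e = (complex.Re e)%:C%C /\ 0 < complex.Re e.
Proof. by case: e => a b; rewrite ltcE/= => /andP[/eqP-> ->]. Qed.

Let cvg_to_complete (F : set_system V) : ProperFilter F -> cauchy F -> cvg F.
Proof.
move=> FF /cauchyP Fc.
have d0 (n : nat) : 0 < (n.+1%:R^-1 : R[i]) by rewrite invr_gt0 ltr0n.
pose u n : V := projT1 (cid (Fc _ (d0 n))).
have uF n : F (ball (u n) (n.+1%:R^-1)) := projT2 (cid (Fc _ (d0 n))).
have uu m n : `|u m - u n| <= m.+1%:R^-1 + n.+1%:R^-1.
  have [z [zm zn]] := @filter_ex _ _ FF _ (@filterI _ F _ _ _ (uF m) (uF n)).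
  rewrite -(subrKA z) (le_trans (ler_normD _ _))//.
  move: zm zn; rewrite -!ball_normE/= => zm zn.
  by apply: lerD; apply: ltW => //; rewrite distrC.
have inv_le (e : R) : 0 < e -> exists N, forall n, (N <= n)%N -> n.+1%:R^-1 <= e%:C%C :> R[i].
  move=> e0; exists (Num.truncn e^-1) => n nN.
  have : (n.+1%:R : R)^-1 <= e.
    rewrite -[leRHS]invrK lef_pV2 ?posrE ?invr_gt0 ?ltr0n//.
    by apply: ltW; apply: lt_le_trans (truncnS_gt _) _; rewrite ler_nat.
  by rewrite -lecR fmorphV/= rmorph_nat.
have [|l ul] := dot_complete (u := u).
  move=> e e0.
  have s0 : 0 < Num.sqrt e by rewrite sqrtr_gt0.
  have [N hN] := inv_le (Num.sqrt e / 2) (divr_gt0 s0 (ltr0Sn _ _)).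
  exists N => m n mN nN; rewrite -lecR -normRe.
  have -> : e%:C%C = (Num.sqrt e)%:C%C ^+ 2 by rewrite -rmorphXn/= sqr_sqrtr// ltW.
  rewrite ler_sqr ?nnegrE ?ler0c ?sqrtr_ge0// (le_trans (uu _ _))//.
  rewrite (le_trans (lerD (hN _ mN) (hN _ nN)))// -rmorphD/= lecR.
  by rewrite -splitr.
apply/cvg_ex; exists l; apply/cvg_ballP => e /real_gt0[-> e0].
set r := complex.Re e in e0 *.
have r2 : 0 < r / 3 by rewrite divr_gt0// ltr0n.
have [N1 h1] := inv_le _ r2.
have [N2 h2] := ul _ (exprn_gt0 2 r2).
pose n := maxn N1 N2.
apply: filterS (uF n) => z; rewrite -!ball_normE/= => zn.
have h3 : `|l - u n| <= (r / 3)%:C%C.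
  rewrite distrC -ler_sqr ?nnegrE ?ler0c ?(ltW r2)// normRe -rmorphXn/= lecR.
  exact/h2/leq_maxr.
rewrite -(subrKA (u n)) (le_lt_trans (ler_normD _ _))//.
apply: (@le_lt_trans _ _ ((r/3)%:C%C + (r/3)%:C%C)).
  apply: lerD => //; apply: le_trans (ltW zn) _; exact/h1/leq_maxl.
by rewrite -rmorphD/= ltcR; lra.
Qed.

HB.instance Definition _ := Uniform_isComplete.Build V cvg_to_complete.
HB.instance Definition _ := isHilbert.Build R V dot_linearl dotC
  (fun x => esym (normE x)).
HB.end.

Definition sqnorm (R : realType) (E : hilbertType R) (x : E) : R :=
  complex.Re (dot x x).

Lemma Re_normsq (R : realType) (a : R[i]) :
  (complex.Re (`|a| ^+ 2))%:C%C = `|a| ^+ 2.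
Proof.
by rewrite normc_def; set s := Num.sqrt _; rewrite -(rmorphXn (real_complex R)).
Qed.

Section HilbertTheory.
Context (R : realType) (E : hilbertType R).
Implicit Types x y : E.

Lemma sqnormE x : (sqnorm x)%:C%C = `|x| ^+ 2.
Proof.
rewrite /sqnorm -dotE; have : 0 <= dot x x by rewrite dotE exprn_ge0.
by case: (dot x x) => a b; rewrite lecE/= => /andP[/eqP-> _].
Qed.

Lemma dot0l x : dot 0 x = 0. Proof. exact: pre_dot0l dot_linearl x. Qed.
Lemma dot0r x : dot x 0 = 0. Proof. by rewrite dotC dot0l conjC0. Qed.
Lemma dotDl x y z : dot (x + y) z = dot x z + dot y z.
Proof. exact: pre_dotDl dot_linearl _ _ _. Qed.
Lemma dotZl (a : R[i]) x y : dot (a *: x) y = a * dot x y.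
Proof. exact: pre_dotZl dot_linearl _ _ _. Qed.
Lemma dotDr x y z : dot x (y + z) = dot x y + dot x z.
Proof. exact: pre_dotDr dot_linearl dotC _ _ _. Qed.
Lemma dotZr (a : R[i]) x y : dot x (a *: y) = a^* * dot x y.
Proof. exact: pre_dotZr dot_linearl dotC _ _ _. Qed.

Lemma sqnorm_ge0 x : 0 <= sqnorm x.
Proof. by rewrite -ler0c sqnormE exprn_ge0. Qed.

Lemma sqnorm0 : sqnorm (0 : E) = 0.
Proof. by apply/complexI; rewrite sqnormE normr0 expr0n. Qed.

Lemma sqnorm_eq0 x : sqnorm x = 0 -> x = 0.
Proof.
move=> h; apply/normr0_eq0/eqP; rewrite -sqrf_eq0 -sqnormE h.
by apply/eqP.
Qed.

Lemma sqnormZ (a : R[i]) x :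
  sqnorm (a *: x) = complex.Re (`|a| ^+ 2) * sqnorm x.
Proof.
by apply/complexI; rewrite sqnormE normrZ exprMn -Re_normsq -sqnormE rmorphM.
Qed.

Lemma sqnormN x : sqnorm (- x) = sqnorm x.
Proof. by apply/complexI; rewrite !sqnormE normrN. Qed.

Lemma sqnormD_le x y : sqnorm (x + y) <= 2 * (sqnorm x + sqnorm y).
Proof.
rewrite -lecR rmorphM rmorph_nat rmorphD/= !sqnormE.
apply: (@le_trans _ _ ((`|x| + `|y|) ^+ 2)).
  by rewrite ler_sqr ?nnegrE ?addr_ge0// ler_normD.
rewrite -subr_ge0.
have -> : 2 * (`|x| ^+ 2 + `|y| ^+ 2) - (`|x| + `|y|) ^+ 2 =
  (`|x| - `|y|) ^+ 2 :> R[i] by ring.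
by apply: real_exprn_even_ge0 => //; apply: rpredB; apply: ger0_real.
Qed.

Lemma CauchySchwarz_dot x y : `|dot x y| <= `|x| * `|y|.
Proof.
rewrite -ler_sqr ?nnegrE ?mulr_ge0// exprMn -!dotE.
apply: (pre_CS dot_linearl dotC) => z; first by rewrite dotE exprn_ge0.
by rewrite dotE => /eqP; rewrite sqrf_eq0 normr_eq0 => /eqP.
Qed.

Lemma norm_dot_le x y : `|dot x y| <= (sqnorm x + sqnorm y)%:C%C.
Proof.
rewrite rmorphD/= !sqnormE (le_trans (CauchySchwarz_dot _ _))//.
rewrite -subr_ge0.
have -> : `|x| ^+ 2 + `|y| ^+ 2 - `|x| * `|y| =
   ((`|x| - `|y|) ^+ 2 + `|x| ^+ 2 + `|y| ^+ 2) / 2 :> R[i] by field.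
apply: divr_ge0 => //; apply: addr_ge0; last exact: exprn_ge0.
apply: addr_ge0; last exact: exprn_ge0.
by apply: real_exprn_even_ge0 => //; apply: rpredB; apply: ger0_real.
Qed.

Lemma hilbert_complete (u : nat -> E) :
  (forall e : R, 0 < e -> exists N, forall m n, (N <= m)%N -> (N <= n)%N ->
    sqnorm (u m - u n) <= e) ->
  exists l, forall e : R, 0 < e -> exists N, forall n, (N <= n)%N ->
    sqnorm (u n - l) <= e.
Proof.
have key (x y : E) (e : R[i]) : 0 < e -> 
    sqnorm (x - y) <= (complex.Re e / 2) ^+ 2 -> `|x - y| < e.
  case: e => a b; rewrite ltcE/= => /andP[/eqP-> a0] h.
  have : `|x - y| <= (a / 2)%:C%C.
    rewrite -ler_sqr ?nnegrE ?ler0c ?divr_ge0 ?(ltW a0) ?ler0n//.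
    by rewrite -sqnormE -rmorphXn lecR.
  move=> /le_lt_trans; apply; rewrite ltcE/= eqxx/=; lra.
move=> uC.
have /cauchy_cvgP/cvg_ex[l /cvg_ballP ul] : cauchy (u @ \oo).
  apply/cauchyP => e e0.
  have e2 : 0 < (complex.Re e / 2) ^+ 2.
    by move: e0; case: e => a b; rewrite ltcE/= => /andP[_ a0]; rewrite exprn_gt0// divr_gt0// ltr0n.
  have [N hN] := uC _ e2.
  exists (u N), N => // n /= nN; rewrite -ball_normE/=; exact/key/hN.
exists l => e e0.
have s0 : 0 < (Num.sqrt e)%:C%C :> R[i] by rewrite ltcE/= eqxx sqrtr_gt0.
have [N _ hN] := ul _ s0.
exists N => n nN; have := hN n nN.
rewrite /= -ball_normE/= distrC => /ltW h.
rewrite -lecR sqnormE -[leRHS](_ : (Num.sqrt e)%:C%C ^+ 2 = _); last first.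
  by rewrite -rmorphXn/= sqr_sqrtr// ltW.
by rewrite ler_sqr ?nnegrE ?ler0c ?sqrtr_ge0.
Qed.

End HilbertTheory.

(* For linear maps, continuity is boundedness, cf. [linear_bounded_continuous]. *)
Record bop (R : realType) (U V : hilbertType R) := Bop {
  bop_fun :> U -> V;
  bop_linear : linear bop_fun;
  bop_continuous : continuous bop_fun }.

HB.instance Definition _ (R : realType) (U V : hilbertType R) (T : bop U V) :=
  GRing.isLinear.Build R[i] U V _ T (@bop_linear _ _ _ T).
HB.instance Definition _ (R : realType) (U V : hilbertType R) :=
  gen_eqMixin (bop U V).
HB.instance Definition _ (R : realType) (U V : hilbertType R) :=
  gen_choiceMixin (bop U V).

Section BoundedOperators.
Context (R : realType).
Implicit Types U V W : hilbertType R.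

Definition sqbounded U V (f : U -> V) :=
  exists M : R, forall x, sqnorm (f x) <= M * sqnorm x.

Lemma sqbounded_continuous U V (f : U -> V) :
  linear f -> sqbounded f -> continuous f.
Proof.
move=> lf [M hM].
pose F : {linear U -> V} := HB.pack f (GRing.isLinear.Build _ _ _ _ f lf).
apply: (@bounded_linear_continuous _ _ _ F).
apply/ex_bound; exists (Num.sqrt `|M|)%:C%C.
apply/nbhs_norm0P; exists 1 => //= x /ltW x1.
rewrite /mkset /=.
rewrite -ler_sqr ?nnegrE ?ler0c ?sqrtr_ge0// -sqnormE.
rewrite -rmorphXn/= sqr_sqrtr// lecR (le_trans (hM x))//.
have s1 : sqnorm x <= 1.
  rewrite -lecR sqnormE; apply: (@le_trans _ _ (1 ^+ 2)); last by rewrite expr1n.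
  by rewrite ler_sqr ?nnegrE.
apply: (@le_trans _ _ (`|M| * sqnorm x)).
  by rewrite ler_wpM2r ?sqnorm_ge0 ?ler_norm.
by rewrite ler_piMr.
Qed.

Lemma bop_sqbounded U V (T : bop U V) : sqbounded T.
Proof.
have /linear_bounded_continuous/linear_boundedP := @bop_continuous _ _ _ T.
move=> [M [_ hM]].
exists (complex.Re (`|M + 1| ^+ 2)) => x.
rewrite -lecR rmorphM/= Re_normsq !sqnormE -exprMn.
have h := hM (M + 1); move: h => /(_ _ x) h.
have {h}h : `|T x| <= (M + 1) * `|x| by apply: h; rewrite ltrDl.
rewrite ler_sqr ?nnegrE ?mulr_ge0// -[X in _ * X]normr_id -normrM ger0_norm//.
exact: le_trans h.
Qed.

End BoundedOperators.

(* The alias carries the Hilbert norm; the library's norm on U * V is the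
   maximum norm. *)
Definition hsum (R : realType) (U V : hilbertType R) : Type := (U * V)%type.

Section DirectSum.
Context (R : realType) (U V : hilbertType R).

HB.instance Definition _ := GRing.Lmodule.copy (hsum U V) (U * V)%type.

Definition hpair (x : U) (y : V) : hsum U V := (x, y).

Definition hsum_dot (x y : hsum U V) : R[i] := dot x.1 y.1 + dot x.2 y.2.

Lemma hsum_dot_linearl a x y z :
  hsum_dot (a *: x + y) z = a * hsum_dot x z + hsum_dot y z.
Proof. by rewrite /hsum_dot !dot_linearl mulrDr addrACA. Qed.

Lemma hsum_dotC x y : hsum_dot x y = (hsum_dot y x)^*.
Proof. by rewrite /hsum_dot rmorphD/= -!dotC. Qed.

Lemma hsum_dot_ge0 x : 0 <= hsum_dot x x.
Proof. by rewrite addr_ge0// dotE exprn_ge0. Qed.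

Lemma hsum_dot_eq0 x : hsum_dot x x = 0 -> x = 0.
Proof.
rewrite /hsum_dot !dotE => /eqP; rewrite paddr_eq0 ?exprn_ge0//.
rewrite !sqrf_eq0 !normr_eq0 => /andP[/eqP x1 /eqP x2].
by case: x x1 x2 => x y /= -> ->.
Qed.

Lemma hsum_dot_complete (u : nat -> hsum U V) :
  (forall e : R, 0 < e -> exists N, forall m n, (N <= m)%N -> (N <= n)%N ->
     complex.Re (hsum_dot (u m - u n) (u m - u n)) <= e) ->
  exists l, forall e : R, 0 < e -> exists N, forall n, (N <= n)%N ->
     complex.Re (hsum_dot (u n - l) (u n - l)) <= e.
Proof.
have sqE (x : hsum U V) : complex.Re (hsum_dot x x) = sqnorm x.1 + sqnorm x.2.
  by rewrite /hsum_dot raddfD.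
move=> uC.
have [|l1 h1] := @hilbert_complete _ U (fun n => (u n).1).
  move=> e /uC[N hN]; exists N => m n mN nN; apply: le_trans (hN m n mN nN).
  by rewrite sqE lerDl sqnorm_ge0.
have [|l2 h2] := @hilbert_complete _ V (fun n => (u n).2).
  move=> e /uC[N hN]; exists N => m n mN nN; apply: le_trans (hN m n mN nN).
  by rewrite sqE lerDr sqnorm_ge0.
exists (hpair l1 l2) => e e0; have e2 : 0 < e / 2 by rewrite divr_gt0.
have [N1 {}h1] := h1 _ e2; have [N2 {}h2] := h2 _ e2.
exists (maxn N1 N2) => n; rewrite geq_max => /andP[n1 n2].
by rewrite sqE (splitr e) lerD// ?h1 ?h2.
Qed.

HB.instance Definition _ := Lmodule_isHilbert.Build R (hsum U V)
  hsum_dot_linearl hsum_dotC hsum_dot_ge0 hsum_dot_eq0 hsum_dot_complete.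

Lemma sqnorm_hsum (x : hsum U V) : sqnorm x = sqnorm x.1 + sqnorm x.2.
Proof. by rewrite /sqnorm -raddfD. Qed.

End DirectSum.

Section ClosedRange.
Context (R : realType) (U V : hilbertType R) (T : bop U V).

Definition in_clran : {pred V} := fun y => `[< closure (range T) y >].

Lemma in_clranP y : reflect (forall e : R, 0 < e -> exists x, sqnorm (y - T x) <= e)
  (y \in in_clran).
Proof.
apply: (iffP (asboolP _)) => [cy e e0|h B /nbhs_ballP[e/= e0 yB]].
  have s0 : 0 < (Num.sqrt e)%:C%C :> R[i] by rewrite ltcE/= eqxx sqrtr_gt0.
  have [_ [[x _ <-]]] := cy _ (nbhsx_ballx y _ s0).
  rewrite -ball_normE/= => yx; exists x; rewrite -lecR sqnormE.
  rewrite -[leRHS](_ : (Num.sqrt e)%:C%C ^+ 2 = _); last first.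
    by rewrite -rmorphXn/= sqr_sqrtr// ltW.
  by rewrite ler_sqr ?nnegrE ?ler0c ?sqrtr_ge0// ltW.
case: e e0 yB => a b; rewrite ltcE/= => /andP[/eqP-> a0] yB.
have [|x hx] := h ((a / 2) ^+ 2); first by rewrite exprn_gt0// divr_gt0.
exists (T x); split; first by exists x.
apply: yB; rewrite -ball_normE/=; apply: (@le_lt_trans _ _ (a / 2)%:C%C).
  rewrite -ler_sqr ?nnegrE ?ler0c ?divr_ge0 ?(ltW a0)//.
  by rewrite -sqnormE -rmorphXn lecR.
rewrite ltcE/= eqxx/=; lra.
Qed.

Lemma in_clran_submod : submod_closed in_clran.
Proof.
split=> [|a x y /in_clranP hx /in_clranP hy]; apply/in_clranP => e e0.
  by exists 0; rewrite linear0 subr0 sqnorm0 ltW.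
pose c := complex.Re (`|a| ^+ 2).
have c0 : 0 <= c by rewrite -ler0c Re_normsq exprn_ge0.
have [|x' hx'] := hx (e / 4 / (c + 1)); first by rewrite !divr_gt0// ltr_wpDl.
have [|y' hy'] := hy (e / 4); first by rewrite divr_gt0.
exists (a *: x' + y'); rewrite linearP opprD addrACA -scalerBr.
rewrite (le_trans (sqnormD_le _ _))// sqnormZ -/c.
have : c * sqnorm (x - T x') <= e / 4.
  apply: (@le_trans _ _ ((c + 1) * sqnorm (x - T x'))).
    by rewrite ler_wpM2r ?sqnorm_ge0// lerDl.
  by rewrite -ler_pdivlMl ?ltr_wpDl// mulrC.
lra.
Qed.
HB.instance Definition _ := GRing.isSubmodClosed.Build R[i] V in_clran in_clran_submod.

(* the closure of the range of T, as a Hilbert space *)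
Record clran := Clran { clran_val :> V; _ : clran_val \in in_clran }.
HB.instance Definition _ := [isSub for clran_val].
HB.instance Definition _ := [Choice of clran by <:].
HB.instance Definition _ := [SubChoice_isSubLmodule of clran by <:].

Definition clran_dot (x y : clran) : R[i] := dot (x : V) (y : V).

Lemma clran_dot_linearl a x y z :
  clran_dot (a *: x + y) z = a * clran_dot x z + clran_dot y z.
Proof. exact: dot_linearl. Qed.
Lemma clran_dotC x y : clran_dot x y = (clran_dot y x)^*.
Proof. exact: dotC. Qed.
Lemma clran_dot_ge0 x : 0 <= clran_dot x x.
Proof. by rewrite /clran_dot dotE exprn_ge0. Qed.
Lemma clran_dot_eq0 x : clran_dot x x = 0 -> x = 0.
Proof.
rewrite /clran_dot dotE => /eqP; rewrite sqrf_eq0 normr_eq0 => /eqP x0.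
exact: val_inj.
Qed.

Lemma clran_dot_complete (u : nat -> clran) :
  (forall e : R, 0 < e -> exists N, forall m n, (N <= m)%N -> (N <= n)%N ->
     complex.Re (clran_dot (u m - u n) (u m - u n)) <= e) ->
  exists l, forall e : R, 0 < e -> exists N, forall n, (N <= n)%N ->
     complex.Re (clran_dot (u n - l) (u n - l)) <= e.
Proof.
move=> uC; have [|l hl] := @hilbert_complete _ V (fun n => clran_val (u n)).
  by move=> e /uC[N hN]; exists N => m n mN nN; exact: hN.
suff lT : l \in in_clran by exists (Clran lT).
apply/in_clranP => e e0; have e4 : 0 < e / 4 by rewrite divr_gt0.
have [N hN] := hl _ e4; have /in_clranP/(_ _ e4)[x hx] := valP (u N).
exists x; rewrite -(subrKA (clran_val (u N))).
rewrite (le_trans (sqnormD_le _ _))// -(sqnormN (l - _)) opprB.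
have := hN N (leqnn N); move: hx; rewrite /=; lra.
Qed.

HB.instance Definition _ := Lmodule_isHilbert.Build R clran
  clran_dot_linearl clran_dotC clran_dot_ge0 clran_dot_eq0 clran_dot_complete.

Lemma mem_clran x : T x \in in_clran.
Proof. by apply/asboolP/subset_closure; exists x. Qed.
Definition clran_cor_fun (x : U) : clran := Clran (mem_clran x).
Lemma clran_cor_linear : linear clran_cor_fun.
Proof. by move=> a x y; apply: val_inj; rewrite /= linearP. Qed.
Lemma clran_cor_continuous : continuous clran_cor_fun.
Proof.
apply: (sqbounded_continuous clran_cor_linear).
by have [M hM] := bop_sqbounded T; exists M.
Qed.
(* T with codomain restricted to the closure of its range *)
Definition clran_cor := Bop clran_cor_linear clran_cor_continuous.

Lemma clran_val_linear : linear clran_val. Proof. by []. Qed.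
Lemma clran_val_continuous : continuous clran_val.
Proof.
apply: (sqbounded_continuous clran_val_linear).
by exists 1 => x; rewrite mul1r.
Qed.
Definition clran_incl := Bop clran_val_linear clran_val_continuous.

End ClosedRange.

Section SquareSummable.
Context (R : realType) (E : hilbertType R).
Implicit Types u v : nat -> E.

Definition square_summable u := cvgn (series (fun n => sqnorm (u n))).

Definition in_l2 : {pred nat -> E} := fun u => `[< square_summable u >].

Lemma in_l2P u : reflect (exists M, forall n, \sum_(i < n) sqnorm (u i) <= M)
  (u \in in_l2).
Proof.
apply: (iffP (asboolP _)) => [cu|[M hM]].
  have /cvg_seq_bounded/bounded_fun_has_ubound[M hM] := cu.
  by exists M => n; have := hM _ (ex_intro2 _ _ n I erefl); rewrite seriesEord.
apply: nondecreasing_is_cvgn.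
  by apply: nondecreasing_series => *; exact: sqnorm_ge0.
by exists M => _ [n _ <-]; rewrite seriesEord; exact: hM.
Qed.

Lemma in_l2_submod : submod_closed in_l2.
Proof.
split=> [|a u v /in_l2P[M hM] /in_l2P[N hN]]; apply/in_l2P.
  by exists 0 => n; rewrite big1// => i _; rewrite sqnorm0.
have c0 : 0 <= complex.Re (`|a| ^+ 2) by rewrite -ler0c Re_normsq exprn_ge0.
set c := complex.Re _ in c0; exists (2 * (c * M + N)) => n.
apply: (@le_trans _ _ (\sum_(i < n) 2 * (c * sqnorm (u i) + sqnorm (v i)))).
  by apply: ler_sum => i _; rewrite -sqnormZ; exact: sqnormD_le.
rewrite -mulr_sumr; apply: ler_wpM2l => //; rewrite big_split/= -mulr_sumr.
apply: lerD; [exact: (ler_wpM2l c0 (hM n))|exact: hN].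
Qed.
HB.instance Definition _ := GRing.isSubmodClosed.Build R[i] (nat -> E) in_l2 in_l2_submod.

Record l2 := L2 { l2_val :> nat -> E; _ : l2_val \in in_l2 }.
HB.instance Definition _ := [isSub for l2_val].
HB.instance Definition _ := [Choice of l2 by <:].
HB.instance Definition _ := [SubChoice_isSubLmodule of l2 by <:].

Definition l2_dot (u v : l2) : R[i] :=
  limn (series (fun n => dot (u n) (v n)) : nat -> R[i]^o).

Lemma cvgn_complex (z : nat -> R[i]) (a b : R) :
  (fun n => complex.Re (z n)) @ \oo --> a -> (fun n => complex.Im (z n)) @ \oo --> b ->
  (z : nat -> R[i]^o) @ \oo --> (Complex a b : R[i]^o).
Proof.
move=> /cvgrPdist_le za /cvgrPdist_le zb; apply/cvgrPdist_le => -[e e']/=.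
rewrite ltcE/= => /andP[/eqP-> e0]; have e2 : 0 < e / 2 by rewrite divr_gt0.
near=> n.
have h1 : `|a - complex.Re (z n)| <= e / 2 by near: n; exact: za.
have h2 : `|b - complex.Im (z n)| <= e / 2 by near: n; exact: zb.
case: (z n) h1 h2 => c d /= h1 h2.
have -> : Complex a b - Complex c d = (a - c)%:C%C + (b - d)%:C%C * 'i%C.
  by rewrite /real_complex_def; simpc.
rewrite (le_trans (ler_normD _ _))// normrM [`|'i%C|](_ : _ = 1); last first.
  by rewrite normc_def/= expr0n expr1n add0r sqrtr1.
rewrite mulr1 !normc_def/= !expr0n !addr0 !sqrtr_sqr -rmorphD lecR/=.
by rewrite (splitr e) lerD.
Unshelve. all: by end_near. Qed.

Lemma l2_dot_cvg (u v : l2) :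
  cvgn (series (fun n => dot (u n) (v n)) : nat -> R[i]^o).
Proof.
have /asboolP su := valP u; have /asboolP sv := valP v.
have cuv : cvgn (series (fun n => sqnorm (u n) + sqnorm (v n))).
  exact: (is_cvg_seriesD su sv).
have key (f : nat -> R) : (forall n, `|f n| <= sqnorm (u n) + sqnorm (v n)) ->
    cvgn (series f).
  move=> hf; apply: normed_cvg; apply: series_le_cvg cuv => //= n.
  by rewrite addr_ge0 ?sqnorm_ge0.
have h1 : cvgn (series (fun n => complex.Re (dot (u n) (v n)))).
  apply: key => n; rewrite -lecR (le_trans _ (norm_dot_le _ _))//.
  exact: normc_ge_Re.
have h2 : cvgn (series (fun n => complex.Im (dot (u n) (v n)))).
  apply: key => n; rewrite -lecR (le_trans _ (norm_dot_le _ _))//.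
  by rewrite normc_def lecR -sqrtr_sqr ler_wsqrtr// lerDr sqr_ge0.
apply/cvg_ex; exists (Complex (limn (series (fun n => complex.Re (dot (u n) (v n)))))
   (limn (series (fun n => complex.Im (dot (u n) (v n)))))).
apply: cvgn_complex.
  rewrite (_ : (fun n => _) = series (fun n => complex.Re (dot (u n) (v n))))//.
  by apply/funext => n; rewrite /series/= raddf_sum.
rewrite (_ : (fun n => _) = series (fun n => complex.Im (dot (u n) (v n))))//.
by apply/funext => n; rewrite /series/= raddf_sum.
Qed.

#[local] Arguments l2_dot_cvg : clear implicits.

Lemma l2_dot_linearl a (x y z : l2) :
  l2_dot (a *: x + y) z = a * l2_dot x z + l2_dot y z.
Proof.
apply: (@cvg_lim R[i]^o); first exact: norm_hausdorff.
rewrite (_ : series _ = (fun n => a *: (series (fun n => dot (x n) (z n)) n : R[i]^o)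
   + (series (fun n => dot (y n) (z n)) n : R[i]^o))); last first.
  apply/funext => n; rewrite /series/= scaler_sumr -big_split/=.
  by apply: eq_bigr => i _; rewrite dot_linearl.
apply: (@cvgD R[i] R[i]^o); last exact: (l2_dot_cvg y z).
exact: (@cvgZl_tmp R[i] R[i]^o _ _ _ _ _ _ (l2_dot_cvg x z)).
Qed.

Lemma l2_dotC (x y : l2) : l2_dot x y = (l2_dot y x)^*.
Proof.
apply: (@cvg_lim R[i]^o); first exact: norm_hausdorff.
have h := l2_dot_cvg y x; rewrite -[X in (X)^*]/(limn (series (fun n => dot (y n) (x n)) : nat -> R[i]^o)).
apply/(@cvgrPdist_le R[i] R[i]^o) => e e0; near=> n.
rewrite (_ : series _ n = (series (fun n => dot (y n) (x n)) n)^*); last first.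
  by rewrite /series/= rmorph_sum; apply: eq_bigr => i _; exact: dotC.
rewrite -rmorphB/= norm_conjC; near: n.
by move/(@cvgrPdist_le R[i] R[i]^o) : h; exact.
Unshelve. all: by end_near. Qed.

Lemma l2_dotE (x : l2) : l2_dot x x = (limn (series (fun n => sqnorm (x n))))%:C%C.
Proof.
have /asboolP sx := valP x.
apply: (@cvg_lim R[i]^o); first (exact: norm_hausdorff); rewrite (_ : series _ = fun n => (series (fun n => sqnorm (x n)) n)%:C%C); last first.
  apply/funext => n; rewrite /series/= rmorph_sum/=; apply: eq_bigr => i _.
  by rewrite sqnormE dotE.
apply: cvgn_complex => //=; exact: cvg_cst.
Qed.

Lemma l2_sum_le (x : l2) n : \sum_(i < n) sqnorm (x i) <= complex.Re (l2_dot x x).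
Proof.
rewrite l2_dotE/=; have /asboolP sx := valP x.
have h : nondecreasing_seq (series (fun n => sqnorm (x n))).
  by apply: nondecreasing_series => *; exact: sqnorm_ge0.
by apply: le_trans (nondecreasing_cvgn_le h sx n); rewrite seriesEord.
Qed.

Lemma l2_dot_le (x : l2) (e : R) : (forall n, \sum_(i < n) sqnorm (x i) <= e) ->
  complex.Re (l2_dot x x) <= e.
Proof.
move=> h; rewrite l2_dotE/=; have /asboolP sx := valP x.
by apply: limr_le => //; near=> n; rewrite seriesEord; exact: h.
Unshelve. all: by end_near. Qed.

Lemma l2_dot_ge0 (x : l2) : 0 <= l2_dot x x.
Proof.
have := l2_sum_le x 0; rewrite big_ord0 => h.
by rewrite l2_dotE ler0c; move: h; rewrite l2_dotE.
Qed.

Lemma l2_dot_eq0 (x : l2) : l2_dot x x = 0 -> x = 0.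
Proof.
move=> x0; apply/val_inj/funext => n; apply: sqnorm_eq0.
apply/eqP; rewrite eq_le sqnorm_ge0 andbT.
have := l2_sum_le x n.+1; rewrite x0/= big_ord_recr/=; apply: le_trans.
by rewrite lerDr sumr_ge0// => *; exact: sqnorm_ge0.
Qed.

Lemma l2_dot_complete (u : nat -> l2) :
  (forall e : R, 0 < e -> exists N, forall m n, (N <= m)%N -> (N <= n)%N ->
     complex.Re (l2_dot (u m - u n) (u m - u n)) <= e) ->
  exists l, forall e : R, 0 < e -> exists N, forall n, (N <= n)%N ->
     complex.Re (l2_dot (u n - l) (u n - l)) <= e.
Proof.
move=> uC.
have term (x : l2) n : sqnorm (x n) <= complex.Re (l2_dot x x).
  apply: le_trans (l2_sum_le x n.+1); rewrite big_ord_recr/= lerDr.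
  by apply: sumr_ge0 => *; exact: sqnorm_ge0.
have lim n : exists l, forall e : R, 0 < e -> exists N, forall k, (N <= k)%N ->
     sqnorm (u k n - l) <= e.
  apply: hilbert_complete => e /uC[N hN]; exists N => i j iN jN.
  exact: le_trans (term _ n) (hN _ _ iN jN).
have [l {}lim] := choice lim.
have fin m e : 0 < e -> exists N, forall k, (N <= k)%N ->
    \sum_(i < m) sqnorm (u k i - l i) <= e.
  elim: m e => [|m IHm] e e0; first by exists 0%N => k _; rewrite big_ord0 ltW.
  have e2 : 0 < e / 2 by rewrite divr_gt0.
  have [N1 h1] := IHm _ e2; have [N2 h2] := lim m (e / 2) e2.
  exists (maxn N1 N2) => k; rewrite geq_max => /andP[k1 k2].
  by rewrite big_ord_recr/= (splitr e) lerD ?h1 ?h2.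
have tail e : 0 < e -> exists N, forall k, (N <= k)%N -> forall m,
    \sum_(i < m) sqnorm (u k i - l i) <= e.
  move=> e0; have e4 : 0 < e / 4 by rewrite divr_gt0.
  have [N hN] := uC _ e4; exists N => k kN m.
  have [N' hN'] := fin m _ e4; pose j := maxn N N'.
  apply: (@le_trans _ _ (\sum_(i < m) 2 * (sqnorm ((u k - u j) i) + sqnorm (u j i - l i)))).
    apply: ler_sum => i _; rewrite -(subrKA (u j i)); exact: sqnormD_le.
  rewrite -mulr_sumr big_split/=.
  have := hN' j (leq_maxr _ _).
  have := le_trans (l2_sum_le (u k - u j) m) (hN _ _ kN (leq_maxl _ _)).
  rewrite -/j; lra.
have lin : l \in in_l2.
  have [N hN] := tail 1 ltr01.
  have : (u N : nat -> E) - l \in in_l2 by apply/in_l2P; exists 1; exact: hN.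
  move=> h; rewrite (_ : l = (u N : nat -> E) - ((u N : nat -> E) - l)); last by rewrite subKr.
  by apply: rpredB => //; exact: valP.
exists (L2 lin) => e e0; have [N hN] := tail _ e0; exists N => n nN.
apply: l2_dot_le; exact: hN.
Qed.

HB.instance Definition _ := Lmodule_isHilbert.Build R l2
  l2_dot_linearl l2_dotC l2_dot_ge0 l2_dot_eq0 l2_dot_complete.
End SquareSummable.

Section BoundedLinear.
Context (R : realType).
Implicit Types U V W E : hilbertType R.

Definition bounded_linear U V (f : U -> V) := linear f /\ sqbounded f.

Definition bop_of U V (f : U -> V) (fB : bounded_linear f) : bop U V :=
  Bop fB.1 (sqbounded_continuous fB.1 fB.2).

Lemma bounded_linear_bop U V (T : bop U V) : bounded_linear T.
Proof. by split; [exact: bop_linear|exact: bop_sqbounded]. Qed.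

Lemma bounded_linear0 U V : bounded_linear (fun _ : U => 0 : V).
Proof.
split=> [a x y|]; first by rewrite scaler0 addr0.
by exists 0 => x; rewrite sqnorm0 mul0r.
Qed.

Lemma bounded_linear_id U : bounded_linear (fun x : U => x).
Proof. by split=> //; exists 1 => x; rewrite mul1r. Qed.

Lemma bounded_linear_comp U V W (f : V -> W) (g : U -> V) :
  bounded_linear f -> bounded_linear g -> bounded_linear (fun x => f (g x)).
Proof.
move=> [lf [M hM]] [lg [N hN]]; split=> [a x y|]; first by rewrite lg lf.
exists (`|M| * N) => x; rewrite (le_trans (hM _))// -mulrA.
apply: (@le_trans _ _ (`|M| * sqnorm (g x))).
  by rewrite ler_wpM2r ?sqnorm_ge0// ler_norm.
by rewrite ler_wpM2l.
Qed.

Lemma bounded_linearD U V (f g : U -> V) :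
  bounded_linear f -> bounded_linear g -> bounded_linear (fun x => f x + g x).
Proof.
move=> [lf [M hM]] [lg [N hN]]; split=> [a x y|].
  by rewrite lf lg scalerDr addrACA.
exists (2 * (M + N)) => x.
rewrite (le_trans (sqnormD_le _ _))// -mulrA ler_wpM2l// mulrDl.
exact: lerD.
Qed.

Lemma bounded_linearN U V (f : U -> V) :
  bounded_linear f -> bounded_linear (fun x => - f x).
Proof.
move=> [lf [M hM]]; split=> [a x y|]; first by rewrite lf opprD scalerN.
by exists M => x; rewrite sqnormN.
Qed.

Lemma bounded_linear_pair U V W (f : U -> V) (g : U -> W) :
  bounded_linear f -> bounded_linear g ->
  bounded_linear (fun x => hpair (f x) (g x)).
Proof.
move=> [lf [M hM]] [lg [N hN]]; split=> [a x y|]; first by rewrite lf lg.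
by exists (M + N) => x; rewrite sqnorm_hsum/= mulrDl; exact: lerD.
Qed.

Lemma bounded_linear_fst U V : bounded_linear (fun x : hsum U V => x.1).
Proof.
by split=> //; exists 1 => x; rewrite mul1r sqnorm_hsum lerDl sqnorm_ge0.
Qed.

Lemma bounded_linear_snd U V : bounded_linear (fun x : hsum U V => x.2).
Proof.
by split=> //; exists 1 => x; rewrite mul1r sqnorm_hsum lerDr sqnorm_ge0.
Qed.

Lemma bounded_linear_coord E n : bounded_linear (fun a : l2 E => a n).
Proof.
split=> //; exists 1 => x; rewrite mul1r.
apply: le_trans (l2_sum_le x n.+1); rewrite big_ord_recr/= lerDr.
by apply: sumr_ge0 => *; exact: sqnorm_ge0.
Qed.

End BoundedLinear.

Section SequenceOperations.
Context (R : realType) (E : hilbertType R).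

Definition cons_seq (x : E) (a : nat -> E) n := if n is k.+1 then a k else x.

Lemma cons_seq_sum (x : E) (a : l2 E) n :
  \sum_(i < n) sqnorm (cons_seq x a i) <= sqnorm x + sqnorm a.
Proof.
case: n => [|n]; first by rewrite big_ord0 addr_ge0 ?sqnorm_ge0.
by rewrite big_ord_recl/= lerD2l; exact: l2_sum_le.
Qed.

Lemma cons_seq_l2 (x : E) (a : l2 E) : cons_seq x a \in @in_l2 R E.
Proof. by apply/in_l2P; exists (sqnorm x + sqnorm a); exact: cons_seq_sum. Qed.

(* (x, a_0, a_1, ...) *)
Definition l2_cons (x : E) (a : l2 E) : l2 E := L2 (cons_seq_l2 x a).

(* (x, 0, 0, ...) *)
Definition l2_single (x : E) : l2 E := l2_cons x 0.

Lemma tail_seq_sum (a : l2 E) n : \sum_(i < n) sqnorm (a i.+1) <= sqnorm a.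
Proof.
apply: le_trans (l2_sum_le a n.+1); rewrite big_ord_recl/= lerDr.
exact: sqnorm_ge0.
Qed.

Lemma tail_seq_l2 (a : l2 E) : (fun n => a n.+1) \in @in_l2 R E.
Proof. by apply/in_l2P; exists (sqnorm a); exact: tail_seq_sum. Qed.

(* (a_1, a_2, ...) *)
Definition l2_tail (a : l2 E) : l2 E := L2 (tail_seq_l2 a).

Lemma map_seq_sum (F : hilbertType R) (T : bop E F) : exists M,
  forall (a : l2 E) n, \sum_(i < n) sqnorm (T (a i)) <= M * sqnorm a.
Proof.
have [M hM] := bop_sqbounded T; exists `|M| => a n.
apply: (@le_trans _ _ (\sum_(i < n) `|M| * sqnorm (a i))).
  apply: ler_sum => i _; rewrite (le_trans (hM _))// ler_wpM2r ?sqnorm_ge0//.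
  exact: ler_norm.
by rewrite -mulr_sumr ler_wpM2l//; exact: l2_sum_le.
Qed.

Lemma map_seq_l2 (F : hilbertType R) (T : bop E F) (a : l2 E) :
  (fun n => T (a n)) \in @in_l2 R F.
Proof.
by have [M hM] := map_seq_sum T; apply/in_l2P; exists (M * sqnorm a) => n.
Qed.

(* (T a_0, T a_1, ...) *)
Definition l2_map (F : hilbertType R) (T : bop E F) (a : l2 E) : l2 F :=
  L2 (map_seq_l2 T a).

Lemma bounded_linear_cons (U : hilbertType R) (f : U -> E) (g : U -> l2 E) :
  bounded_linear f -> bounded_linear g ->
  bounded_linear (fun x => l2_cons (f x) (g x)).
Proof.
move=> [lf [M hM]] [lg [N hN]]; split=> [a x y|].
  by apply/val_inj/funext => -[|n]; rewrite /= ?lf ?lg.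
exists (M + N) => x; apply: l2_dot_le => n; rewrite mulrDl.
apply: le_trans (cons_seq_sum (f x) (g x) n) _; exact: lerD.
Qed.

Lemma bounded_linear_tail : bounded_linear l2_tail.
Proof.
split=> [a x y|]; first exact/val_inj/funext.
by exists 1 => x; rewrite mul1r; apply: l2_dot_le => n; exact: tail_seq_sum.
Qed.

Lemma bounded_linear_map (F : hilbertType R) (T : bop E F) :
  bounded_linear (l2_map T).
Proof.
split=> [a x y|]; first by apply/val_inj/funext => n /=; rewrite linearP.
have [M hM] := map_seq_sum T; exists M => x; apply: l2_dot_le => n; exact: hM.
Qed.

End SequenceOperations.

Section Adjoint.
Context (R : realType).

Definition bop0 (U V : hilbertType R) : bop U V :=
  bop_of (bounded_linear0 U V).

(* The default value of xget is never taken: the adjoint exists and is unique by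
   the Riesz representation theorem. *)
Definition adj (U V : hilbertType R) (T : bop U V) : bop V U :=
  xget (bop0 V U) [set S | forall x y, dot (T x) y = dot x (S y)].

Definition normal_op (H : hilbertType R) (T : bop H H) :=
  forall x, T (adj T x) = adj T (T x).

(* Likewise the positive square root exists and is unique for T >= 0. On a
   complex space, 0 <= dot (S x) x for all x entails that S is self-adjoint. *)
Definition pos_sqrt (H : hilbertType R) (T : bop H H) : bop H H :=
  xget (bop0 H H) [set S | (forall x, 0 <= dot (S x) x) /\
                           (forall x, S (S x) = T x)].

Context (H : hilbertType R) (P : bop H H).

Lemma bounded_linear_defect : bounded_linear (fun x => x - adj P (P x)).
Proof.
apply: bounded_linearD; first exact: bounded_linear_id.
apply/bounded_linearN/(bounded_linear_comp (bounded_linear_bop _)).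
exact: bounded_linear_bop.
Qed.

(* (I - P^* P)^(1/2); for the defect operator of P^*, use [defect_op (adj P)],
   which is (I - P P^* )^(1/2) since P^** = P. *)
Definition defect_op : bop H H := pos_sqrt (bop_of bounded_linear_defect).
End Adjoint.

Notation defect_space P := (clran (defect_op P)).

Notation triC R := (R[i]^o * R[i]^o * R[i]^o)%type.

Section Tetrablock.
Context (R : realType).

Definition euclid_norm n (v : 'cV[R[i]]_n) : R :=
  Num.sqrt (\sum_i complex.Re `|v i 0| ^+ 2).

Definition mx_opnorm n (A : 'M[R[i]]_n) : R :=
  sup [set euclid_norm (A *m v) | v in [set v | euclid_norm v <= 1]].

Definition tetrablock : set (triC R) :=
  [set z | exists2 A : 'M[R[i]]_2, mx_opnorm A < 1 &
           z = (A 0 0, A 1 1, \det A)].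

(* Differentiability is over R[i], so the third condition is about functions
   continuous on the closure and holomorphic inside. *)
Definition closed_boundary (B : set (triC R)) :=
  [/\ closed B, B `<=` closure tetrablock &
      forall f : triC R -> R[i]^o,
        {within closure tetrablock, continuous f} ->
        (forall z, tetrablock z -> differentiable f z) ->
        exists2 w, B w & forall z, closure tetrablock z -> `|f z| <= `|f w|].

(* [smallest C set0] is the intersection of all the sets satisfying C, hence the
   least of them, which exists by Shilov's theorem. *)
Definition distinguished_boundary : set (triC R) :=
  smallest closed_boundary set0.

End Tetrablock.

Section TaylorSpectrum.
Context (R : realType) (H : hilbertType R).

(* Exactness of the Koszul complex 0 -> H -> H^3 -> H^3 -> H -> 0 of a commuting
   triple, with H^3 indexed by e1, e2, e3 and by e12, e13, e23; the composites
   being zero by commutation, only ker <= im is required. *)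
Definition koszul_exact (S1 S2 S3 : H -> H) :=
  [/\ forall x, S1 x = 0 -> S2 x = 0 -> S3 x = 0 -> x = 0,
      forall x1 x2 x3,
        S1 x2 - S2 x1 = 0 -> S1 x3 - S3 x1 = 0 -> S2 x3 - S3 x2 = 0 ->
        exists x, [/\ x1 = S1 x, x2 = S2 x & x3 = S3 x],
      forall x12 x13 x23, S1 x23 - S2 x13 + S3 x12 = 0 ->
        exists x1 x2 x3, [/\ x12 = S1 x2 - S2 x1, x13 = S1 x3 - S3 x1 &
                             x23 = S2 x3 - S3 x2] &
      forall y, exists x12 x13 x23, y = S1 x23 - S2 x13 + S3 x12].

Definition taylor_spectrum (T1 T2 T3 : H -> H) : set (triC R) :=
  [set z | ~ koszul_exact (fun x => T1 x - (z.1.1 : R[i]) *: x)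
                          (fun x => T2 x - (z.1.2 : R[i]) *: x)
                          (fun x => T3 x - (z.2 : R[i]) *: x)].

Definition commuting_triple (T1 T2 T3 : H -> H) :=
  [/\ forall x, T1 (T2 x) = T2 (T1 x), forall x, T1 (T3 x) = T3 (T1 x) &
      forall x, T2 (T3 x) = T3 (T2 x)].

(* p(A, B, P) for a commuting triple *)
Definition poly_op (p : mpoly.mpoly 3 R[i]) (A B P : H -> H) (h : H) : H :=
  \sum_(m <- mpoly.msupp p) mpoly.mcoeff m p *:
    let e i := nth 0%N (mpoly.multinom_val m) i in
    iter (e 0%N) A (iter (e 1%N) B (iter (e 2%N) P h)).

Definition poly_eval (p : mpoly.mpoly 3 R[i]) (z : triC R) : R[i] :=
  mpoly.meval (fun i : 'I_3 => nth 0 [:: z.1.1; z.1.2; z.2] i) p.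

Definition opnorm (T : H -> H) : R :=
  sup [set complex.Re `|T x| | x in [set x | `|x| <= 1]].

Definition tetrablock_contraction (A B P : bop H H) :=
  [/\ commuting_triple A B P,
      taylor_spectrum A B P `<=` closure (tetrablock (R := R)) &
      forall p, opnorm (poly_op p A B P) <=
        sup [set complex.Re `|poly_eval p z| | z in closure (tetrablock (R := R))]].

Definition commutator (X Y : H -> H) (x : H) : H := X (Y x) - Y (X x).

(* In D_P F D_P, the inner D_P is the map from H to its closed range and the
   outer one is restricted to it. *)
Definition fundamental_operators (A B P : bop H H)
    (F1 F2 : bop (defect_space P) (defect_space P)) :=
  (forall h, A h - adj B (P h) = defect_op P (F1 (clran_cor (defect_op P) h))) /\
  (forall h, B h - adj A (P h) = defect_op P (F2 (clran_cor (defect_op P) h))).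

Definition tetrablock_unitary (N1 N2 N3 : bop H H) :=
  [/\ commuting_triple N1 N2 N3, [/\ normal_op N1, normal_op N2 & normal_op N3] &
      taylor_spectrum N1 N2 N3 `<=` distinguished_boundary (R := R)].

Definition is_orth_proj (M : set H) (x y : H) :=
  M y /\ forall z, M z -> dot (x - y) z = 0.

End TaylorSpectrum.

Definition tetrablock_unitary_dilation (R : realType) (H K : hilbertType R)
    (iota : H -> K) (A B P : bop H H) (N1 N2 N3 : bop K K) :=
  [/\ linear iota, forall h, `|iota h| = `|h|, tetrablock_unitary N1 N2 N3 &
      forall m n l h, is_orth_proj (range iota)
        (iter m N1 (iter n N2 (iter l N3 (iota h))))
        (iota (iter m A (iter n B (iter l P h))))].

Section Construction.
Context (R : realType).

Section BlockTriangular.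
Context (U W : hilbertType R) (V : bop U U) (C : bop W U) (D : bop W W).

(* ((V, C), (0, D)) *)
Definition block_ut_fun (x : hsum U W) : hsum U W :=
  hpair (V x.1 + C x.2) (D x.2).

Lemma bounded_linear_block_ut : bounded_linear block_ut_fun.
Proof.
apply: bounded_linear_pair; first apply: bounded_linearD.
- exact: bounded_linear_comp (bounded_linear_bop V) (bounded_linear_fst _ _).
- exact: bounded_linear_comp (bounded_linear_bop C) (bounded_linear_snd _ _).
- exact: bounded_linear_comp (bounded_linear_bop D) (bounded_linear_snd _ _).
Qed.

Definition block_ut : bop (hsum U W) (hsum U W) :=
  bop_of bounded_linear_block_ut.
End BlockTriangular.

Section D.
Context (E : hilbertType R) (G G' : bop E E).

(* (G^* a_0 + G' a_1, G^* a_1 + G' a_2, ...) *)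
Definition D_fun (a : l2 E) : l2 E := l2_map (adj G) a + l2_map G' (l2_tail a).

Lemma bounded_linear_D : bounded_linear D_fun.
Proof.
apply: bounded_linearD; first exact: bounded_linear_map.
apply: bounded_linear_comp; first exact: bounded_linear_map.
exact: bounded_linear_tail.
Qed.

Definition D_op : bop (l2 E) (l2 E) := bop_of bounded_linear_D.

Definition shift_op : bop (l2 E) (l2 E) := bop_of (bounded_linear_tail E).
End D.

Context (H : hilbertType R) (P : bop H H).
Local Notation DP := (defect_space P).
Local Notation DPs := (defect_space (adj P)).
Local Notation Ht := (hsum H (l2 DP)).

Section V.
Context (T : bop H H) (F F' : bop DP DP).

(* T h (+) (F'^* D_P h + F a_0, F'^* a_0 + F a_1, F'^* a_1 + F a_2, ...) *)
Definition V_fun (x : Ht) : Ht :=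
  hpair (T x.1)
    (l2_map (adj F') (l2_cons (clran_cor (defect_op P) x.1) x.2) + l2_map F x.2).

Lemma bounded_linear_V : bounded_linear V_fun.
Proof.
apply: bounded_linear_pair.
  exact: bounded_linear_comp (bounded_linear_bop T) (bounded_linear_fst _ _).
apply: bounded_linearD; last first.
  exact: bounded_linear_comp (bounded_linear_map F) (bounded_linear_snd _ _).
apply: bounded_linear_comp; first exact: bounded_linear_map.
apply: bounded_linear_cons; last exact: bounded_linear_snd.
apply: bounded_linear_comp (bounded_linear_fst _ _).
exact: bounded_linear_bop.
Qed.

Definition V_op : bop Ht Ht := bop_of bounded_linear_V.
End V.

(* P h (+) (D_P h, a_0, a_1, ...) *)
Definition V3_fun (x : Ht) : Ht :=
  hpair (P x.1) (l2_cons (clran_cor (defect_op P) x.1) x.2).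

Lemma bounded_linear_V3 : bounded_linear V3_fun.
Proof.
apply: bounded_linear_pair.
  exact: bounded_linear_comp (bounded_linear_bop P) (bounded_linear_fst _ _).
apply: bounded_linear_cons; last exact: bounded_linear_snd.
apply: bounded_linear_comp (bounded_linear_fst _ _).
exact: bounded_linear_bop.
Qed.

Definition V3_op : bop Ht Ht := bop_of bounded_linear_V3.

(* P^* as a map from the defect space of P^* to that of P. For a contraction P,
   P^* D_{P^*} = D_P P^*, so P^* x lies in the defect space of P already; the
   adjoint of the inclusion is the orthogonal projection onto that space, and
   only serves to change the codomain. *)
Definition Pstar_restr (x : DPs) : DP :=
  adj (clran_incl (defect_op P)) (adj P (x : H)).

Lemma bounded_linear_Pstar_restr : bounded_linear Pstar_restr.
Proof.
apply: (bounded_linear_comp (bounded_linear_bop _)).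
apply: (bounded_linear_comp (bounded_linear_bop _)).
exact: (bounded_linear_bop (clran_incl _)).
Qed.

Section C.
Context (F : bop DP DP) (G : bop DPs DPs).

(* D_{P^*} G a_0 (+) (- F^* P^* a_0, 0, 0, ...) *)
Definition C_fun (a : l2 DPs) : Ht :=
  hpair (defect_op (adj P) (G (a 0%N)))
        (l2_single (- adj F (Pstar_restr (a 0%N)))).

Lemma bounded_linear_C : bounded_linear C_fun.
Proof.
have c0 := bounded_linear_coord DPs 0.
apply: bounded_linear_pair.
  apply: (bounded_linear_comp (bounded_linear_bop _)).
  apply: (bounded_linear_comp (bounded_linear_bop (clran_incl _))).
  exact: (bounded_linear_comp (bounded_linear_bop _)).
apply: bounded_linear_cons; last exact: bounded_linear0.
apply/bounded_linearN/(bounded_linear_comp (bounded_linear_bop _)).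
exact: (bounded_linear_comp bounded_linear_Pstar_restr).
Qed.

Definition C_op : bop (l2 DPs) Ht := bop_of bounded_linear_C.
End C.

(* D_{P^*} a_0 (+) (- P^* a_0, 0, 0, ...) *)
Definition C3_fun (a : l2 DPs) : Ht :=
  hpair (defect_op (adj P) (a 0%N)) (l2_single (- Pstar_restr (a 0%N))).

Lemma bounded_linear_C3 : bounded_linear C3_fun.
Proof.
have c0 := bounded_linear_coord DPs 0.
apply: bounded_linear_pair.
  apply: (bounded_linear_comp (bounded_linear_bop _)).
  exact: (bounded_linear_comp (bounded_linear_bop (clran_incl _))).
apply: bounded_linear_cons; last exact: bounded_linear0.
exact/bounded_linearN/(bounded_linear_comp bounded_linear_Pstar_restr).
Qed.

Definition C3_op : bop (l2 DPs) Ht := bop_of bounded_linear_C3.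

End Construction.

(* Main.v *)
(* U is the minimal unitary extension of the isometry V3 (Schaeffer's matrix), R1
   and R2 commute with U, and a direct computation with the fundamental operators
   gives R1 R2 = R2 R1 and R1 = R2^* U on Ht = H (+) l2(D_P).  For every k, the
   distance of U^n k to Ht tends to 0, so that both relations, and more generally
   any norm inequality between operators commuting with U, extend from Ht to the
   whole space; in particular no commutation relation between G1 and G2 has to be
   established.  The relations R1 = R2^* U and R2 = R1^* U make R1 and R2 normal.

   At a point z outside { |z3| = 1, |z2| <= 1, z1 = conj z2 * z3 }, the operators
   R1 - z1, R2 - z2, U - z3 are jointly bounded below, hence the Koszul complex is
   exact.  The only delicate case is |z2| > 1, |z3| = 1: on Ht, an approximate
   eigenvector h (+) a of V3 and V2 satisfies Bh ~ z2 h and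
   (F2 + z3 F1^* ) a_n ~ z2 a_n, which contradicts |B| <= 1 and the numerical radius
   bound w(F2 + z3 F1^* ) <= 1.  The latter comes from the von Neumann inequality for
   the functions (a - wp) / (1 - wb), approximated by polynomials.  Finally every
   point of that set is a peak point, so it lies in the distinguished boundary. *)
Require Import Defs.
From HB Require Import structures.
From mathcomp Require Import all_boot all_order all_algebra.
From mathcomp Require Import complex.
From mathcomp Require Import all_classical all_reals all_analysis.
From mathcomp Require mpoly.
From mathcomp Require Import ring lra.
Set Implicit Arguments.
Unset Strict Implicit.
Unset Printing Implicit Defensive.
Import Order.TTheory GRing.Theory Num.Theory.
Import numFieldNormedType.Exports.
Local Open Scope classical_set_scope.
Local Open Scope ring_scope.

(** * Riesz representation and adjoints *)

(** [adj] and [pos_sqrt] are choices with a default value, so nothing can be said of them before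
    adjoints and positive roots are constructed; uniqueness of the root then carries P D_P = D_{P^*}
    P from the constructed root to the chosen one. From there on D_P, D_{P^*} and the restriction of
    P^* are replaced by abstract maps [d], [d'], [Q] subject to the unitarity of the Julia operator:
    factors [d'] and [adj d] can be cancelled, and exchanging the indices 1 and 2 or passing to
    adjoints is a substitution. Normality needs no Fuglede theorem, since the two relations with U
    give the adjoints explicitly: R1^* = R2 U^* and R2^* = R1 U^*. The obstacle in the spectral part
    is that no bound on the norm of R2 is at hand. The lower bound is therefore joint with U - z3:
    near an approximate eigenvector of U the shift S in F1^* S + F2 may be replaced by the number
    z3, which leaves a single operator on D_P. *)

Section InnerProduct.
Context (R : realType) (E : hilbertType R).
Implicit Types x y z : E.

Lemma dotNl x y : dot (- x) y = - dot x y.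
Proof. by rewrite -scaleN1r dotZl mulN1r. Qed.

Lemma dotNr x y : dot x (- y) = - dot x y.
Proof. by rewrite -scaleN1r dotZr rmorphN rmorph1 mulN1r. Qed.

Lemma dotBl x y z : dot (x - y) z = dot x z - dot y z.
Proof. by rewrite dotDl dotNl. Qed.

Lemma dotBr x y z : dot x (y - z) = dot x y - dot x z.
Proof. by rewrite dotDr dotNr. Qed.

Lemma dot_sqnorm x : dot x x = (sqnorm x)%:C%C.
Proof. by rewrite sqnormE dotE. Qed.

Lemma eq_dotl x y : (forall z, dot x z = dot y z) -> x = y.
Proof.
move=> h; apply/eqP; rewrite -subr_eq0; apply/eqP/sqnorm_eq0/complexI.
by rewrite -dot_sqnorm dotBl h subrr.
Qed.

Lemma eq_dotr x y : (forall z, dot z x = dot z y) -> x = y.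
Proof. by move=> h; apply: eq_dotl => z; rewrite dotC h -dotC. Qed.

Lemma sqnormD x y :
  sqnorm (x + y) = sqnorm x + 2 * complex.Re (dot x y) + sqnorm y.
Proof.
apply/complexI; rewrite -dot_sqnorm dotDl !dotDr !dot_sqnorm (dotC y x).
case: (dot x y) => a b; rewrite /real_complex_def.
by apply/eqP; rewrite eq_complex /=; apply/andP; split; apply/eqP; simpc => /=; ring.
Qed.

Lemma sqnormB x y :
  sqnorm (x - y) = sqnorm x - 2 * complex.Re (dot x y) + sqnorm y.
Proof. by rewrite sqnormD dotNr sqnormN raddfN mulrN. Qed.

End InnerProduct.

Lemma ReD (R : realType) (z w : R[i]) :
  complex.Re (z + w) = complex.Re z + complex.Re w.
Proof. exact: raddfD. Qed.

Lemma ReN (R : realType) (z : R[i]) : complex.Re (- z) = - complex.Re z.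
Proof. exact: raddfN. Qed.

Lemma Re_realM (R : realType) (t : R) (z : R[i]) :
  complex.Re (t%:C%C * z) = t * complex.Re z.
Proof. by case: z => a b /=; rewrite mul0r subr0. Qed.

Lemma conj_real (R : realType) (t : R) : (t%:C%C)^* = t%:C%C :> R[i].
Proof. by apply/eqP; rewrite eq_complex /= oppr0 !eqxx. Qed.

Lemma complexRe_conj (R : realType) (z : R[i]) : complex.Re (z^*) = complex.Re z.
Proof. by case: z. Qed.

Lemma Re_le_norm (R : realType) (z : R[i]) : (complex.Re z)%:C%C <= `|z|.
Proof. by apply: le_trans (normc_ge_Re z); rewrite lecR ler_norm. Qed.

Lemma eq_Re_mul (R : realType) (z w : R[i]) :
  (forall a : R[i], complex.Re (a * z) = complex.Re (a * w)) -> z = w.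
Proof.
move=> h; have := h 1; have := h 'i%C; rewrite !mul1r.
case: z w {h} => [a b] [c d] /=.
by rewrite !mul0r !mul1r !sub0r => /oppr_inj -> ->.
Qed.

Lemma Re_dot_sqr_le (R : realType) (E : hilbertType R) (x y : E) :
  complex.Re (dot x y) ^+ 2 <= sqnorm x * sqnorm y.
Proof.
rewrite -lecR [leRHS]rmorphM/= !sqnormE -exprMn.
apply: (@le_trans _ _ (`|dot x y| ^+ 2)); last first.
  by rewrite ler_sqr ?nnegrE ?mulr_ge0// CauchySchwarz_dot.
rewrite rmorphXn/= -real_normK ?complex_real// ler_sqr ?nnegrE//.
by rewrite normc_def/= expr0n addr0 sqrtr_sqr normc_ge_Re.
Qed.

(** * Lax-Milgram for symmetric coercive operators; the identity gives Riesz representation *)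

Section LaxMilgram.
Context (R : realType) (E : hilbertType R) (T : bop E E) (c : R).
Hypothesis c0 : 0 < c.
Hypothesis T_sym : forall x y, dot (T x) y = dot x (T y).
Hypothesis T_coercive : forall x, c * sqnorm x <= complex.Re (dot (T x) x).
Variables (phi : E -> R[i]) (M : R).
Hypothesis M0 : 0 <= M.
Hypothesis phi_lin : forall a x y, phi (a *: x + y) = a * phi x + phi y.
Hypothesis phi_bounded : forall x, complex.Re (phi x) ^+ 2 <= M * sqnorm x.

Let q x := complex.Re (dot (T x) x).
Let J x := q x - 2 * complex.Re (phi x).

Let ReT_sym x y : complex.Re (dot (T x) y) = complex.Re (dot (T y) x).
Proof. by rewrite T_sym dotC complexRe_conj. Qed.

Let phiD x y : phi (x + y) = phi x + phi y.
Proof. by have := phi_lin 1 x y; rewrite scale1r mul1r. Qed.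

Let phi0 : phi 0 = 0.
Proof. by apply: (@addIr _ (phi 0)); rewrite -phiD !add0r. Qed.

Let phiZ a x : phi (a *: x) = a * phi x.
Proof. by have := phi_lin a x 0; rewrite !addr0 phi0 addr0. Qed.

Let JD x (t : R) v : J (x + t%:C%C *: v) =
  J x + 2 * t * (complex.Re (dot (T x) v) - complex.Re (phi v)) + t ^+ 2 * q v.
Proof.
have TD : T (x + t%:C%C *: v) = T x + t%:C%C *: T v by rewrite linearD linearZ.
rewrite /J /q TD !(dotDl, dotDr, dotZl, dotZr) phiD phiZ !conj_real.
by rewrite !(ReD, Re_realM) (ReT_sym v x); ring.
Qed.

(** With s = [sqnorm x], coercivity and the bound on [phi] give J x >= c s - 2 sqrt (M s), whose
    minimum over s is - M / c. *)
Let J_lb : lbound (range J) (- (M / c)).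
Proof.
move=> _ [x _ <-]; rewrite /J.
have h1 := T_coercive x; have h2 := phi_bounded x; have s0 := sqnorm_ge0 x.
rewrite -/(q x) in h1; set s := sqnorm x in h1 h2 s0 *; set p := complex.Re _ in h2 *.
suff : 0 <= c * s + M / c - 2 * p by lra.
rewrite subr_ge0 -[leRHS]ger0_norm ?addr_ge0 ?mulr_ge0 ?divr_ge0 ?invr_ge0 ?(ltW c0)//.
rewrite (le_trans (ler_norm _))//.
rewrite -ler_sqr ?nnegrE// !real_normK ?num_real//.
have -> : (c * s + M / c) ^+ 2 = (c * s - M / c) ^+ 2 + 4 * (M * s).
  by field; rewrite gt_eqF.
by have := sqr_ge0 (c * s - M / c); lra.
Qed.

Let J_inf : has_inf (range J).
Proof. by split; [exists (J 0), 0|exists (- (M / c)); exact: J_lb]. Qed.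

Let m := inf (range J).

Let J_ge x : m <= J x.
Proof. by apply: ge_inf; [case: J_inf|exists x]. Qed.

Let q_ge0 x : 0 <= q x.
Proof. by apply: le_trans (T_coercive x); rewrite mulr_ge0 ?sqnorm_ge0// ltW. Qed.

(** The last value of [J] is taken at the midpoint, where it is at least the infimum; so two
    near-minimisers are close for the coercive form [q], and a minimising sequence is Cauchy. *)
Let J_parallelogram x y : q (x - y) = 2 * (J x + J y - 2 * J (x + (1 / 2)%:C%C *: (y - x))).
Proof.
rewrite JD (_ : J y = J (x + 1%:C%C *: (y - x))); last by rewrite scale1r subrKC.
by rewrite JD (_ : q (x - y) = q (y - x)); [field|
  rewrite -opprB /q linearN dotNl dotNr opprK].
Qed.

(* Minimise [dot (T x) x - 2 Re (phi x)]. *)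
Lemma lax_milgram : exists y, forall x, phi x = dot x (T y).
Proof.
have [u hu] : exists u : nat -> E, forall n, J (u n) <= m + n.+1%:R^-1.
  suff h n : exists x, J x <= m + n.+1%:R^-1 by have [u hu] := choice h; exists u.
  have [|_ [x _ <-] /ltW ?] := @inf_adherent _ (range J) n.+1%:R^-1 _ J_inf.
    by rewrite invr_gt0.
  by exists x.
have inv_le (e : R) : 0 < e -> exists N, forall n, (N <= n)%N -> n.+1%:R^-1 <= e.
  move=> e0; exists (Num.truncn e^-1) => n nN.
  rewrite -[leRHS]invrK lef_pV2 ?posrE ?invr_gt0 ?ltr0n//.
  by apply: ltW; apply: lt_le_trans (truncnS_gt _) _; rewrite ler_nat.
have [|y hy] := @hilbert_complete _ E u.
  move=> e e0; have [|N hN] := inv_le (c * e / 4).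
    by rewrite divr_gt0// mulr_gt0.
  exists N => i j iN jN; rewrite -(ler_pM2l c0).
  apply: le_trans (T_coercive _) _; rewrite -/(q _) J_parallelogram.
  set w := u i + _; move: (J_ge w) (hN _ iN) (hN _ jN) (hu i) (hu j).
  move: (i.+1%:R^-1) (j.+1%:R^-1) => di dj; lra.
exists y.
have key v : complex.Re (phi v) = complex.Re (dot (T y) v).
  set g := fun n => complex.Re (dot (T (u n)) v) - complex.Re (phi v).
  (* [g n] is half the derivative of [J] at [u n] in direction v. Moving by - g / (q v + 1), nearly
     the optimal step but with a denominator that cannot vanish, bounds its square by the distance
     of [J (u n)] to the infimum. *)
  have g_le n : g n ^+ 2 <= n.+1%:R^-1 * (q v + 1).
    have qv1 : 0 < q v + 1 by rewrite ltr_wpDl.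
    have := J_ge (u n + (- (g n / (q v + 1)))%:C%C *: v).
    rewrite JD -/(g n) => h; have {h} := le_trans h (lerD (lerD (hu n) (lexx _)) (lexx _)).
    set Q := q v + 1 in qv1 *; set w := g n; set dn := _^-1.
    have -> : q v = Q - 1 by rewrite /Q addrK.
    have -> : m + dn + 2 * - (w / Q) * w + (- (w / Q)) ^+ 2 * (Q - 1) =
        m + dn - w ^+ 2 / Q - (w / Q) ^+ 2 by field; rewrite gt_eqF.
    move=> h; rewrite -ler_pdivrMr//; have := sqr_ge0 (w / Q); lra.
  have [K hK] := bop_sqbounded T.
  set G := complex.Re (dot (T y) v) - complex.Re (phi v).
  suff : G ^+ 2 <= 0 by move=> h; apply/eqP; rewrite eq_sym -subr_eq0 -sqrf_eq0 eq_le h sqr_ge0.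
  apply/ler_addgt0Pr => e e0; rewrite add0r.
  have qv1 : 0 < q v + 1 by rewrite ltr_wpDl.
  have K1 : 0 < `|K| * sqnorm v + 1 by rewrite ltr_wpDl// mulr_ge0// sqnorm_ge0.
  have [|N1 h1] := inv_le (e / 4 / (q v + 1)); first by rewrite !divr_gt0.
  have [|N2 h2] := hy (e / 4 / (`|K| * sqnorm v + 1)); first by rewrite !divr_gt0.
  set n := maxn N1 N2.
  have {h1} := h1 n (leq_maxl _ _); rewrite ler_pdivlMr// => h1.
  have {h2} := h2 n (leq_maxr _ _); rewrite ler_pdivlMr// => h2.
  have h3 := Re_dot_sqr_le (T (u n - y)) v.
  have -> : G = g n - complex.Re (dot (T (u n - y)) v).
    rewrite /G /g linearB dotBl ReD ReN; lra.
  have h4 : sqnorm (T (u n - y)) * sqnorm v <= e / 4.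
    apply: le_trans h2; have s0 := sqnorm_ge0 (u n - y); have v0 := sqnorm_ge0 v.
    apply: (@le_trans _ _ (`|K| * sqnorm (u n - y) * sqnorm v)).
      rewrite ler_wpM2r// (le_trans (hK _))// ler_wpM2r// ler_norm//.
    have := mulr_ge0 (normr_ge0 K) s0; nra.
  have h5 := le_trans (g_le n) h1; have {h3 h4}h6 := le_trans h3 h4.
  move: h5 h6; set a := g n; set b := complex.Re _ => h5 h6.
  have := sqr_ge0 (a + b); lra.
move=> x; apply/eq_Re_mul => a.
by rewrite -phiZ key dotC complexRe_conj dotZl.
Qed.
End LaxMilgram.

Section AdjointTheory.
Context (R : realType).
Implicit Types U V W : hilbertType R.

Lemma sqbound_ge0 U V (f : U -> V) : sqbounded f ->
  exists2 M, 0 <= M & forall x, sqnorm (f x) <= M * sqnorm x.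
Proof.
move=> [M hM]; exists `|M| => // x; apply: le_trans (hM x) _.
by rewrite ler_wpM2r ?sqnorm_ge0// ler_norm.
Qed.

(** Riesz representation of x |-> dot (T x) y gives S y for each y. Boundedness comes from |S y|^2 =
    dot (T (S y)) y and Cauchy-Schwarz, after dividing by |S y|^2. *)
Lemma adj_exists U V (T : bop U V) :
  exists S : bop V U, forall x y, dot (T x) y = dot x (S y).
Proof.
have [M M0 hM] := sqbound_ge0 (bop_sqbounded T).
have [S hS] : exists S : V -> U, forall y x, dot (T x) y = dot x (S y).
  suff h y : exists z, forall x, dot (T x) y = dot x z.
    by have [S hS] := choice h; exists S.
  apply: (@lax_milgram R U (bop_of (bounded_linear_id U)) 1 ltr01 _ _ _ (M * sqnorm y)) => //=.
  - by move=> x; rewrite mul1r.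
  - by rewrite mulr_ge0// sqnorm_ge0.
  - by move=> a x z; rewrite linearP dot_linearl.
  - move=> x; apply: le_trans (Re_dot_sqr_le _ _) _.
    by rewrite mulrAC ler_wpM2r// sqnorm_ge0.
suff SB : bounded_linear S by exists (bop_of SB) => x y; exact: hS.
split=> [a x y|].
  by apply: eq_dotr => z; rewrite -hS !dotDr !dotZr !hS.
exists M => y; have h : sqnorm (S y) ^+ 2 <= M * sqnorm (S y) * sqnorm y.
  apply: le_trans (_ : sqnorm (T (S y)) * sqnorm y <= _).
    by apply: le_trans (Re_dot_sqr_le _ _); rewrite hS.
  by rewrite ler_wpM2r ?sqnorm_ge0.
have [s0|s0] := eqVneq (sqnorm (S y)) 0; first by rewrite s0 mulr_ge0// sqnorm_ge0.
have sp : 0 < sqnorm (S y) by rewrite lt0r s0 sqnorm_ge0.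
by rewrite -(ler_pM2l sp) -expr2 (le_trans h)// mulrA [sqnorm _ * M]mulrC.
Qed.

Lemma adjP U V (T : bop U V) x y : dot (T x) y = dot x (adj T y).
Proof. by rewrite /adj; case: xgetP => [S _ ->//|/(_ _)h]; have [S] := adj_exists T; move/h. Qed.

Lemma adjPl U V (T : bop U V) x y : dot (adj T y) x = dot y (T x).
Proof. by rewrite dotC -adjP -dotC. Qed.

Lemma adjK U V (T : bop U V) x : adj (adj T) x = T x.
Proof. by apply: eq_dotr => y; rewrite -adjP adjPl. Qed.

Lemma adj_unique U V (T : bop U V) (f : V -> U) :
  (forall x y, dot (T x) y = dot x (f y)) -> forall y, adj T y = f y.
Proof. by move=> h y; apply: eq_dotr => x; rewrite -adjP h. Qed.

End AdjointTheory.

(** * Positive square roots *)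

Section BopArithmetic.
Context (R : realType) (U V : hilbertType R) (T : bop U V).

Lemma bopD x y : T (x + y) = T x + T y. Proof. exact: linearD. Qed.
Lemma bopN x : T (- x) = - T x. Proof. exact: linearN. Qed.
Lemma bopB x y : T (x - y) = T x - T y. Proof. exact: linearB. Qed.
Lemma bopZ a x : T (a *: x) = a *: T x. Proof. exact: linearZ. Qed.
Lemma bop_0 : T 0 = 0. Proof. exact: linear0. Qed.

End BopArithmetic.

(** * Real-valued norms and moduli, within reach of real arithmetic *)

Section RealNorm.
Context (R : realType).
Implicit Types E : hilbertType R.

Definition nrm E (x : E) : R := complex.Re `|x|.

Lemma nrmE E (x : E) : `|x| = (nrm x)%:C%C.
Proof.
have := normr_real x; rewrite realE /nrm; case: `|x| => a b.
by rewrite !lecE/= => /orP[|]/andP[/eqP]; [move->|move<-].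
Qed.

Lemma nrm_ge0 E (x : E) : 0 <= nrm x.
Proof. by have := normr_ge0 x; rewrite nrmE ler0c. Qed.

Lemma nrm_sqr E (x : E) : nrm x ^+ 2 = sqnorm x.
Proof. by apply: complexI; rewrite sqnormE nrmE rmorphXn. Qed.

Lemma nrm0 E : nrm (0 : E) = 0. Proof. by rewrite /nrm normr0. Qed.

Lemma nrm_eq0 E (x : E) : nrm x = 0 -> x = 0.
Proof. by move=> h; apply/normr0_eq0; rewrite nrmE h. Qed.

Lemma nrmN E (x : E) : nrm (- x) = nrm x.
Proof. by rewrite /nrm normrN. Qed.

Lemma nrmD E (x y : E) : nrm (x + y) <= nrm x + nrm y.
Proof. by rewrite -lecR rmorphD/= -!nrmE ler_normD. Qed.

Lemma nrmB E (x y : E) : nrm (x - y) <= nrm x + nrm y.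
Proof. by rewrite -(nrmN y) nrmD. Qed.

Definition cmod (a : R[i]) : R := complex.Re `|a|.

Lemma cmodE (a : R[i]) : `|a| = (cmod a)%:C%C.
Proof. by rewrite /cmod normc_def. Qed.

Lemma nrmZ E (a : R[i]) (x : E) : nrm (a *: x) = cmod a * nrm x.
Proof. by apply: complexI; rewrite rmorphM/= -cmodE -!nrmE normrZ. Qed.

Lemma nrmZr E (t : R) (x : E) : 0 <= t -> nrm (t%:C%C *: x) = t * nrm x.
Proof. by move=> t0; rewrite nrmZ /cmod ger0_norm ?ler0c. Qed.

Lemma cmod_dot E (x y : E) : cmod (dot x y) <= nrm x * nrm y.
Proof. by rewrite -lecR rmorphM/= -cmodE -!nrmE CauchySchwarz_dot. Qed.

Lemma Re_dot_le E (x y : E) : complex.Re (dot x y) <= nrm x * nrm y.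
Proof.
by apply: le_trans (cmod_dot x y); rewrite -lecR -cmodE Re_le_norm.
Qed.

Lemma nrm_ball E (x y : E) (e : R) : ball x e%:C%C y <-> nrm (x - y) < e.
Proof. by rewrite -ball_normE/= nrmE ltcR. Qed.

Lemma pos_complex (e : R[i]) : 0 < e -> exists2 r : R, 0 < r & e = r%:C%C.
Proof.
by case: e => a b; rewrite ltcE/= => /andP[/eqP-> a0]; exists a.
Qed.

Lemma cvg_nrmP E (u : nat -> E) (l : E) : u @ \oo --> l <->
  forall e : R, 0 < e -> exists N, forall n, (N <= n)%N -> nrm (u n - l) <= e.
Proof.
split=> [/cvg_ballP h e e0|h].
  have e0' : 0 < e%:C%C :> R[i] by rewrite ltcR.
  have [N _ hN] := h _ e0'; exists N => n Nn.
  by have /nrm_ball/ltW := hN n Nn; rewrite -nrmN opprB.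
apply/cvg_ballP => _ /pos_complex[e e0 ->].
have [|N hN] := h (e / 2); first by rewrite divr_gt0.
exists N => // n Nn; apply/nrm_ball; rewrite -nrmN opprB.
by apply: le_lt_trans (hN n Nn) _; rewrite ltr_pdivrMr// mulr_natr mulr2n ltrDl.
Qed.

Lemma nrm_complete E (u : nat -> E) :
  (forall e : R, 0 < e -> exists N, forall m n, (N <= m)%N -> (N <= n)%N ->
    nrm (u m - u n) <= e) -> cvgn u.
Proof.
move=> h; apply/cauchy_cvgP/cauchyP => _ /pos_complex[e e0 ->].
have [|N hN] := h (e / 2); first by rewrite divr_gt0.
exists (u N), N => // n /= Nn; apply/nrm_ball; apply: le_lt_trans (hN _ _ (leqnn N) Nn) _.
by rewrite ltr_pdivrMr// mulr_natr mulr2n ltrDl.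
Qed.

Lemma continuous_dotl E (y : E) : continuous (fun x : E => dot x y : R[i]^o).
Proof.
pose f x : R[i]^o := dot x y.
have lf : linear f by move=> a x z; rewrite /f dot_linearl.
pose F : {linear E -> R[i]^o} := HB.pack f (GRing.isLinear.Build _ _ _ _ f lf).
apply: (@bounded_linear_continuous _ _ _ F).
apply/ex_bound; exists `|y|; apply/nbhs_norm0P; exists 1 => //= x /ltW x1.
by rewrite /mkset /= (le_trans (CauchySchwarz_dot _ _))// ler_piMl.
Qed.

End RealNorm.

Section CauchySequences.
Context (R : realType) (E F : hilbertType R).

Lemma cvgn_uniq (u : nat -> E) (l l' : E) :
  u @ \oo --> l -> u @ \oo --> l' -> l = l'.
Proof. exact: (cvg_unique (@norm_hausdorff _ _)). Qed.

Lemma cvg_bop (T : bop E F) (u : nat -> E) (l : E) :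
  u @ \oo --> l -> (fun n => T (u n)) @ \oo --> T l.
Proof. move=> ul; exact: (cvg_comp u _ ul (@bop_continuous _ _ _ T l)). Qed.

Lemma cvg_dotl (y : E) (u : nat -> E) (l : E) :
  u @ \oo --> l -> (fun n => dot (u n) y : R[i]^o) @ \oo --> (dot l y : R[i]^o).
Proof. move=> ul; exact: (cvg_comp u _ ul (@continuous_dotl _ _ y l)). Qed.

Lemma cvg_dotr (y : E) (u : nat -> E) (l : E) :
  u @ \oo --> l -> (fun n => dot y (u n) : R[i]^o) @ \oo --> (dot y l : R[i]^o).
Proof.
move=> /(@cvg_dotl y)/(@cvgrPdist_le R[i] R[i]^o) h.
apply/(@cvgrPdist_le R[i] R[i]^o) => e e0.
have [N _ hN] := h e e0; exists N => // n Nn; apply: le_trans (hN n Nn).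
by rewrite -[leRHS]norm_conjC rmorphB/= -!dotC.
Qed.

Lemma nrm_bop_le (T : bop E F) : exists2 M, 0 <= M & forall x, nrm (T x) <= M * nrm x.
Proof.
have [M M0 hM] := sqbound_ge0 (bop_sqbounded T).
exists (Num.sqrt M); rewrite ?sqrtr_ge0// => x.
rewrite -ler_sqr ?nnegrE ?mulr_ge0 ?sqrtr_ge0 ?nrm_ge0//.
by rewrite exprMn sqr_sqrtr// !nrm_sqr.
Qed.

Lemma nrm_sqbounded (f : E -> F) (M : R) :
  (forall x, nrm (f x) <= M * nrm x) -> sqbounded f.
Proof.
move=> h; exists (M ^+ 2) => x; rewrite -!nrm_sqr -exprMn ler_sqr ?nnegrE ?nrm_ge0//.
exact: le_trans (nrm_ge0 _) (h x).
Qed.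

End CauchySequences.

(* [S = I - Y] is a square root of [I - T] iff [Y = (T + Y^2) / 2], which is
   solved by iteration from 0; the scalar iteration with [T = 1], which tends
   to 1, is a majorant. *)
Section SquareRootIteration.
Context (R : realType).

Fixpoint sqrt_iter (E : hilbertType R) (T : E -> E) n (x : E) : E :=
  if n is k.+1 then (2^-1)%:C%C *: (T x + sqrt_iter T k (sqrt_iter T k x)) else 0.

Fixpoint sqrt_majorant n : R :=
  if n is k.+1 then 2^-1 * (1 + sqrt_majorant k ^+ 2) else 0.

Lemma sqrt_majorant_itv n : 0 <= sqrt_majorant n <= 1.
Proof.
elim: n => [|n /andP[h0 h1]]; rewrite /= ?lexx ?ler01//.
by apply/andP; split; nra.
Qed.

Lemma sqrt_majorantS n : sqrt_majorant n <= sqrt_majorant n.+1.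
Proof. by have /andP[h0 h1] := sqrt_majorant_itv n => /=; nra. Qed.

Lemma sqrt_majorant_nd : nondecreasing_seq sqrt_majorant.
Proof. exact/nondecreasing_seqP/sqrt_majorantS. Qed.

Lemma sqrt_majorant_cauchy (e : R) : 0 < e -> exists N, forall m n,
  (N <= n)%N -> (n <= m)%N -> sqrt_majorant m - sqrt_majorant n <= e.
Proof.
move=> e0; have c : cvgn sqrt_majorant.
  apply: nondecreasing_is_cvgn; first exact: sqrt_majorant_nd.
  by exists 1 => _ [n _ <-]; case/andP: (sqrt_majorant_itv n).
have /cvgrPdist_le/(_ e e0)[N _ hN] := c.
exists N => m n Nn nm.
have := nondecreasing_cvgn_le sqrt_majorant_nd c m.
have := hN n Nn => /=; set l := limn _; rewrite ler_norml => /andP[_]; lra.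
Qed.

(** The iterates are built from T by sums and compositions only. With E = F this yields that they
    commute with each other; with T = P^* P and T' = P P^* it is the origin of P D_P = D_{P^*} P. *)
Lemma sqrt_iter_intertwine (E F : hilbertType R) (T : E -> E) (T' : F -> F) (P : bop E F) :
  (forall x, P (T x) = T' (P x)) ->
  forall n x, P (sqrt_iter T n x) = sqrt_iter T' n (P x).
Proof.
move=> h; elim=> [|n IH] x; first exact: bop_0.
by rewrite /= bopZ bopD h !IH.
Qed.

Context (E : hilbertType R) (T : bop E E).
Hypothesis T_sym : forall x y, dot (T x) y = dot x (T y).
Hypothesis T_le1 : forall x, nrm (T x) <= nrm x.
Local Notation Y := (sqrt_iter T).

Lemma sqrt_iter_linear n : linear (Y n).
Proof.
elim: n => [|n IH] a x y /=; first by rewrite scaler0 addr0.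
by rewrite IH IH bopD bopZ addrACA scalerDr -[a *: _ + a *: _]scalerDr !scalerA mulrC.
Qed.

Lemma sqrt_iterB n x y : Y n (x - y) = Y n x - Y n y.
Proof. by rewrite -scaleN1r addrC sqrt_iter_linear scaleN1r addrC. Qed.

Lemma sqrt_iter_le n x : nrm (Y n x) <= sqrt_majorant n * nrm x.
Proof.
elim: n x => [|n IH] x /=; first by rewrite nrm0 mul0r.
have /andP[s0 s1] := sqrt_majorant_itv n; move: (sqrt_majorant n) s0 s1 IH => s s0 s1 IH.
rewrite nrmZr ?invr_ge0// -mulrA ler_pM2l ?invr_gt0//.
apply: le_trans (nrmD _ _) _; rewrite mulrDl mul1r lerD//.
by apply: le_trans (IH _) _; rewrite expr2 -mulrA ler_wpM2l.
Qed.

Lemma sqrt_iter_sym n x y : dot (Y n x) y = dot x (Y n y).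
Proof.
elim: n x y => [|n IH] x y /=; first by rewrite dot0l dot0r.
by rewrite dotZl dotZr conj_real dotDl dotDr T_sym !IH.
Qed.

Lemma sqrt_iterT n x : T (Y n x) = Y n (T x).
Proof. exact: sqrt_iter_intertwine. Qed.

Lemma sqrt_iterC m n x : Y m (Y n x) = Y n (Y m x).
Proof.
have YB k : bounded_linear (Y k).
  split; [exact: sqrt_iter_linear|].
  by apply: nrm_sqbounded; exact: sqrt_iter_le.
apply/esym; apply: (@sqrt_iter_intertwine _ _ T T (bop_of (YB n))) => {}x /=.
by rewrite sqrt_iterT.
Qed.

(** Since the iterates commute, the difference of two squares factors as sum times difference; the
    majorant satisfies the same recursion, so the bound propagates. *)
Lemma sqrt_iter_diffS n x :
  nrm (Y n.+1 x - Y n x) <= (sqrt_majorant n.+1 - sqrt_majorant n) * nrm x.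
Proof.
elim: n x => [|n IH] x.
  by rewrite /= !addr0 !subr0 expr0n addr0 mulr1 nrmZr ?invr_ge0// ler_pM2l ?invr_gt0.
set s := sqrt_majorant n.+1 in IH *; set t := sqrt_majorant n in IH *.
have -> : Y n.+2 x - Y n.+1 x =
    (2^-1)%:C%C *: (Y n.+1 (Y n.+1 x - Y n x) + Y n (Y n.+1 x - Y n x)).
  have YS k : Y k.+1 x = (2^-1)%:C%C *: (T x + Y k (Y k x)) by [].
  rewrite (YS n.+1) [in X in _ - X](YS n) -scalerBr !sqrt_iterB (sqrt_iterC n n.+1).
  by rewrite addrA subrK opprD addrACA subrr add0r.
rewrite nrmZr ?invr_ge0//.
have -> : sqrt_majorant n.+2 - s = 2^-1 * ((s + t) * (s - t)).
  have es : s = 2^-1 * (1 + t ^+ 2) by [].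
  by rewrite -[sqrt_majorant n.+2]/(2^-1 * (1 + s ^+ 2)); lra.
rewrite -!mulrA ler_pM2l ?invr_gt0// mulrDl.
apply: le_trans (nrmD _ _) _; apply: lerD.
  apply: le_trans (sqrt_iter_le _ _) _; apply: ler_wpM2l (IH _).
  by case/andP: (sqrt_majorant_itv n.+1).
apply: le_trans (sqrt_iter_le _ _) _; apply: ler_wpM2l (IH _).
by case/andP: (sqrt_majorant_itv n).
Qed.

Lemma sqrt_iter_diff m n x : (n <= m)%N ->
  nrm (Y m x - Y n x) <= (sqrt_majorant m - sqrt_majorant n) * nrm x.
Proof.
move=> /subnK <-; elim: (m - n)%N => [|k IH].
  by rewrite add0n !subrr nrm0 mul0r.
rewrite addSn -(subrKA (Y (k + n) x)) (le_trans (nrmD _ _))//.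
by have := sqrt_iter_diffS (k + n) x; move: IH; lra.
Qed.

Lemma sqrt_iter_cvg x : cvgn (fun n => Y n x).
Proof.
apply: nrm_complete => e e0; have nx := nrm_ge0 x.
have [|N hN] := @sqrt_majorant_cauchy (e / (nrm x + 1)).
  by rewrite divr_gt0// ltr_wpDl.
have key m n : (N <= n)%N -> (n <= m)%N -> nrm (Y m x - Y n x) <= e.
  move=> Nn nm; apply: le_trans (sqrt_iter_diff x nm) _.
  have := hN _ _ Nn nm; rewrite ler_pdivlMr ?ltr_wpDl//.
  have := sqrt_majorant_nd nm; nra.
exists N => m n Nm Nn; have [nm|/ltnW mn] := leqP n m; first exact: key.
by rewrite -nrmN opprB key.
Qed.

Definition sqrt_lim x : E := limn (fun n => Y n x).

Lemma sqrt_limP x : (fun n => Y n x) @ \oo --> sqrt_lim x.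
Proof. exact: sqrt_iter_cvg. Qed.

Lemma sqrt_lim_linear : linear sqrt_lim.
Proof.
move=> a x y; apply: (@cvgn_uniq _ _ (fun n => Y n (a *: x + y))).
  exact: sqrt_limP.
rewrite (_ : (fun n => _) = (fun n => a *: Y n x + Y n y)); last first.
  by apply/funext => n; rewrite sqrt_iter_linear.
by apply: cvgD; [apply: cvgZr|]; exact: sqrt_limP.
Qed.

Lemma sqrt_lim_le x : nrm (sqrt_lim x) <= nrm x.
Proof.
apply/ler_addgt0Pr => e e0; have /cvg_nrmP/(_ e e0)[N /(_ N (leqnn N))h] := @sqrt_limP x.
rewrite -[sqrt_lim x](subKr (Y N x)) (le_trans (nrmB _ _))// lerD//.
apply: le_trans (sqrt_iter_le N x) _; have /andP[_] := sqrt_majorant_itv N.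
by have := nrm_ge0 x; nra.
Qed.

Lemma sqrt_lim_sym x y : dot (sqrt_lim x) y = dot x (sqrt_lim y).
Proof.
apply: (@cvg_unique R[i]^o (@norm_hausdorff _ _) ((fun n => dot (Y n x) y : R[i]^o) @ \oo)).
  exact: cvg_dotl (@sqrt_limP x).
rewrite (_ : (fun n => _) = (fun n => dot x (Y n y))); last first.
  by apply/funext => n; rewrite sqrt_iter_sym.
exact: cvg_dotr (@sqrt_limP y).
Qed.

Lemma sqrt_limE x : sqrt_lim x = (2^-1)%:C%C *: (T x + sqrt_lim (sqrt_lim x)).
Proof.
apply: (@cvgn_uniq _ _ (fun n => Y n.+1 x)).
  rewrite (@cvg_shiftS E (fun n => Y n x)); exact: sqrt_limP.
apply: cvgZr; apply: cvgD; first exact: cvg_cst.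
apply/cvg_nrmP => e e0; have e2 : 0 < e / 2 by rewrite divr_gt0.
have /cvg_nrmP/(_ _ e2)[N1 h1] := @sqrt_limP x.
have /cvg_nrmP/(_ _ e2)[N2 h2] := @sqrt_limP (sqrt_lim x).
exists (maxn N1 N2) => n; rewrite geq_max => /andP[/h1{}h1 /h2{}h2].
rewrite -(subrKA (Y n (sqrt_lim x))) (le_trans (nrmD _ _))// (splitr e) lerD//.
rewrite -sqrt_iterB (le_trans (sqrt_iter_le _ _))// (le_trans _ h1)//.
by rewrite ler_piMl ?nrm_ge0//; case/andP: (sqrt_majorant_itv n).
Qed.

End SquareRootIteration.

Lemma real_complexE (R : realType) (z : R[i]) : z^* = z -> z = (complex.Re z)%:C%C.
Proof.
case: z => a b [/eqP]; rewrite eq_sym -addr_eq0 -mulr2n mulrn_eq0/= => /eqP ->.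
by [].
Qed.

(** * Positive operators and uniqueness of the positive square root *)

Section PositiveOperators.
Context (R : realType).

(** The sesquilinear defect [f] of symmetry vanishes on the diagonal because nonnegative numbers are
    real; comparing y with i y then kills it off the diagonal. *)
Lemma pos_op_sym (E : hilbertType R) (S : bop E E) : (forall x, 0 <= dot (S x) x) ->
  forall x y, dot (S x) y = dot x (S y).
Proof.
move=> S0; pose f x y := dot (S x) y - dot x (S y).
have fxx x : f x x = 0.
  by rewrite /f [dot x _]dotC (CrealP (ger0_real (S0 x))) subrr.
have f_add x y : f x y + f y x = 0.
  have := fxx (x + y); rewrite /f bopD !dotDl !dotDr => h.
  have := fxx x; have := fxx y; rewrite /f => /subr0_eq h1 /subr0_eq h2.
  by rewrite -[RHS]h h1 h2; ring.
have fZl a x y : f (a *: x) y = a * f x y.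
  by rewrite /f bopZ !dotZl mulrBr.
have fZr a x y : f x (a *: y) = a^* * f x y.
  by rewrite /f bopZ !dotZr mulrBr.
move=> x y; apply/subr0_eq; rewrite -/(f x y).
have h1 := f_add x y; have := f_add x ('i *: y).
rewrite fZl fZr conjCi mulNr => /eqP; rewrite addrC subr_eq0.
move=> /eqP/(mulfI (neq0Ci _)) h2; move: h1; rewrite h2 => /eqP.
by rewrite -mulr2n mulrn_eq0/= => /eqP.
Qed.

(** The form at x + t S x is a nonnegative quadratic polynomial in t without constant term, so its
    linear coefficient 2 |S x|^2 is zero. *)
Lemma pos_op_eq0 (E : hilbertType R) (S : bop E E) : (forall x, 0 <= dot (S x) x) ->
  forall x, dot (S x) x = 0 -> S x = 0.
Proof.
move=> S0 x Sx; have S_sym := pos_op_sym S0.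
have q0 y : 0 <= complex.Re (dot (S y) y).
  by have := S0 y; case: (dot _ _) => a b; rewrite lecE/= => /andP[].
set q := complex.Re (dot (S (S x)) (S x)).
have h (t : R) : 0 <= 2 * t * sqnorm (S x) + t ^+ 2 * q.
  have := q0 (x + t%:C%C *: S x).
  rewrite bopD bopZ !(dotDl, dotDr, dotZl, dotZr) conj_real Sx (S_sym (S x) x).
  by rewrite !(ReD, Re_realM) -/q -/(sqnorm (S x)) /=; lra.
apply: sqnorm_eq0; apply/eqP; rewrite eq_le sqnorm_ge0 andbT leNgt; apply/negP => s0.
have q1 : 0 < q + 1 by have := q0 (S x); rewrite -/q; lra.
have := h (- (sqnorm (S x) / (q + 1))).
have -> : 2 * - (sqnorm (S x) / (q + 1)) * sqnorm (S x) + (- (sqnorm (S x) / (q + 1))) ^+ 2 * q =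
  - (sqnorm (S x) / (q + 1)) ^+ 2 * (q + 2) by field; rewrite gt_eqF.
have : 0 < (sqnorm (S x) / (q + 1)) ^+ 2 by rewrite exprn_gt0// divr_gt0.
by have := q0 (S x); rewrite -/q; nra.
Qed.

Definition contractive_sym (E : hilbertType R) (T : bop E E) :=
  (forall x y, dot (T x) y = dot x (T y)) /\ (forall x, nrm (T x) <= nrm x).

Definition sqrt_fun (E : hilbertType R) (T : bop E E) (x : E) := x - sqrt_lim T x.

Lemma bounded_linear_sqrt_fun (E : hilbertType R) (T : bop E E) :
  contractive_sym T -> bounded_linear (sqrt_fun T).
Proof.
move=> [T_sym T_le1]; apply: bounded_linearD; first exact: bounded_linear_id.
apply: bounded_linearN; split; first exact: sqrt_lim_linear.
by apply: (@nrm_sqbounded _ _ _ _ 1) => x; rewrite mul1r; exact: sqrt_lim_le.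
Qed.

Lemma sqrt_fun_sqr (E : hilbertType R) (T : bop E E) :
  contractive_sym T -> forall x, sqrt_fun T (sqrt_fun T x) = x - T x.
Proof.
move=> [T_sym T_le1] x; rewrite /sqrt_fun.
have := sqrt_limE T_le1 x; set L := sqrt_lim T.
have LB y z : L (y - z) = L y - L z.
  by rewrite /L -scaleN1r addrC sqrt_lim_linear// scaleN1r addrC.
rewrite LB => /(congr1 (fun y => 2%:C%C *: y)); rewrite scalerA -rmorphM/= mulfV ?pnatr_eq0//.
rewrite scale1r => h.
have {h} -> : L (L x) = L x + L x - T x.
  by rewrite -[X in X = _](addKr (T x)) -h rmorph_nat scaler_nat mulr2n addrC.
apply: eq_dotl => z.
by rewrite !(dotBl, dotDl); ring.
Qed.

Lemma sqrt_fun_ge0 (E : hilbertType R) (T : bop E E) :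
  contractive_sym T -> forall x, 0 <= dot (sqrt_fun T x) x.
Proof.
move=> [T_sym T_le1] x; have Ls := sqrt_lim_sym T_sym T_le1.
rewrite /sqrt_fun dotBl subr_ge0; have := sqrt_lim_le T_le1 x.
set L := sqrt_lim T x => Lx.
have /real_complexE -> : (dot L x)^* = dot L x by rewrite -dotC Ls.
rewrite dot_sqnorm lecR -nrm_sqr.
apply: le_trans (Re_dot_le _ _) _; rewrite expr2 ler_wpM2r ?nrm_ge0//.
Qed.

Lemma sqrt_fun_intertwine (E F : hilbertType R) (T : bop E E) (T' : bop F F) (P : bop E F) :
  contractive_sym T -> contractive_sym T' ->
  (forall x, P (T x) = T' (P x)) -> forall x, P (sqrt_fun T x) = sqrt_fun T' (P x).
Proof.
move=> [T_sym T_le1] [T_sym' T_le1'] h x; rewrite /sqrt_fun bopB; congr (_ - _).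
apply: (@cvgn_uniq _ _ (fun n => P (sqrt_iter T n x))).
  exact: cvg_bop (@sqrt_limP _ _ _ T_le1 x).
rewrite (_ : (fun n => _) = (fun n => sqrt_iter T' n (P x))); last first.
  by apply/funext => n; rewrite (sqrt_iter_intertwine h).
exact: sqrt_limP.
Qed.

(** S commutes with T = I - S^2, hence with the constructed root Q, a limit of expressions in T. For
    y = (S - Q) x the forms of S and Q at y add up to dot ((S^2 - Q^2) x) y = 0, so S y = Q y = 0,
    and therefore |y|^2 = dot ((S - Q) x) y = 0. *)
Lemma pos_sqrt_unique (E : hilbertType R) (T S : bop E E) : contractive_sym T ->
  (forall x, 0 <= dot (S x) x) -> (forall x, S (S x) = x - T x) ->
  forall x, S x = sqrt_fun T x.
Proof.
move=> cT S0 SS x.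
have ST y : S (T y) = T (S y).
  by apply: oppr_inj; apply: (addrI (S y)); rewrite -bopB -!SS.
have [Q QE] : exists Q : bop E E, forall x, Q x = sqrt_fun T x.
  by exists (bop_of (bounded_linear_sqrt_fun cT)).
have Q0 y : 0 <= dot (Q y) y by rewrite QE sqrt_fun_ge0.
have QQ y : Q (Q y) = y - T y by rewrite !QE sqrt_fun_sqr.
have SQ y : S (Q y) = Q (S y) by rewrite !QE; exact: sqrt_fun_intertwine.
rewrite -QE.
apply/subr0_eq; set y := S x - Q x.
have e : dot (S y) y + dot (Q y) y = 0.
  by rewrite -dotDl /y !bopB SS QQ SQ addrC subrKA subrr dot0l.
move: e => /eqP; rewrite paddr_eq0// => /andP[/eqP/(pos_op_eq0 S0) Sy /eqP/(pos_op_eq0 Q0) Qy].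
apply: sqnorm_eq0; apply: complexI; rewrite -dot_sqnorm {1}/y dotBl.
by rewrite (pos_op_sym S0) (pos_op_sym Q0) Sy Qy !dot0r subrr.
Qed.

End PositiveOperators.

(** * Defect operators and fundamental operators *)

Section AdjointNorm.
Context (R : realType).

Lemma nrm_adj_le (U V : hilbertType R) (T : bop U V) (M : R) : 0 <= M ->
  (forall x, nrm (T x) <= M * nrm x) -> forall y, nrm (adj T y) <= M * nrm y.
Proof.
move=> M0 h y; have [->|n0] := eqVneq (nrm (adj T y)) 0.
  by rewrite mulr_ge0 ?nrm_ge0.
have n1 : 0 < nrm (adj T y) by rewrite lt0r n0 nrm_ge0.
rewrite -(ler_pM2l n1) -expr2 nrm_sqr /sqnorm adjPl.
apply: le_trans (Re_dot_le _ _) _.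
by rewrite [leRHS]mulrA [leRHS]mulrC ler_wpM2l ?nrm_ge0// mulrC.
Qed.

Lemma adj_contraction (U V : hilbertType R) (T : bop U V) :
  (forall x, nrm (T x) <= nrm x) -> forall y, nrm (adj T y) <= nrm y.
Proof.
by move=> h y; have := @nrm_adj_le _ _ T 1 ler01 _ y; rewrite mul1r; apply=> x; rewrite mul1r.
Qed.

Lemma adj_comm (U : hilbertType R) (S T : bop U U) : (forall x, S (T x) = T (S x)) ->
  forall x, adj S (adj T x) = adj T (adj S x).
Proof. by move=> h x; apply: eq_dotr => y; rewrite -!adjP h. Qed.

(** Density as triviality of the orthogonal complement, the form used when an identity is tested
    against the range. *)
Definition dense_range (U V : hilbertType R) (T : bop U V) :=
  forall y, (forall x, dot y (T x) = 0) -> y = 0.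

Lemma eq_dense (U V : hilbertType R) (T : bop U V) : dense_range T ->
  forall y z, (forall x, dot y (T x) = dot z (T x)) -> y = z.
Proof. by move=> hT y z h; apply/subr0_eq/hT => x; rewrite dotBl h subrr. Qed.

Lemma dense_eq (U V W : hilbertType R) (T : bop U V) (f g : V -> W) :
  dense_range T -> bounded_linear f -> bounded_linear g ->
  (forall x, f (T x) = g (T x)) -> forall y, f y = g y.
Proof.
move=> hT bf bg h y; apply: eq_dotr => z.
rewrite -[f y]/(bop_of bf y) -[g y]/(bop_of bg y) -!adjPl.
congr (dot _ _); apply: (eq_dense hT) => x.
by rewrite !adjPl /= h.
Qed.

Lemma adj_dense_inj (U V : hilbertType R) (T : bop U V) : dense_range T ->
  forall y z, adj T y = adj T z -> y = z.
Proof.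
by move=> hT y z e; apply: (eq_dense hT) => x; rewrite -!adjPl e.
Qed.

End AdjointNorm.

Section ClosedRangeTheory.
Context (R : realType) (U V : hilbertType R) (T : bop U V).

Lemma clran_cor_dense : dense_range (clran_cor T).
Proof.
move=> y hy; apply: sqnorm_eq0; apply/eqP; rewrite eq_le sqnorm_ge0 andbT.
apply/ler_addgt0Pr => e e0; rewrite add0r.
have /in_clranP/(_ _ e0)[x hx] := valP y.
have [y0|y0] := eqVneq (sqnorm y) 0; first by rewrite y0 ltW.
have yp : 0 < sqnorm y by rewrite lt0r y0 sqnorm_ge0.
have := Re_dot_sqr_le y (y - clran_cor T x).
rewrite dotBr hy subr0 -/(sqnorm y) expr2 ler_pM2l// => /le_trans; apply.
exact: hx.
Qed.

Lemma clran_cor_approx (y : clran T) (e : R) : 0 < e ->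
  exists x, nrm (y - clran_cor T x) <= e.
Proof.
move=> e0; have /in_clranP/(_ _ (exprn_gt0 2 e0))[x hx] := valP y.
exists x; rewrite -ler_sqr ?nnegrE ?nrm_ge0 ?(ltW e0)// nrm_sqr.
exact: hx.
Qed.

Lemma adj_clran_cor (y : clran T) : adj (clran_cor T) y = adj T (y : V).
Proof.
apply: (adj_unique (T := clran_cor T) (f := fun z : clran T => adj T (z : V))).
by move=> x z; rewrite -adjP.
Qed.

Lemma adj_clran_incl (x : U) : adj (clran_incl T) (T x) = clran_cor T x.
Proof. by apply: eq_dotl => y; rewrite adjPl. Qed.

End ClosedRangeTheory.

(* The relations say that [[P, d'*], [d, -Q]] is unitary; with d, d' the
   restrictions of D_P and D_{P*}, this is the Julia operator of P. *)
Record julia (R : realType) (H E E' : hilbertType R) (P : bop H H) (d : bop H E)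
    (d' : bop H E') (Q : bop E' E) : Prop := Julia {
  julia_dense : dense_range d;
  julia_dense' : dense_range d';
  julia_dd : forall h, adj d (d h) = h - adj P (P h);
  julia_dd' : forall h, adj d' (d' h) = h - P (adj P h);
  julia_Q : forall h, Q (d' h) = d (adj P h) }.

Section JuliaTheory.
Context (R : realType) (H E E' : hilbertType R) (P : bop H H) (d : bop H E)
  (d' : bop H E') (Q : bop E' E).
Hypothesis J : julia P d d' Q.

(** This and the next four identities are the remaining entries of the two unitarity relations of
    the Julia operator. *)
Lemma julia_adjQ h : adj Q (d h) = d' (P h).
Proof.
apply: (eq_dense (julia_dense' J)) => k.
rewrite adjPl (julia_Q J) -adjPl (julia_dd J) -[RHS]adjPl (julia_dd' J).
by rewrite -[LHS]adjP bopB.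
Qed.

Lemma julia_ddl u : d (adj d u) = u - Q (adj Q u).
Proof.
apply: (eq_dense (julia_dense J)) => h.
rewrite adjP (julia_dd J) adjPl bopB dotBr dotBl; congr (_ - _).
by rewrite adjP julia_adjQ adjPl (julia_Q J).
Qed.

Lemma julia_ddl' v : d' (adj d' v) = v - adj Q (Q v).
Proof.
apply: (eq_dense (julia_dense' J)) => h.
rewrite adjP (julia_dd' J) adjPl bopB dotBr dotBl; congr (_ - _).
by rewrite adjPl (julia_Q J) adjP julia_adjQ.
Qed.

Lemma julia_Pd u : P (adj d u) = adj d' (adj Q u).
Proof.
by apply: eq_dotl => h; rewrite adjP !adjPl (julia_Q J).
Qed.

Lemma julia_Pd' v : adj P (adj d' v) = adj d (Q v).
Proof.
by apply: eq_dotl => h; rewrite !adjPl adjP julia_adjQ.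
Qed.

End JuliaTheory.

Section Defect.
Context (R : realType) (H : hilbertType R) (P : bop H H).
Hypothesis P_le1 : forall x, nrm (P x) <= nrm x.

Definition adjM : bop H H :=
  bop_of (bounded_linear_comp (bounded_linear_bop (adj P)) (bounded_linear_bop P)).

Lemma adjM_contractive : contractive_sym adjM.
Proof.
split=> [x y|x] /=; first by rewrite adjPl adjP.
exact: le_trans (adj_contraction P_le1 _) (P_le1 x).
Qed.

Lemma defect_op_ge0 x : 0 <= dot (defect_op P x) x.
Proof.
rewrite /defect_op /pos_sqrt; case: xgetP => [S _ [? _]//|_].
by rewrite /= dot0l.
Qed.

Lemma defect_op_sqr x : defect_op P (defect_op P x) = x - adj P (P x).
Proof.
rewrite /defect_op /pos_sqrt; case: xgetP => [S _ [_ ->]//|h].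
have := h (bop_of (bounded_linear_sqrt_fun adjM_contractive)); case; split=> y /=.
  exact: sqrt_fun_ge0 adjM_contractive _.
by rewrite (sqrt_fun_sqr adjM_contractive).
Qed.

Lemma defect_op_sym x y : dot (defect_op P x) y = dot x (defect_op P y).
Proof. exact/pos_op_sym/defect_op_ge0. Qed.

Lemma defect_opE x : defect_op P x = sqrt_fun adjM x.
Proof.
apply: (pos_sqrt_unique adjM_contractive); first exact: defect_op_ge0.
exact: defect_op_sqr.
Qed.

End Defect.

Section DefectJulia.
Context (R : realType) (H : hilbertType R) (P : bop H H).
Hypothesis P_le1 : forall x, nrm (P x) <= nrm x.
Let P'_le1 := adj_contraction P_le1.

(** P intertwines P^* P with P P^*, hence also the roots obtained by iteration, with which the
    defect operators have been identified. *)
Lemma defect_intertwine x : P (defect_op P x) = defect_op (adj P) (P x).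
Proof.
rewrite (defect_opE P_le1) (defect_opE P'_le1).
apply: sqrt_fun_intertwine; [exact: adjM_contractive..|].
by move=> y; rewrite /= adjK.
Qed.

Lemma defect_intertwine_adj x : adj P (defect_op (adj P) x) = defect_op P (adj P x).
Proof.
apply: eq_dotl => y; rewrite adjPl (defect_op_sym (adj P)) -defect_intertwine.
by rewrite -adjPl (defect_op_sym P).
Qed.

Lemma defect_julia : julia P (clran_cor (defect_op P)) (clran_cor (defect_op (adj P)))
  (bop_of (bounded_linear_Pstar_restr P)).
Proof.
split; [exact: clran_cor_dense..| | |] => h.
- rewrite adj_clran_cor (adj_unique (f := defect_op P)); last exact: defect_op_sym.
  exact: defect_op_sqr.
- rewrite adj_clran_cor (adj_unique (f := defect_op (adj P))); last exact: defect_op_sym.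
  by rewrite /= (defect_op_sqr P'_le1) adjK.
- by rewrite /= /Pstar_restr /= defect_intertwine_adj adj_clran_incl.
Qed.

Lemma adj_clran_defect (y : defect_space P) :
  adj (clran_cor (defect_op P)) y = defect_op P (y : H).
Proof.
by rewrite adj_clran_cor (adj_unique (f := defect_op P))//; exact: defect_op_sym.
Qed.

End DefectJulia.

(* In D_P F D_P the inner D_P is d and the outer one is its adjoint. *)
Record fundamental (R : realType) (H E : hilbertType R) (A B P : bop H H)
    (d : bop H E) (F1 F2 : bop E E) : Prop := Fundamental {
  fund_AB : forall x, A (B x) = B (A x);
  fund_AP : forall x, A (P x) = P (A x);
  fund_BP : forall x, B (P x) = P (B x);
  fund_dense : dense_range d;
  fund_dd : forall h, adj d (d h) = h - adj P (P h);
  fund_F1 : forall h, adj d (F1 (d h)) = A h - adj B (P h);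
  fund_F2 : forall h, adj d (F2 (d h)) = B h - adj A (P h) }.

Lemma fundamental_swap (R : realType) (H E : hilbertType R) (A B P : bop H H)
  (d : bop H E) (F1 F2 : bop E E) :
  fundamental A B P d F1 F2 -> fundamental B A P d F2 F1.
Proof. by case=> AB AP BP dd dP h1 h2; split. Qed.

Section FundamentalTheory.
Context (R : realType) (H E : hilbertType R) (A B P : bop H H) (d : bop H E)
  (F1 F2 : bop E E).
Hypothesis fF : fundamental A B P d F1 F2.

Lemma fund_adjF1 h : adj d (adj F1 (d h)) = adj A h - adj P (B h).
Proof.
by apply: eq_dotl => k; rewrite !adjPl adjP (fund_F1 fF) dotBr dotBl !adjPl -adjP.
Qed.

(** Pairing with [d k] restores the outer factor of both defining relations, and the terms in B^* P
    cancel. The identity is the first sequence entry of V3 V1 = V1 V3 at h. *)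
Lemma fund_dA h : d (A h) = F1 (d h) + adj F2 (d (P h)).
Proof.
apply: (eq_dense (fund_dense fF)) => k.
rewrite -[LHS]adjPl (fund_dd fF) [RHS]dotDl.
rewrite -[X in _ = X + _]adjPl (fund_F1 fF) [X in _ = _ + X]adjPl adjP (fund_F2 fF).
by rewrite dotBr -adjP !dotBl !adjPl (fund_AP fF) subrKA.
Qed.

End FundamentalTheory.

Section FundamentalRelations.
Context (R : realType) (H E E' : hilbertType R) (A B P : bop H H) (d : bop H E)
  (d' : bop H E') (Q : bop E' E) (F1 F2 : bop E E) (G1 G2 : bop E' E').
Hypothesis J : julia P d d' Q.
Hypothesis fF : fundamental A B P d F1 F2.
Hypothesis fG : fundamental (adj A) (adj B) (adj P) d' G1 G2.

Lemma fund_adjA v : A (adj d' v) = adj d' (adj G1 v) + P (adj d' (G2 v)).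
Proof.
apply: eq_dotl => h.
rewrite adjP adjPl (fund_dA fG) dotDr dotDl; congr (_ + _).
  by rewrite !adjPl.
by rewrite -adjP [RHS]adjP adjPl.
Qed.

(** Placed between [d'] on the right and [adj d] on the left, both sides become P^* B^* - P^* A P^*;
    the density of the ranges of [d'] and [d] removes these factors. *)
Lemma fund_QG v : Q (G2 v) = adj F2 (Q v).
Proof.
move: v; apply: (dense_eq (julia_dense' J)).
- exact: bounded_linear_comp (bounded_linear_bop _) (bounded_linear_bop _).
- exact: bounded_linear_comp (bounded_linear_bop _) (bounded_linear_bop _).
move=> k; apply: (adj_dense_inj (julia_dense J)).
rewrite -(julia_Pd' J) (fund_F2 fG) (julia_Q J) (fund_adjF1 (fundamental_swap fF)).
rewrite bopB adjK; congr (_ - _).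
by apply: adj_comm => x; rewrite (fund_BP fF).
Qed.

(** The entry of R1 U = U R1 from the first coordinate of l2(D_{P^*}) to that of l2(D_P). Between
    [d'] and [adj d] both sides equal B^* - A P^* - P^* A + P^* A P P^*. *)
Lemma fund_corner v :
  adj F2 (d (adj d' v)) - F1 (Q v) = d (adj d' (G2 v)) - Q (adj G1 v).
Proof.
move: v; apply: (dense_eq (julia_dense' J)).
- apply: bounded_linearD.
    do 2![apply: (bounded_linear_comp (bounded_linear_bop _))].
    exact: bounded_linear_bop.
  apply/bounded_linearN/(bounded_linear_comp (bounded_linear_bop _)).
  exact: bounded_linear_bop.
- apply: bounded_linearD.
    do 2![apply: (bounded_linear_comp (bounded_linear_bop _))].
    exact: bounded_linear_bop.
  apply/bounded_linearN/(bounded_linear_comp (bounded_linear_bop _)).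
  exact: bounded_linear_bop.
move=> k; apply: (adj_dense_inj (julia_dense J)); rewrite !bopB.
rewrite (fund_adjF1 (fundamental_swap fF)) (julia_Q J) (fund_F1 fF) (julia_dd J).
rewrite -(julia_Pd' J) (fund_adjF1 fG) (julia_dd' J) (fund_F2 fG) !adjK.
rewrite !bopB -!(fund_AP fF); apply: eq_dotl => z.
by rewrite !dotBl; ring.
Qed.

Lemma fund_adjG h : adj G2 (d' (P h)) = adj Q (F2 (d h)).
Proof.
apply: eq_dotl => v; rewrite !adjPl [RHS]adjP -fund_QG -[RHS]adjPl.
by rewrite (julia_adjQ J).
Qed.

End FundamentalRelations.

(** * The unitary extension *)

Section SquareSummableTheory.
Context (R : realType) (E : hilbertType R).
Implicit Types a b : l2 E.

Lemma l2_ext a b : (forall n, a n = b n) -> a = b.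
Proof. by move=> h; apply/val_inj/funext. Qed.

Lemma l2_cons_tail a : l2_cons (a 0%N) (l2_tail a) = a.
Proof. by apply: l2_ext => -[]. Qed.

Lemma l2_dotP a b : series (fun n => dot (a n) (b n)) @ \oo --> (dot a b : R[i]^o).
Proof. exact: (@l2_dot_cvg _ _ a b). Qed.

Lemma dot_l2_cons x y a b :
  dot (l2_cons x a) (l2_cons y b) = dot x y + dot a b.
Proof.
set s := series (fun n => dot (l2_cons x a n) (l2_cons y b n)) : nat -> R[i]^o.
apply: (@cvg_unique R[i]^o (@norm_hausdorff _ _) ((fun n => s n.+1) @ \oo)).
  have h : s @ \oo --> (dot (l2_cons x a) (l2_cons y b) : R[i]^o) by exact: l2_dotP.
  by move=> X /h[N _ hN]; exists N => // n Nn; apply: hN; exact: leqW.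
rewrite (_ : (fun n => _) = (fun n => (dot x y : R[i]^o) +
    series (fun n => dot (a n) (b n)) n)).
  by apply: cvgD; [exact: cvg_cst|exact: l2_dotP].
by apply/funext => n; rewrite /s /series /= big_nat_recl.
Qed.

End SquareSummableTheory.

Section SquareSummableMaps.
Context (R : realType) (E : hilbertType R).
Implicit Types a b : l2 E.

Lemma dot_l2_map (F : hilbertType R) (T : bop E F) a (b : l2 F) :
  dot (l2_map T a) b = dot a (l2_map (adj T) b).
Proof.
apply: (@cvg_unique R[i]^o (@norm_hausdorff _ _)
  ((series (fun n => dot (l2_map T a n) (b n)) : nat -> R[i]^o) @ \oo)).
  exact: l2_dotP.
rewrite (_ : (fun n => _) = (fun n => dot (a n) (l2_map (adj T) b n))).
  exact: l2_dotP.
by apply/funext => n; rewrite /= adjP.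
Qed.

Lemma sqnorm_iter_tail n a :
  sqnorm (iter n (@l2_tail R E) a) = sqnorm a - \sum_(i < n) sqnorm (a i).
Proof.
elim: n a => [|n IH] a; first by rewrite big_ord0 subr0.
rewrite iterSr IH big_ord_recl/= opprD addrA; congr (_ - _).
apply: complexI; rewrite rmorphB/= -!dot_sqnorm -{3 4}(l2_cons_tail a) dot_l2_cons.
by rewrite addrC addKr.
Qed.

Lemma l2_tail_small a (e : R) : 0 < e ->
  exists n, nrm (iter n (@l2_tail R E) a) <= e.
Proof.
move=> e0; have e2 : 0 < e ^+ 2 by rewrite exprn_gt0.
have sa : sqnorm a = limn (series (fun n => sqnorm (a n))).
  by apply: complexI; rewrite -dot_sqnorm -l2_dotE.
have /asboolP/cvgrPdist_le/(_ _ e2)[N _ /(_ N (leqnn N)) h] := valP a.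
exists N; rewrite -ler_sqr ?nnegrE ?nrm_ge0 ?(ltW e0)// nrm_sqr.
rewrite sqnorm_iter_tail sa; apply: le_trans (ler_norm _) _.
by move: h; rewrite seriesEord.
Qed.

Lemma l2_map_ge (F : hilbertType R) (T : bop E F) (c : R) : 0 < c ->
  (forall x, c * sqnorm x <= sqnorm (T x)) ->
  forall a, c * sqnorm a <= sqnorm (l2_map T a).
Proof.
move=> c0 h a; rewrite mulrC -ler_pdivlMr//; apply: l2_dot_le => n.
rewrite ler_pdivlMr// mulr_suml; apply: le_trans (l2_sum_le (l2_map T a) n).
by apply: ler_sum => i _; rewrite mulrC.
Qed.

End SquareSummableMaps.

Section Coordinates.
Context (R : realType) (E F : hilbertType R).
Implicit Types (a b : l2 E) (T : bop E F).

Lemma l2_0E n : (0 : l2 E) n = 0. Proof. by []. Qed.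
Lemma l2_DE a b n : (a + b) n = a n + b n. Proof. by []. Qed.
Lemma l2_NE a n : (- a) n = - a n. Proof. by []. Qed.
Lemma l2_ZE c a n : (c *: a) n = c *: a n. Proof. by []. Qed.
Lemma l2_mapE T a n : l2_map T a n = T (a n). Proof. by []. Qed.
Lemma l2_cons0E x a : l2_cons x a 0%N = x. Proof. by []. Qed.
Lemma l2_consSE x a n : l2_cons x a n.+1 = a n. Proof. by []. Qed.
Lemma l2_tailE a n : l2_tail a n = a n.+1. Proof. by []. Qed.
Lemma l2_single0E (x : E) : l2_single x 0%N = x. Proof. by []. Qed.
Lemma l2_singleSE (x : E) n : l2_single x n.+1 = 0. Proof. by []. Qed.

End Coordinates.

Definition l2E := (l2_0E, l2_DE, l2_NE, l2_ZE, l2_mapE, l2_cons0E, l2_consSE,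
  l2_tailE, l2_single0E, l2_singleSE).

(** * The block operators over abstract Julia data *)

Section UnitaryExtension.
Context (R : realType) (H E E' : hilbertType R) (P : bop H H)
  (d : bop H E) (d' : bop H E') (Q : bop E' E).
Local Notation Ht := (hsum H (l2 E)).
Local Notation K := (hsum Ht (l2 E')).

Definition ext_op (A : bop H H) (F1 F2 : bop E E) (G1 G2 : bop E' E') (x : K) : K :=
  hpair (hpair (A x.1.1 + adj d' (G2 (x.2 0%N)))
      (l2_map (adj F2) (l2_cons (d x.1.1) x.1.2) + l2_map F1 x.1.2 +
       l2_single (- adj F2 (Q (x.2 0%N)))))
    (l2_map (adj G1) x.2 + l2_map G2 (l2_tail x.2)).

Definition ext_unitary (x : K) : K :=
  hpair (hpair (P x.1.1 + adj d' (x.2 0%N))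
      (l2_cons (d x.1.1) x.1.2 + l2_single (- Q (x.2 0%N))))
    (l2_tail x.2).

(** The formula of the adjoint of [ext_unitary]. It serves as a right inverse, which together with
    the isometry property gives unitarity. *)
Definition ext_unitary_inv (x : K) : K :=
  hpair (hpair (adj P x.1.1 + adj d (x.1.2 0%N)) (l2_tail x.1.2))
    (l2_cons (d' x.1.1 - adj Q (x.1.2 0%N)) x.2).

Lemma ext_opE A F1 F2 G1 G2 h b a : ext_op A F1 F2 G1 G2 (hpair (hpair h b) a) =
  hpair (hpair (A h + adj d' (G2 (a 0%N)))
      (l2_map (adj F2) (l2_cons (d h) b) + l2_map F1 b +
       l2_single (- adj F2 (Q (a 0%N)))))
    (l2_map (adj G1) a + l2_map G2 (l2_tail a)).
Proof. by []. Qed.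

Lemma ext_unitaryE h b a : ext_unitary (hpair (hpair h b) a) =
  hpair (hpair (P h + adj d' (a 0%N))
      (l2_cons (d h) b + l2_single (- Q (a 0%N)))) (l2_tail a).
Proof. by []. Qed.

Lemma ext_unitary_invE h b a : ext_unitary_inv (hpair (hpair h b) a) =
  hpair (hpair (adj P h + adj d (b 0%N)) (l2_tail b))
    (l2_cons (d' h - adj Q (b 0%N)) a).
Proof. by []. Qed.

Lemma ext_opl A F1 F2 G1 G2 h b : ext_op A F1 F2 G1 G2 (hpair (hpair h b) 0) =
  hpair (hpair (A h) (l2_map (adj F2) (l2_cons (d h) b) + l2_map F1 b)) 0.
Proof.
rewrite ext_opE !l2E !bop_0 addr0 oppr0; congr (hpair (hpair _ _) _).
- by apply: l2_ext => -[|n]; rewrite !l2E addr0.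
- by apply: l2_ext => n; rewrite !l2E !bop_0 addr0.
Qed.

Lemma ext_unitaryl h b : ext_unitary (hpair (hpair h b) 0) =
  hpair (hpair (P h) (l2_cons (d h) b)) 0.
Proof.
rewrite ext_unitaryE !l2E !bop_0 addr0 oppr0; congr (hpair (hpair _ _) _).
by apply: l2_ext => -[|n]; rewrite !l2E addr0.
by apply: l2_ext => n; rewrite !l2E.
Qed.

Hypothesis J : julia P d d' Q.

Lemma ext_unitaryK x : ext_unitary (ext_unitary_inv x) = x.
Proof.
case: x => [[h b] a]; rewrite -/(hpair h b) -/(hpair (hpair h b) a).
rewrite ext_unitary_invE ext_unitaryE !l2E; congr (hpair (hpair _ _) _).
- rewrite bopD bopB (julia_dd' J) (julia_Pd J); apply: eq_dotl => z.
  by rewrite !(dotDl, dotNl); ring.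
- apply: l2_ext => -[|n]; rewrite !l2E ?addr0//.
  rewrite bopD bopB (julia_ddl J) (julia_Q J); apply: eq_dotl => z.
  by rewrite !(dotDl, dotNl); ring.
by apply: l2_ext => n; rewrite !l2E.
Qed.

Lemma dot_l2_map_adj (X Y : hilbertType R) (T : bop X Y) (a : l2 Y) (b : l2 X) :
  dot (l2_map (adj T) a) b = dot a (l2_map T b).
Proof. by rewrite dotC -dot_l2_map -dotC. Qed.

Lemma l2_map_cons (X Y : hilbertType R) (T : bop X Y) (x : X) (a : l2 X) :
  l2_map T (l2_cons x a) = l2_cons (T x) (l2_map T a).
Proof. by apply: l2_ext => -[|n]; rewrite !l2E. Qed.

Lemma dot_hpair (X Y : hilbertType R) (x x' : X) (y y' : Y) :
  dot (hpair x y) (hpair x' y') = dot x x' + dot y y'.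
Proof. by []. Qed.

Lemma l2_consD (X : hilbertType R) (x y : X) (u v : l2 X) :
  l2_cons x u + l2_cons y v = l2_cons (x + y) (u + v).
Proof. by apply: l2_ext => -[|n]; rewrite !l2E. Qed.

(** Apart from the shifts this is the isometry of the Julia operator: [e1] and [e2] say that its
    columns are isometric, [e3] and [e4] that they are orthogonal. *)
Lemma dot_ext_unitary x y : dot (ext_unitary x) (ext_unitary y) = dot x y.
Proof.
case: x y => [[h b] a] [[h' b'] a'].
rewrite -/(hpair h b) -/(hpair (hpair h b) a) -/(hpair h' b') -/(hpair (hpair h' b') a').
rewrite !ext_unitaryE /l2_single !l2_consD !addr0 !dot_hpair dot_l2_cons.
rewrite -[a in RHS]l2_cons_tail -[a' in RHS]l2_cons_tail dot_l2_cons.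
rewrite !(dotDl, dotDr, dotNl, dotNr).
have e1 : dot (P h) (P h') + dot (d h) (d h') = dot h h'.
  by rewrite adjP [X in _ + X]adjP (julia_dd J) dotBr addrC subrK.
have e2 : dot (adj d' (a 0%N)) (adj d' (a' 0%N)) + dot (Q (a 0%N)) (Q (a' 0%N)) =
    dot (a 0%N) (a' 0%N).
  by rewrite adjPl (julia_ddl' J) adjP dotBr subrK.
have e3 : dot (P h) (adj d' (a' 0%N)) = dot (d h) (Q (a' 0%N)).
  by rewrite adjP (julia_Pd' J) -adjP.
have e4 : dot (adj d' (a 0%N)) (P h') = dot (Q (a 0%N)) (d h').
  by rewrite adjPl -(julia_adjQ J) -adjP.
by rewrite e3 e4 -e1 -e2; ring.
Qed.

Section Operators.
Context (A B : bop H H) (F1 F2 : bop E E) (G1 G2 : bop E' E').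
Hypothesis fF : fundamental A B P d F1 F2.
Hypothesis fG : fundamental (adj A) (adj B) (adj P) d' G1 G2.
Local Notation R1 := (ext_op A F1 F2 G1 G2).
Local Notation R2 := (ext_op B F2 F1 G2 G1).
Local Notation U := ext_unitary.

Lemma ext_op_comm x : R1 (U x) = U (R1 x).
Proof.
case: x => [[h b] a]; rewrite -/(hpair h b) -/(hpair (hpair h b) a).
rewrite ext_unitaryE !ext_opE ext_unitaryE !l2E; congr (hpair (hpair _ _) _).
- rewrite !bopD (fund_adjA fG) (fund_AP fF); apply: eq_dotl => z.
  by rewrite !dotDl; ring.
- apply: l2_ext => -[|[|n]]; rewrite !l2E.
  + rewrite !bopD !bopN (fund_dA fF) (fund_QG J fF fG).
    have -> : adj F2 (d (adj d' (a 0%N))) =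
        d (adj d' (G2 (a 0%N))) - Q (adj G1 (a 0%N)) + F1 (Q (a 0%N)).
      by rewrite -(fund_corner J fF fG) subrK.
    by apply: eq_dotl => z; rewrite !(dotDl, dotNl); ring.
  + by rewrite !addr0 bopB addrAC.
  + by rewrite !addr0.
- by apply: l2_ext => n; rewrite !l2E.
Qed.

(** R1 = R2^* U on Ht in weak form, so that no formula for the adjoint of R2 has to be found. *)
Lemma ext_op_dot h b x :
  dot (U (hpair (hpair h b) 0)) (R2 x) = dot (R1 (hpair (hpair h b) 0)) x.
Proof.
case: x => [[h' b'] a']; rewrite -/(hpair h' b') -/(hpair (hpair h' b') a').
rewrite ext_unitaryl ext_opl ext_opE !dot_hpair !dot0l !addr0.
rewrite !dotDr !dotDl -(dot_l2_map F1) -(dot_l2_map_adj F2) l2_map_cons /l2_single.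
rewrite !dot_l2_cons dot0r addr0 dotNr.
have -> : dot (F1 (d h)) (d h') = dot (A h) h' - dot (P h) (B h').
  by rewrite -adjPl (fund_F1 fF) dotBl adjPl.
have -> : dot (P h) (adj d' (G1 (a' 0%N))) = dot (d h) (adj F1 (Q (a' 0%N))).
  rewrite -[RHS]adjP -[RHS]adjPl.
  rewrite -(fund_adjG J (fundamental_swap fF) (fundamental_swap fG)).
  by rewrite adjPl -adjP.
by ring.
Qed.

Hypothesis commF : forall x, F1 (F2 x) = F2 (F1 x).
Hypothesis commF_adj : forall x,
  F1 (adj F1 x) - adj F1 (F1 x) = F2 (adj F2 x) - adj F2 (F2 x).

(** On sequences R1 and R2 act as F2^* S + F1 and F1^* S + F2, with S the shift. The coefficients of
    1 and S^2 in the two products agree by [F1,F2] = 0, and that of S by [F1,F1^*] = [F2,F2^*]. *)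
Lemma ext_op_ext_opl h b :
  R1 (R2 (hpair (hpair h b) 0)) = R2 (R1 (hpair (hpair h b) 0)).
Proof.
rewrite !ext_opl; congr (hpair (hpair _ _) _); first exact: (fund_AB fF).
have key x : F1 (adj F1 x) = adj F1 (F1 x) + F2 (adj F2 x) - adj F2 (F2 x).
  by rewrite -addrA -commF_adj addrC subrK.
have adjF : forall x, adj F1 (adj F2 x) = adj F2 (adj F1 x) := adj_comm commF.
apply: l2_ext => -[|[|n]]; rewrite !l2E !bopD ?(fund_dA fF) ?(fund_dA (fundamental_swap fF));
  rewrite ?bopD key commF adjF; apply: eq_dotl => z; rewrite !(dotDl, dotNl); ring.
Qed.

End Operators.
End UnitaryExtension.

(** * Spectra of tetrablock unitaries *)

Section Transfer.
Context (R : realType) (K : hilbertType R) (U : bop K K) (M : set K).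
Hypothesis U_iso : forall x, nrm (U x) = nrm x.
Hypothesis M_absorbing : forall k (e : R), 0 < e ->
  exists n x r, [/\ iter n U k = x + r, M x & nrm r <= e].

(* Z, X, Y commute with the isometry U, so their values at k can be computed at
   U^n k, which is asymptotically in M. *)
Lemma isometry_transfer (Z X Y : bop K K) :
  (forall x, Z (U x) = U (Z x)) -> (forall x, X (U x) = U (X x)) ->
  (forall x, Y (U x) = U (Y x)) ->
  (forall x, M x -> nrm (Z x) <= nrm (X x) + nrm (Y x)) ->
  forall k, nrm (Z k) <= nrm (X k) + nrm (Y k).
Proof.
move=> ZU XU YU h k.
have [c1 c1_ge0 hc1] := nrm_bop_le Z; have [c2 c2_ge0 hc2] := nrm_bop_le X.
have [c3 c3_ge0 hc3] := nrm_bop_le Y.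
have iterU (T : bop K K) n : (forall x, T (U x) = U (T x)) ->
    nrm (T (iter n U k)) = nrm (T k).
  by move=> TU; elim: n => //= n IH; rewrite TU U_iso.
apply/ler_addgt0Pr => e e0; have c_gt0 : 0 < c1 + c2 + c3 + 1 by lra.
have [|n [x [r [kE Mx]]]] := @M_absorbing k (e / (c1 + c2 + c3 + 1)).
  by rewrite divr_gt0.
rewrite ler_pdivlMr// => re.
rewrite -(iterU _ n ZU) -(iterU _ n XU) -(iterU _ n YU) kE !bopD.
have hX := nrmB (X x + X r) (X r); rewrite addrK in hX.
have hY := nrmB (Y x + Y r) (Y r); rewrite addrK in hY.
have := nrmD (Z x) (Z r); have := h x Mx; have r0 := nrm_ge0 r.
have := hc1 r; have := hc2 r; have := hc3 r; nra.
Qed.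

Lemma isometry_transfer_eq (Z X : bop K K) :
  (forall x, Z (U x) = U (Z x)) -> (forall x, X (U x) = U (X x)) ->
  (forall x, M x -> Z x = X x) -> forall k, Z k = X k.
Proof.
move=> ZU XU h k; apply/subr0_eq/nrm_eq0/eqP; rewrite eq_le nrm_ge0 andbT.
have bD : bounded_linear (fun x => Z x - X x).
  by apply: bounded_linearD; [|apply: bounded_linearN]; exact: bounded_linear_bop.
have := @isometry_transfer (bop_of bD) (bop0 K K) (bop0 K K) _ _ _ _ k.
have z x : bop0 K K x = 0 by [].
rewrite !z nrm0 addr0; apply=> x.
- by rewrite /= ZU XU bopB.
- by rewrite !z bop_0.
- by rewrite !z bop_0.
- by move=> Mx; rewrite /= h// subrr nrm0.
Qed.

End Transfer.

(** * Exactness of the Koszul complex from a joint lower bound *)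

Section KoszulExactness.
Context (R : realType) (K : hilbertType R) (S1 S2 S3 : bop K K).
Hypothesis S12 : forall x, S1 (S2 x) = S2 (S1 x).
Hypothesis S13 : forall x, S1 (S3 x) = S3 (S1 x).
Hypothesis S23 : forall x, S2 (S3 x) = S3 (S2 x).

(* A left inverse of the first Koszul map that commutes with the S_i yields a
   contracting homotopy. *)
Lemma koszul_exact_homotopy (X : 'I_3 -> bop K K) :
  (forall x, X 0 (S1 x) + X 1 (S2 x) + X 2%:R (S3 x) = x) ->
  (forall i x, S1 (X i x) = X i (S1 x)) ->
  (forall i x, S2 (X i x) = X i (S2 x)) ->
  (forall i x, S3 (X i x) = X i (S3 x)) ->
  koszul_exact S1 S2 S3.
Proof.
move=> h C1 C2 C3; split.
- by move=> x e1 e2 e3; rewrite -(h x) e1 e2 e3 !bop_0 !addr0.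
- move=> x1 x2 x3 /subr0_eq e12 /subr0_eq e13 /subr0_eq e23.
  exists (X 0 x1 + X 1 x2 + X 2%:R x3); split.
  + by rewrite !bopD !C1 e12 e13 h.
  + by rewrite !bopD !C2 -e12 e23 h.
  + by rewrite !bopD !C3 -e13 -e23 h.
- move=> x12 x13 x23 e.
  exists (- X 1 x12 - X 2%:R x13), (X 0 x12 - X 2%:R x23), (X 0 x13 + X 1 x23).
  have e1 : S1 x23 = S2 x13 - S3 x12.
    by apply/subr0_eq; rewrite -e opprB addrA addrAC.
  rewrite !(bopD, bopN) !(C1, C2, C3) e1 !(bopD, bopN).
  split; [rewrite -{1}(h x12)|rewrite -{1}(h x13)|rewrite -{1}(h x23)].
  + by apply: eq_dotl => z; rewrite !(dotDl, dotNl); ring.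
  + by apply: eq_dotl => z; rewrite !(dotDl, dotNl); ring.
  + rewrite e1 !(bopD, bopN); apply: eq_dotl => z.
    by rewrite !(dotDl, dotNl); ring.
- move=> y; exists (X 2%:R y), (- X 1 y), (X 0 y).
  by rewrite bopN opprK C1 C2 C3 h.
Qed.

Lemma coercive_inverse (T : bop K K) (c : R) : 0 < c ->
  (forall x y, dot (T x) y = dot x (T y)) ->
  (forall x, c * sqnorm x <= complex.Re (dot (T x) x)) ->
  exists G : bop K K, (forall y, T (G y) = y) /\ (forall x, G (T x) = x).
Proof.
move=> c0 T_sym Tc.
have Tinj x y : T x = T y -> x = y.
  move=> e; apply/subr0_eq/sqnorm_eq0/eqP; rewrite eq_le sqnorm_ge0 andbT.
  by have := Tc (x - y); rewrite bopB e subrr dot0l /=; rewrite pmulr_rle0.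
have [G TG] : exists G : K -> K, forall y, T (G y) = y.
  suff h y : exists x, T x = y by have [G hG] := choice h; exists G.
  have [|||x hx] := @lax_milgram _ _ T c c0 T_sym Tc (fun x => dot x y) (sqnorm y).
  - exact: sqnorm_ge0.
  - by move=> a x z; rewrite dot_linearl.
  - by move=> x; rewrite mulrC; exact: Re_dot_sqr_le.
  by exists x; apply: eq_dotr => z; rewrite -hx.
suff GB : bounded_linear G.
  by exists (bop_of GB); split=> //= x; apply: Tinj; rewrite TG.
split=> [a x y|]; first by apply: Tinj; rewrite bopD bopZ !TG.
apply: (@nrm_sqbounded _ _ _ _ c^-1) => y; rewrite mulrC ler_pdivlMr// mulrC.
have [->|n0] := eqVneq (nrm (G y)) 0; first by rewrite mulr0 nrm_ge0.
have n1 : 0 < nrm (G y) by rewrite lt0r n0 nrm_ge0.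
rewrite -(ler_pM2r n1) -mulrA -expr2 nrm_sqr; apply: le_trans (Tc _) _.
by rewrite TG Re_dot_le.
Qed.

Hypothesis adj_comm_S : forall S S', S \in [:: S1; S2; S3] -> S' \in [:: S1; S2; S3] ->
  forall x, adj S (S' x) = S' (adj S x).

(** The sum of the S_i^* S_i is coercive, hence has a bounded inverse G, which commutes with every
    S_i because the S_i commute with each other and with all the adjoints. The homotopy is then X_i
    = G S_i^*. *)
Lemma koszul_exact_bounded_below (c : R) : 0 < c ->
  (forall x, c * sqnorm x <= sqnorm (S1 x) + sqnorm (S2 x) + sqnorm (S3 x)) ->
  koszul_exact S1 S2 S3.
Proof.
move=> c0 h.
have bT : bounded_linear (fun x => adj S1 (S1 x) + adj S2 (S2 x) + adj S3 (S3 x)).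
  by do ![apply: bounded_linearD]; apply: (bounded_linear_comp (bounded_linear_bop _));
    exact: bounded_linear_bop.
have [G [TG GT]] : exists G : bop K K, (forall y, bop_of bT (G y) = y) /\
    (forall x, G (bop_of bT x) = x).
  apply: (coercive_inverse c0) => /= [x y|x].
    by rewrite !dotDl !dotDr !adjPl !adjP.
  by rewrite !dotDl !adjPl !ReD.
have GC S : S \in [:: S1; S2; S3] -> forall x, S (G x) = G (S x).
  move=> Sin x; have TS y : bop_of bT (S y) = S (bop_of bT y).
    rewrite /= !bopD -!adj_comm_S// ?inE ?eqxx ?orbT//.
    by move: Sin; rewrite !inE => /or3P[]/eqP->; rewrite ?S12 ?S13 ?S23.
  by rewrite -[LHS]GT TS TG.
pose X (i : 'I_3) : bop K K := bop_of (bounded_linear_comp (bounded_linear_bop G)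
  (bounded_linear_bop (adj (nth S1 [:: S1; S2; S3] i)))).
have nthS (i : 'I_3) : nth S1 [:: S1; S2; S3] i \in [:: S1; S2; S3].
  by apply: mem_nth; case: i.
apply: (koszul_exact_homotopy (X := X)) => [x|i x|i x|i x].
- by rewrite /X /= -!bopD; exact: GT.
- by rewrite /X /= GC ?inE ?eqxx// adj_comm_S// inE eqxx.
- by rewrite /X /= GC ?inE ?eqxx ?orbT// adj_comm_S// !inE eqxx orbT.
- by rewrite /X /= GC ?inE ?eqxx ?orbT// adj_comm_S// !inE eqxx !orbT.
Qed.

End KoszulExactness.

Lemma cmod_ge0 (R : realType) (a : R[i]) : 0 <= cmod a.
Proof. by rewrite -ler0c -cmodE. Qed.

Lemma cmod_conj (R : realType) (a : R[i]) : cmod (a^*) = cmod a.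
Proof. by rewrite /cmod norm_conjC. Qed.

Lemma cmod_eq0 (R : realType) (a : R[i]) : cmod a = 0 -> a = 0.
Proof. by move=> h; apply/normr0_eq0; rewrite cmodE h. Qed.

Lemma cmodM (R : realType) (a b : R[i]) : cmod (a * b) = cmod a * cmod b.
Proof. by apply: complexI; rewrite rmorphM/= -!cmodE normrM. Qed.

Section ShiftedOperator.
Context (R : realType) (K : hilbertType R) (T : bop K K) (z : R[i]).

Lemma bounded_linear_shifted : bounded_linear (fun x => T x - z *: x).
Proof.
apply: bounded_linearD; first exact: bounded_linear_bop.
apply: bounded_linearN; split=> [a x y|].
  by rewrite scalerDr !scalerA mulrC.
by apply: (@nrm_sqbounded _ _ _ _ (cmod z)) => x; rewrite nrmZ.
Qed.

Definition shifted := bop_of bounded_linear_shifted.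

Lemma adj_shifted y : adj shifted y = adj T y - z^* *: y.
Proof.
apply: (adj_unique (f := fun y => adj T y - z^* *: y)) => x {}y /=.
by rewrite dotBl dotBr adjP dotZl dotZr conjCK.
Qed.

Lemma nrm_adj_shifted : normal_op T -> forall x,
  nrm (adj T x - z^* *: x) = nrm (T x - z *: x).
Proof.
move=> nT x; apply/eqP; rewrite -(eqrXn2 (n := 2)) ?nrm_ge0// !nrm_sqr; apply/eqP.
apply: complexI; rewrite -!dot_sqnorm -adj_shifted -[T x - _]/(shifted x).
rewrite [LHS]adjPl [RHS]adjP /= !adj_shifted bopB bopZ [in RHS]bopB bopZ nT.
congr dot; apply: eq_dotl => w.
by rewrite !(dotDl, dotNl, dotZl); ring.
Qed.

End ShiftedOperator.

(** * Taylor spectrum of a commuting triple with N3 unitary and N1 = N2^* N3 *)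

Section TetrablockUnitarySpectrum.
Context (R : realType) (K : hilbertType R) (N1 N2 N3 : bop K K).
Hypothesis N12 : forall x, N1 (N2 x) = N2 (N1 x).
Hypothesis N13 : forall x, N1 (N3 x) = N3 (N1 x).
Hypothesis N23 : forall x, N2 (N3 x) = N3 (N2 x).
Hypothesis N3_iso : forall x, adj N3 (N3 x) = x.
Hypothesis N3_coiso : forall x, N3 (adj N3 x) = x.
Hypothesis N1E : forall x, N1 x = adj N2 (N3 x).

Lemma unitary_N2E x : N2 x = adj N1 (N3 x).
Proof.
apply: eq_dotl => y; rewrite adjPl N1E -[RHS]adjP N23 [RHS]adjP N3_iso.
by [].
Qed.

Lemma unitary_adj_comm (T : bop K K) : (forall x, T (N3 x) = N3 (T x)) ->
  forall x, adj N3 (T x) = T (adj N3 x).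
Proof. by move=> h x; rewrite -{1}(N3_coiso x) h N3_iso. Qed.

Let NN S T : S \in [:: N1; N2; N3] -> T \in [:: N1; N2; N3] ->
  forall x, S (T x) = T (S x).
Proof.
by rewrite !inE => /or3P[]/eqP-> /or3P[]/eqP-> x; rewrite ?N12 ?N13 ?N23.
Qed.

(** The adjoints are products of members of the family with N3^*, namely N1^* = N2 N3^* and N2^* =
    N1 N3^*; only commutation with the inverse of N3 is left. *)
Lemma unitary_adjN S T : S \in [:: N1; N2; N3] -> T \in [:: N1; N2; N3] ->
  forall x, adj S (T x) = T (adj S x).
Proof.
move=> Sin Tin x.
have T3 y : T (N3 y) = N3 (T y) by apply: NN; rewrite // !inE eqxx !orbT.
have adjN1 y : adj N1 y = N2 (adj N3 y) by rewrite unitary_N2E N3_coiso.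
have adjN2 y : adj N2 y = N1 (adj N3 y) by rewrite N1E N3_coiso.
move: Sin; rewrite !inE => /or3P[]/eqP->.
- by rewrite !adjN1 unitary_adj_comm//; apply: NN; rewrite // !inE eqxx !orbT.
- by rewrite !adjN2 unitary_adj_comm//; apply: NN; rewrite // !inE eqxx.
- exact: unitary_adj_comm.
Qed.

Lemma unitary_normal T : T \in [:: N1; N2; N3] -> normal_op T.
Proof. by move=> Tin x; rewrite unitary_adjN. Qed.

Lemma unitary_bounded_below_exact (z1 z2 z3 : R[i]) (c : R) : 0 < c ->
  (forall x, c * nrm x <= nrm (N1 x - z1 *: x) + nrm (N2 x - z2 *: x) +
                         nrm (N3 x - z3 *: x)) ->
  koszul_exact (fun x => N1 x - z1 *: x) (fun x => N2 x - z2 *: x)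
    (fun x => N3 x - z3 *: x).
Proof.
move=> c0 h.
have Sin (S : bop K K) : S \in [:: shifted N1 z1; shifted N2 z2; shifted N3 z3] ->
    exists T z, T \in [:: N1; N2; N3] /\ S = shifted T z.
  rewrite !inE => /or3P[]/eqP->; [exists N1, z1|exists N2, z2|exists N3, z3];
    by rewrite !inE eqxx ?orbT.
have SC S S' : S \in [:: shifted N1 z1; shifted N2 z2; shifted N3 z3] ->
    S' \in [:: shifted N1 z1; shifted N2 z2; shifted N3 z3] ->
    forall x, S (S' x) = S' (S x).
  move=> /Sin[T [z [Tin ->]]] /Sin[T' [z' [Tin' ->]]] x /=.
  rewrite !(bopB, bopZ) (NN Tin Tin'); apply: eq_dotl => w.
  by rewrite !(dotDl, dotNl, dotZl); ring.
(* The factor 3 comes from (p1 + p2 + p3)^2 <= 3 (p1^2 + p2^2 + p3^2). *)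
apply: (@koszul_exact_bounded_below _ _ (shifted N1 z1) (shifted N2 z2) (shifted N3 z3)
  _ _ _ _ (c ^+ 2 / 3)).
- by apply: SC; rewrite !inE eqxx ?orbT.
- by apply: SC; rewrite !inE eqxx ?orbT.
- by apply: SC; rewrite !inE eqxx ?orbT.
- move=> _ _ /Sin[T [z [Tin ->]]] /Sin[T' [z' [Tin' ->]]] x /=.
  rewrite !adj_shifted /= !(bopB, bopZ) unitary_adjN//; apply: eq_dotl => w.
  by rewrite !(dotDl, dotNl, dotZl); ring.
- by rewrite divr_gt0// exprn_gt0.
move=> x /=; rewrite -!nrm_sqr; have := h x.
have p1_ge0 := nrm_ge0 (N1 x - z1 *: x); have p2_ge0 := nrm_ge0 (N2 x - z2 *: x).
have p3_ge0 := nrm_ge0 (N3 x - z3 *: x); have n_ge0 := nrm_ge0 x.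
set n := nrm x in n_ge0 *; set p1 := nrm (N1 x - _) in p1_ge0 *.
set p2 := nrm (N2 x - _) in p2_ge0 *; set p3 := nrm (N3 x - _) in p3_ge0 * => hh.
have : (c * n) ^+ 2 <= (p1 + p2 + p3) ^+ 2.
  by rewrite ler_sqr ?nnegrE ?mulr_ge0 ?addr_ge0 ?(ltW c0).
have := sqr_ge0 (p1 - p2); have := sqr_ge0 (p1 - p3); have := sqr_ge0 (p2 - p3).
rewrite exprMn; lra.
Qed.

Hypothesis N2_below : forall z2 z3, 1 < cmod z2 -> cmod z3 = 1 ->
  exists2 c, 0 < c &
    forall x, c * nrm x <= nrm (N2 x - z2 *: x) + nrm (N3 x - z3 *: x).

Lemma unitary_taylor_spectrum z : taylor_spectrum N1 N2 N3 z ->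
  [/\ cmod z.2 = 1, cmod z.1.2 <= 1 & (z.1.1 : R[i]) = (z.1.2 : R[i])^* * z.2].
Proof.
case: z => [[z1 z2] z3]; rewrite /taylor_spectrum /= => nexact.
have N3_nrm x : nrm (N3 x) = nrm x.
  apply/eqP; rewrite -(eqrXn2 (n := 2)) ?nrm_ge0// !nrm_sqr; apply/eqP/complexI.
  by rewrite -!dot_sqnorm [LHS]adjP N3_iso.
have not_below c : 0 < c -> ~ (forall x, c * nrm x <= nrm (N1 x - z1 *: x) +
    nrm (N2 x - z2 *: x) + nrm (N3 x - z3 *: x)).
  by move=> c0 h; apply: nexact; exact: (unitary_bounded_below_exact c0 h).
have z3_1 : cmod z3 = 1.
  apply: contrapT => z3n.
  have c0 : 0 < `|1 - cmod z3| by rewrite normr_gt0 subr_eq0; apply/eqP => e; exact: z3n.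
  apply: (not_below _ c0) => x.
  apply: le_trans (_ : nrm (N3 x - z3 *: x) <= _); last by rewrite lerDr addr_ge0 ?nrm_ge0.
  have := nrmD (N3 x - z3 *: x) (z3 *: x); rewrite subrK N3_nrm nrmZ.
  have := nrmB (N3 x) (N3 x - z3 *: x); rewrite subKr N3_nrm nrmZ.
  by have := nrm_ge0 x; have [_|_] := ger0P (1 - cmod z3); lra.
split=> //.
  rewrite leNgt; apply/negP => z2_gt1; have [c c0 h] := N2_below z2_gt1 z3_1.
  apply: (not_below _ c0) => x; apply: le_trans (h x) _.
  by rewrite -addrA lerDr nrm_ge0.
apply/subr0_eq/cmod_eq0/eqP; set w := _ - _; rewrite eq_le cmod_ge0 andbT leNgt.
apply/negP => w0.
(* By normality an approximate eigenvector of N2 is one of N2^*, so N1 = N2^* N3 forces z1 = conj z2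
   * z3. The expansion of w x below has coefficients 1, 1 and |z2| on the three residuals, all at
   most 1 + |z2|. *)
have c0 : 0 < cmod w / (1 + cmod z2) by rewrite divr_gt0// ltr_pwDl// cmod_ge0.
apply: (not_below _ c0) => x.
rewrite mulrAC ler_pdivrMr ?ltr_pwDl ?cmod_ge0// -nrmZ.
have -> : w *: x = N3 (adj N2 x - z2^* *: x) - (N1 x - z1 *: x) + z2^* *: (N3 x - z3 *: x).
  rewrite bopB bopZ -unitary_adjN ?inE ?eqxx ?orbT// -N1E /w.
  by apply: eq_dotl => y; rewrite !(dotDl, dotNl, dotZl); ring.
have := nrmD (N3 (adj N2 x - z2^* *: x) - (N1 x - z1 *: x)) (z2^* *: (N3 x - z3 *: x)).
have := nrmB (N3 (adj N2 x - z2^* *: x)) (N1 x - z1 *: x).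
rewrite N3_nrm nrmZ cmod_conj nrm_adj_shifted; last first.
  by apply: unitary_normal; rewrite !inE eqxx ?orbT.
have := nrm_ge0 (N1 x - z1 *: x); have := nrm_ge0 (N2 x - z2 *: x).
have := nrm_ge0 (N3 x - z3 *: x); have := cmod_ge0 z2.
nra.
Qed.

End TetrablockUnitarySpectrum.

(** * The von Neumann inequality on the tetrablock *)

Lemma cmod_sqr (R : realType) (z : R[i]) :
  cmod z ^+ 2 = complex.Re z ^+ 2 + complex.Im z ^+ 2.
Proof. by rewrite /cmod normc_def sqr_sqrtr// addr_ge0 ?sqr_ge0. Qed.

Lemma cmodD (R : realType) (a b : R[i]) : cmod (a + b) <= cmod a + cmod b.
Proof. by rewrite -lecR rmorphD/= -!cmodE ler_normD. Qed.

Lemma cmodN (R : realType) (a : R[i]) : cmod (- a) = cmod a.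
Proof. by rewrite /cmod normrN. Qed.

Lemma cmodB (R : realType) (a b : R[i]) : cmod (a - b) <= cmod a + cmod b.
Proof. by rewrite -(cmodN b) cmodD. Qed.

Lemma cmod0 (R : realType) : cmod (0 : R[i]) = 0.
Proof. by rewrite /cmod normr0. Qed.

Lemma cmod1 (R : realType) : cmod (1 : R[i]) = 1.
Proof. by rewrite /cmod normr1. Qed.

Lemma cmodX (R : realType) (a : R[i]) n : cmod (a ^+ n) = cmod a ^+ n.
Proof. by apply: complexI; rewrite rmorphXn/= -!cmodE normrX. Qed.

Lemma cmod_ball (R : realType) (x y : R[i]^o) (e : R) :
  ball x e%:C%C y <-> cmod (x - y : R[i]) < e.
Proof. by rewrite -ball_normE/= cmodE ltcR. Qed.

Lemma det_mx22 (C : comNzRingType) (A : 'M[C]_2) :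
  \det A = A 0 0 * A 1 1 - A 0 1 * A 1 0.
Proof.
rewrite (expand_det_row _ ord0) !big_ord_recl big_ord0 /cofactor !det_mx11 !mxE/=.
rewrite addr0 expr0 mul1r expr1 mulN1r mulrN.
by congr (_ * A _ _ - A _ _ * A _ _); apply/val_inj.
Qed.

(** * Scalar inequalities on the tetrablock *)

Section TetrablockScalar.
Context (R : realType).

Lemma euclid_norm_sqr n (v : 'cV[R[i]]_n) :
  euclid_norm v ^+ 2 = \sum_i cmod (v i 0) ^+ 2.
Proof. by rewrite /euclid_norm sqr_sqrtr// sumr_ge0// => i _; rewrite sqr_ge0. Qed.

Lemma euclid_normZ n (t : R) (v : 'cV[R[i]]_n) : 0 <= t ->
  euclid_norm (t%:C%C *: v) = t * euclid_norm v.
Proof.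
move=> t0; apply/eqP; rewrite -(eqrXn2 (n := 2)) ?mulr_ge0 ?sqrtr_ge0//.
rewrite exprMn !euclid_norm_sqr mulr_sumr; apply/eqP/eq_bigr => i _.
by rewrite mxE cmodM exprMn /cmod ger0_norm ?ler0c.
Qed.

Lemma mx_opnorm_bounded n (A : 'M[R[i]]_n) :
  has_ubound [set euclid_norm (A *m v) | v in [set v | euclid_norm v <= 1]].
Proof.
exists (Num.sqrt (\sum_i (\sum_j cmod (A i j)) ^+ 2)) => _ [v /= v1 <-].
rewrite -ler_sqr ?nnegrE ?sqrtr_ge0// euclid_norm_sqr sqr_sqrtr; last first.
  by apply: sumr_ge0 => i _; rewrite sqr_ge0.
apply: ler_sum => i _; rewrite ler_sqr ?nnegrE ?cmod_ge0 ?sumr_ge0//; last first.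
  by move=> j _; exact: cmod_ge0.
rewrite mxE.
have cs (s : seq 'I_n) (f : 'I_n -> R[i]) : cmod (\sum_(j <- s) f j) <= \sum_(j <- s) cmod (f j).
  elim: s => [|j s IH]; first by rewrite !big_nil cmod0.
  by rewrite !big_cons; apply: le_trans (cmodD _ _) _; rewrite lerD2l.
apply: le_trans (cs _ _) _; apply: ler_sum => j _.
rewrite cmodM ler_piMr ?cmod_ge0//.
rewrite -(@ler_pXn2r _ 2) ?nnegrE ?cmod_ge0// expr1n.
apply: (@le_trans _ _ (euclid_norm v ^+ 2)).
  rewrite euclid_norm_sqr (bigD1 j)//= lerDl sumr_ge0// => k _.
  by rewrite sqr_ge0.
by rewrite -(expr1n _ 2) ler_sqr ?nnegrE ?sqrtr_ge0.
Qed.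

Lemma mx_opnorm_lt1 n (A : 'M[R[i]]_n) : mx_opnorm A < 1 ->
  forall v, euclid_norm (A *m v) <= euclid_norm v.
Proof.
move=> A1 v; have v0 : 0 <= euclid_norm v by exact: sqrtr_ge0.
have [v00|vn] := eqVneq (euclid_norm v) 0.
  suff -> : v = 0 by rewrite mulmx0.
  have := euclid_norm_sqr v; rewrite v00 expr0n => /esym/eqP.
  rewrite psumr_eq0 => [/allP h|i _]; last exact: sqr_ge0.
  apply/matrixP => i j; rewrite ord1 mxE; apply: cmod_eq0.
  by apply/eqP; rewrite -sqrf_eq0; apply: (h i); rewrite mem_index_enum.
have vp : 0 < euclid_norm v by rewrite lt0r vn.
have : euclid_norm (A *m ((euclid_norm v)^-1%:C%C *: v)) <= mx_opnorm A.
  apply: sup_ubound; first exact: mx_opnorm_bounded.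
  by exists ((euclid_norm v)^-1%:C%C *: v) => //=; rewrite euclid_normZ ?invr_ge0// mulVf.
rewrite -scalemxAr euclid_normZ ?invr_ge0// => h.
have := le_lt_trans h A1; rewrite -(ltr_pM2l vp) mulrA mulfV// mul1r mulr1.
exact: ltW.
Qed.

(* Apply the contraction A to the vector (1 - w a22, w a21), resp. (w a12, 1 - w a11). *)
Lemma tetrablock_disc z (w : R[i]) : tetrablock z -> cmod w <= 1 ->
  cmod ((z.1.1 : R[i]) - w * z.2) <= cmod (1 - w * z.1.2) /\
  cmod ((z.1.2 : R[i]) - w * z.2) <= cmod (1 - w * z.1.1).
Proof.
move=> [A /mx_opnorm_lt1 hA ->] w1 /=.
have wle (x : R[i]) : cmod (w * x) ^+ 2 <= cmod x ^+ 2.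
  by rewrite ler_sqr ?nnegrE ?cmod_ge0// cmodM ler_piMl ?cmod_ge0.
have l1 : lift ord0 ord0 = 1 :> 'I_2 by apply/val_inj.
have key (x y : R[i]) : cmod (A 0 0 * x + A 0 1 * y) ^+ 2 +
    cmod (A 1 0 * x + A 1 1 * y) ^+ 2 <= cmod x ^+ 2 + cmod y ^+ 2.
  have := hA (\col_i (if i == 0 then x else y)).
  rewrite -(ler_pXn2r (n := 2)) ?nnegrE ?sqrtr_ge0// !euclid_norm_sqr.
  by rewrite !big_ord_recl !big_ord0 !addr0 !mxE !big_ord_recl !big_ord0 !mxE/= !addr0 l1.
rewrite det_mx22; split; rewrite -(ler_pXn2r (n := 2)) ?nnegrE ?cmod_ge0//.
  have := key (1 - w * A 1 1) (w * A 1 0); have := wle (A 1 0).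
  have -> : A 0 0 * (1 - w * A 1 1) + A 0 1 * (w * A 1 0) =
    A 0 0 - w * (A 0 0 * A 1 1 - A 0 1 * A 1 0) by ring.
  have -> : A 1 0 * (1 - w * A 1 1) + A 1 1 * (w * A 1 0) = A 1 0 by ring.
  lra.
have := key (w * A 0 1) (1 - w * A 0 0); have := wle (A 0 1).
have -> : A 1 0 * (w * A 0 1) + A 1 1 * (1 - w * A 0 0) =
  A 1 1 - w * (A 0 0 * A 1 1 - A 0 1 * A 1 0) by ring.
have -> : A 0 0 * (w * A 0 1) + A 0 1 * (1 - w * A 0 0) = A 0 1 by ring.
lra.
Qed.

Lemma closure_tetrablock_approx (z : triC R) (e : R) : closure (tetrablock (R := R)) z ->
  0 < e -> exists y : triC R, [/\ tetrablock y, cmod ((z.1.1 : R[i]) - y.1.1) < e,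
    cmod ((z.1.2 : R[i]) - y.1.2) < e & cmod ((z.2 : R[i]) - y.2) < e].
Proof.
move=> cz e0; have e0' : 0 < e%:C%C :> R[i] by rewrite ltcR.
have [y [Ty [[b1 b2] b3]]] := cz _ (nbhsx_ballx z _ e0').
by exists y; split=> //; exact/cmod_ball.
Qed.

Lemma closure_tetrablock_disc (z : triC R) (w : R[i]) :
  closure (tetrablock (R := R)) z -> cmod w <= 1 ->
  cmod ((z.1.1 : R[i]) - w * z.2) <= cmod (1 - w * z.1.2) /\
  cmod ((z.1.2 : R[i]) - w * z.2) <= cmod (1 - w * z.1.1).
Proof.
move=> cz w1.
have wle (x : R[i]) : cmod (w * x) <= cmod x by rewrite cmodM ler_piMl ?cmod_ge0.
have key (a b p a' b' p' : R[i]) (e : R) : cmod (a' - w * p') <= cmod (1 - w * b') ->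
    cmod (a - a') < e -> cmod (b - b') < e -> cmod (p - p') < e ->
    cmod (a - w * p) <= cmod (1 - w * b) + 3 * e.
  move=> h ha hb hp.
  have -> : a - w * p = (a' - w * p') + ((a - a') - w * (p - p')) by ring.
  have := cmodD (a' - w * p') ((a - a') - w * (p - p')).
  have := cmodB (a - a') (w * (p - p')); have := wle (p - p').
  have := cmodD (1 - w * b) (w * (b - b')); have := wle (b - b').
  have -> : 1 - w * b + w * (b - b') = 1 - w * b' by ring.
  lra.
split; apply/ler_addgt0Pr => e e0; have e3 : 0 < e / 3 by rewrite divr_gt0.
  have [y [Ty h1 h2 h3]] := closure_tetrablock_approx cz e3.
  have [h _] := tetrablock_disc Ty w1.
  by have := key _ _ _ _ _ _ _ h h1 h2 h3; lra.
have [y [Ty h1 h2 h3]] := closure_tetrablock_approx cz e3.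
have [_ h] := tetrablock_disc Ty w1.
by have := key _ _ _ _ _ _ _ h h2 h1 h3; lra.
Qed.

Lemma closure_tetrablock_le1 (z : triC R) : closure (tetrablock (R := R)) z ->
  cmod z.1.1 <= 1 /\ cmod z.1.2 <= 1.
Proof.
move=> cz; have := closure_tetrablock_disc (w := 0) cz.
by rewrite cmod0 !mul0r !subr0 cmod1; apply; rewrite ler01.
Qed.

(** A point of the domain, so that the supremum in the von Neumann inequality is over a nonempty
    set. *)
Lemma tetrablock0 : tetrablock ((0, 0, 0) : triC R).
Proof.
exists 0; last by rewrite !mxE det0.
suff : mx_opnorm (0 : 'M[R[i]]_2) <= 0 by move=> h; apply: le_lt_trans h _.
have n0 : euclid_norm (0 : 'cV[R[i]]_2) = 0.
  by rewrite /euclid_norm big1 ?sqrtr0// => i _; rewrite mxE normr0 expr0n.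
apply: ge_sup; first by exists 0, 0; rewrite /= ?mul0mx n0.
by move=> _ [v _ <-]; rewrite mul0mx n0.
Qed.

End TetrablockScalar.

(** * Polynomial functional calculus on lists of monomials *)

Section PolynomialCalculus.
Import -(notations) mpoly.
Context (R : realType) (H : hilbertType R).

Lemma bounded_linear_iter (T : bop H H) n : bounded_linear (fun x => iter n T x).
Proof.
elim: n => [|n IH]; first exact: bounded_linear_id.
exact: bounded_linear_comp (bounded_linear_bop T) IH.
Qed.

Lemma bounded_linearZ (U V : hilbertType R) (c : R[i]) (f : U -> V) :
  bounded_linear f -> bounded_linear (fun x => c *: f x).
Proof.
move=> [lf [M hM]]; split=> [a x y|].
  by rewrite lf scalerDr !scalerA mulrC.
exists (complex.Re (`|c| ^+ 2) * M) => x; rewrite sqnormZ -mulrA ler_wpM2l//.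
by rewrite -ler0c Re_normsq exprn_ge0.
Qed.

Lemma nrm_opnorm (T : H -> H) : bounded_linear T -> forall x, nrm (T x) <= opnorm T * nrm x.
Proof.
move=> bT x; have [M M0 hM] := nrm_bop_le (bop_of bT).
have [x0|xn] := eqVneq (nrm x) 0.
  by rewrite (nrm_eq0 x0) -[T 0]/(bop_of bT 0) bop_0 nrm0 mulr0.
have xp : 0 < nrm x by rewrite lt0r xn nrm_ge0.
rewrite -ler_pdivrMr// mulrC -(nrmZr (T x)) ?invr_ge0 ?nrm_ge0//.
rewrite -[T x]/(bop_of bT x) -bopZ /=; apply: sup_ubound.
  exists M => _ [y /= y1 <-]; rewrite -/(nrm (T y)) (le_trans (hM y))//.
  by rewrite ler_piMr// -lecR -nrmE.
exists ((nrm x)^-1%:C%C *: x) => //=.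
by rewrite nrmE nrmZr ?invr_ge0 ?nrm_ge0// mulVf.
Qed.

Definition term : Type := R[i] * (nat * nat * nat).

Definition term_op (A B P : H -> H) (t : term) (h : H) : H :=
  t.1 *: iter t.2.1.1 A (iter t.2.1.2 B (iter t.2.2 P h)).

Definition term_eval (t : term) (z : triC R) : R[i] :=
  t.1 * ((z.1.1 : R[i]) ^+ t.2.1.1 * (z.1.2 : R[i]) ^+ t.2.1.2 * (z.2 : R[i]) ^+ t.2.2).

Definition term_poly (t : term) : mpoly.mpoly 3 R[i] :=
  t.1 *: mpoly.mpolyX R[i] (mpoly.Multinom [tuple t.2.1.1; t.2.1.2; t.2.2]).

Let monom_op (A B P : H -> H) (m : mpoly.multinom 3) (h : H) : H :=
  let e i := nth 0%N (mpoly.multinom_val m) i in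
  iter (e 0%N) A (iter (e 1%N) B (iter (e 2%N) P h)).

(** [poly_op] sums over the support, which changes under addition; a common larger list for p, q and
    p + q makes it additive. *)
Lemma poly_op_supp (A B P : H -> H) (p : mpoly.mpoly 3 R[i]) s h : uniq s ->
  {subset mpoly.msupp p <= s} ->
  poly_op p A B P h = \sum_(m <- s) mpoly.mcoeff m p *: monom_op A B P m h.
Proof.
move=> us sub; rewrite [RHS](bigID (mem (mpoly.msupp p)))/= [X in _ = _ + X]big1 ?addr0.
  rewrite -big_filter; apply: perm_big; apply: uniq_perm.
  - exact: mpoly.msupp_uniq.
  - exact: filter_uniq.
  by move=> m; rewrite mem_filter; case: (boolP (m \in _)) => //= /sub ->.
by move=> m /mpoly.memN_msupp_eq0 ->; rewrite scale0r.
Qed.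

Lemma poly_opD (A B P : H -> H) (p q : mpoly.mpoly 3 R[i]) h :
  poly_op (p + q) A B P h = poly_op p A B P h + poly_op q A B P h.
Proof.
pose s := undup (mpoly.msupp p ++ mpoly.msupp q ++ mpoly.msupp (p + q)).
have us : uniq s by exact: undup_uniq.
rewrite !(@poly_op_supp A B P _ s)//; try by move=> m hm; rewrite mem_undup !mem_cat hm ?orbT.
by rewrite -big_split; apply: eq_bigr => m _; rewrite mpoly.mcoeffD scalerDl.
Qed.

Lemma poly_op_term (A B P : H -> H) t h :
  poly_op (term_poly t) A B P h = term_op A B P t h.
Proof.
set m := mpoly.Multinom [tuple t.2.1.1; t.2.1.2; t.2.2].
rewrite (@poly_op_supp A B P _ [:: m])//; last first.
  move=> k; rewrite -[k \in mpoly.msupp _]negbK -mpoly.mcoeff_eq0 mpoly.mcoeffZ mpoly.mcoeffX inE.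
  by rewrite -/m [k == m]eq_sym; case: (m == k) => //=; rewrite mulr0 eqxx.
by rewrite big_seq1 mpoly.mcoeffZ mpoly.mcoeffX eqxx mulr1.
Qed.

Lemma poly_eval_term t z : poly_eval (term_poly t) z = term_eval t z.
Proof.
rewrite /poly_eval mpoly.mevalZ mpoly.mevalX !big_ord_recl big_ord0 mulr1 /term_eval.
by rewrite mulrA.
Qed.

Lemma von_neumann_terms (A B P : bop H H) (s : seq term) (M : R) :
  tetrablock_contraction A B P ->
  (forall z, closure (tetrablock (R := R)) z -> cmod (\sum_(t <- s) term_eval t z) <= M) ->
  forall h, nrm (\sum_(t <- s) term_op A B P t h) <= M * nrm h.
Proof.
move=> [_ _ vN] hM h; pose p := \sum_(t <- s) term_poly t.
have opE x : poly_op p A B P x = \sum_(t <- s) term_op A B P t x.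
  rewrite /p; elim: s {hM p} => [|t s IH].
    by rewrite !big_nil /poly_op mpoly.msupp0 big_nil.
  by rewrite !big_cons poly_opD IH poly_op_term.
have evE z : poly_eval p z = \sum_(t <- s) term_eval t z.
  rewrite /p /poly_eval raddf_sum; apply: eq_bigr => t _; exact: poly_eval_term.
have bp : bounded_linear (poly_op p A B P).
  rewrite (_ : poly_op p A B P = fun x => \sum_(t <- s) term_op A B P t x); last exact/funext.
  elim: s {hM p opE evE} => [|t s IH].
    under [X in bounded_linear X]eq_fun do rewrite big_nil.
    exact: bounded_linear0.
  under [X in bounded_linear X]eq_fun do rewrite big_cons.
  apply: bounded_linearD => //; apply: bounded_linearZ.
  by do 2![apply: (bounded_linear_comp (bounded_linear_iter _ _))]; exact: bounded_linear_iter.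
rewrite -opE; apply: le_trans (nrm_opnorm bp h) _; rewrite ler_wpM2r ?nrm_ge0//.
apply: le_trans (vN p) _; apply: ge_sup.
  exists (complex.Re `|poly_eval p (0, 0, 0)|), (0, 0, 0) => //.
  exact/subset_closure/tetrablock0.
by move=> _ [z /hM h1 <-]; rewrite evE.
Qed.

End PolynomialCalculus.

Lemma unimodular_phase (R : realType) (s : R[i]) :
  exists2 w : R[i], cmod w = 1 & w * s = (cmod s)%:C%C.
Proof.
have [s0|sn] := eqVneq (cmod s) 0.
  by exists 1; rewrite ?cmod1// s0 mul1r; exact: cmod_eq0.
exists (s^* / (cmod s)%:C%C).
  rewrite -[_^-1](fmorphV (real_complex R)) cmodM cmod_conj.
  by rewrite [cmod _%:C%C]/cmod ger0_norm ?ler0c ?invr_ge0 ?cmod_ge0//= mulfV.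
rewrite mulrAC [s^* * s]mulrC -normCK cmodE expr2 -mulrA mulfV ?mulr1//.
by apply/eqP => /complexI; apply/eqP.
Qed.

Lemma nrm_le_sqnorm (R : realType) (E F : hilbertType R) (x : E) (y : F) :
  (nrm x <= nrm y) = (sqnorm x <= sqnorm y).
Proof. by rewrite -!nrm_sqr ler_pXn2r ?nnegrE ?nrm_ge0. Qed.

(** * Operator inequalities for a tetrablock contraction *)

Section ContractionInequalities.
Context (R : realType) (H : hilbertType R).

Lemma expr_small (x e : R) : 0 <= x < 1 -> 0 < e -> exists N, x ^+ N <= e.
Proof.
move=> /andP[x0 x1] e0.
have /cvgrPdist_le/(_ e e0)[N _ /(_ N (leqnn N))] : (fun n => x ^+ n) @ \oo --> (0 : R).
  by apply: cvg_expr; rewrite ger0_norm.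
by move=> h; exists N; move: h; rewrite sub0r normrN ger0_norm ?exprn_ge0.
Qed.

(* The sum is the N-th partial sum of the expansion of (a - wp) / (1 - wb). *)
Lemma geometric_disc (a b p w : R[i]) N : cmod b <= 1 -> cmod w < 1 ->
  cmod (a - w * p) <= cmod (1 - w * b) ->
  cmod (\sum_(k < N) (w ^+ k * (a * b ^+ k) - w ^+ k.+1 * (b ^+ k * p))) <= 1 + cmod w ^+ N.
Proof.
move=> b1 w1 h.
have wb : cmod (w * b) < 1.
  by rewrite cmodM; have := cmod_ge0 b; have := cmod_ge0 w; nra.
have nz : 0 < cmod (1 - w * b).
  by have := cmodD (1 - w * b) (w * b); rewrite subrK cmod1; lra.
set S := \sum_(k < N) _; have SE : S * (1 - w * b) = (a - w * p) * (1 - (w * b) ^+ N).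
  have -> : S = (a - w * p) * \sum_(k < N) (w * b) ^+ k.
    by rewrite mulr_sumr; apply: eq_bigr => k _; rewrite exprMn exprS; ring.
  rewrite -mulrA; congr (_ * _).
  by rewrite -[RHS]opprB subrX1 mulrC -[in LHS]opprB mulNr.
have := congr1 (@cmod R) SE; rewrite !cmodM => e.
rewrite -(ler_pM2r nz) e.
have : cmod (1 - (w * b) ^+ N) <= 1 + cmod w ^+ N.
  apply: le_trans (cmodB _ _) _; rewrite cmod1 lerD2l cmodX cmodM.
  by rewrite exprMn ler_piMr ?exprn_ge0 ?cmod_ge0// exprn_ile1 ?cmod_ge0.
have := cmod_ge0 (1 - (w * b) ^+ N); have := cmod_ge0 (a - w * p); nra.
Qed.

(* Apply the N-th partial sum to h - wBh: this gives (A - wP)(h - w^N B^N h). *)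
Lemma geometric_operator (A B P : bop H H) (w : R[i]) :
  (forall x, B (P x) = P (B x)) -> (forall x, nrm (B x) <= nrm x) -> cmod w < 1 ->
  (forall N x, nrm (\sum_(k < N) (w ^+ k *: A (iter k B x) - w ^+ k.+1 *: iter k B (P x))) <=
     (1 + cmod w ^+ N) * nrm x) ->
  forall h, nrm (A h - w *: P h) <= nrm (h - w *: B h).
Proof.
move=> BP B1 w1 hN h; set g := h - w *: B h.
have iterBP k x : iter k B (P x) = P (iter k B x).
  by elim: k => //= k ->; rewrite BP.
have iterB1 k x : nrm (iter k B x) <= nrm x.
  by elim: k => //= k IH; apply: le_trans (B1 _) IH.
have bAP : bounded_linear (fun x => A x - w *: P x).
  apply: bounded_linearD; first exact: bounded_linear_bop.
  exact/bounded_linearN/bounded_linearZ/bounded_linear_bop.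
have [L [LE L_bound]] : exists L : bop H H, (forall x, L x = A x - w *: P x) /\
    exists2 M, 0 <= M & forall x, nrm (L x) <= M * nrm x.
  by exists (bop_of bAP); split=> //; exact: nrm_bop_le.
have [M M0 hM] := L_bound.
have sumE N : \sum_(k < N) (w ^+ k *: A (iter k B g) - w ^+ k.+1 *: iter k B (P g)) =
    L h - w ^+ N *: L (iter N B h).
  elim: N => [|N IH]; first by rewrite big_ord0 expr0 scale1r subrr.
  rewrite big_ord_recr IH iterBP exprSr -scalerA -scalerBr -LE.
  have -> : iter N B g = iter N B h - w *: iter N.+1 B h.
    rewrite /g; elim: N {IH} => //= N ->; by rewrite bopB bopZ.
  rewrite bopB bopZ; apply: eq_dotl => z.
  by rewrite !(dotDl, dotNl, dotZl); ring.
rewrite -LE; apply/ler_addgt0Pr => e e0.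
have n1 : 0 < nrm g + M * nrm h + 1 by rewrite ltr_wpDl// addr_ge0 ?mulr_ge0 ?nrm_ge0.
have [|N] := @expr_small (cmod w) (e / (nrm g + M * nrm h + 1)) _ (divr_gt0 e0 n1).
  by rewrite cmod_ge0.
rewrite ler_pdivlMr// => small; have := hN N g; rewrite sumE => h1.
have := nrmD (L h - w ^+ N *: L (iter N B h)) (w ^+ N *: L (iter N B h)).
rewrite subrK nrmZ cmodX => h2.
have q0 : 0 <= cmod w ^+ N by rewrite exprn_ge0 ?cmod_ge0.
have h3 : cmod w ^+ N * nrm (L (iter N B h)) <= cmod w ^+ N * (M * nrm h).
  by rewrite ler_wpM2l// (le_trans (hM _))// ler_wpM2l.
nra.
Qed.

(** Replacing w by (1 - s) w brings it into the open disc at a cost of at most s (|P h| + |B h|),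
    which s is chosen to keep below e. *)
Lemma closed_disc_limit (A B P : bop H H) :
  (forall w h, cmod w < 1 -> nrm (A h - w *: P h) <= nrm (h - w *: B h)) ->
  forall w h, cmod w <= 1 -> nrm (A h - w *: P h) <= nrm (h - w *: B h).
Proof.
move=> hlt w h w1; apply/ler_addgt0Pr => e e0.
have c0 : 0 < nrm (P h) + nrm (B h) + 1 by rewrite ltr_wpDl// addr_ge0 ?nrm_ge0.
pose s := Num.min 1 (e / (nrm (P h) + nrm (B h) + 1)).
have s0 : 0 < s by rewrite lt_min ltr01 divr_gt0.
have s1 : s <= 1 by rewrite ge_min lexx.
have se : s * (nrm (P h) + nrm (B h) + 1) <= e.
  by rewrite -ler_pdivlMr// ge_min lexx orbT.
have cs : cmod (s%:C%C : R[i]) = s by rewrite /cmod ger0_norm ?ler0c ?ltW.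
have cs1 : cmod (1 - s%:C%C : R[i]) = 1 - s.
  by rewrite -[1 - _](rmorphB (real_complex R)) /cmod ger0_norm ?ler0c ?subr_ge0.
have w0 := cmod_ge0 w.
have h1 : nrm (A h - ((1 - s%:C%C) * w) *: P h) <= nrm (h - ((1 - s%:C%C) * w) *: B h).
  by apply: hlt; rewrite cmodM cs1; nra.
move: h1.
have := nrmD (A h - ((1 - s%:C%C) * w) *: P h) (- ((s%:C%C * w) *: P h)).
have -> : A h - ((1 - s%:C%C) * w) *: P h + - ((s%:C%C * w) *: P h) = A h - w *: P h.
  by apply: eq_dotl => z; rewrite !(dotDl, dotNl, dotZl); ring.
have := nrmD (h - w *: B h) ((s%:C%C * w) *: B h).
have -> : h - w *: B h + (s%:C%C * w) *: B h = h - ((1 - s%:C%C) * w) *: B h.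
  by apply: eq_dotl => z; rewrite !(dotDl, dotNl, dotZl); ring.
rewrite nrmN !nrmZ cmodM cs; have := nrm_ge0 (P h); have := nrm_ge0 (B h).
nra.
Qed.

Variables (A B P : bop H H).
Hypothesis tABP : tetrablock_contraction A B P.

Lemma tetrablock_contraction_le1 h : nrm (A h) <= nrm h /\ nrm (B h) <= nrm h.
Proof.
split.
  have := @von_neumann_terms _ _ A B P [:: (1, (1, 0, 0)%N)] 1 tABP _ h.
  rewrite big_seq1 /term_op /= scale1r mul1r; apply=> z /closure_tetrablock_le1[z1 _].
  by rewrite big_seq1 /term_eval /= mul1r expr1 !expr0 !mulr1.
have := @von_neumann_terms _ _ A B P [:: (1, (0, 1, 0)%N)] 1 tABP _ h.
rewrite big_seq1 /term_op /= scale1r mul1r; apply=> z /closure_tetrablock_le1[_ z1].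
by rewrite big_seq1 /term_eval /= mul1r expr1 !expr0 mulr1 mul1r.
Qed.

Lemma tetrablock_contraction_disc w h : cmod w <= 1 ->
  nrm (A h - w *: P h) <= nrm (h - w *: B h) /\
  nrm (B h - w *: P h) <= nrm (h - w *: A h).
Proof.
have [[AB AP BP] _ _] := tABP.
move=> w1; split; move: w h w1; apply: closed_disc_limit => w h w1.
- apply: geometric_operator => // [x|N x].
    by case: (tetrablock_contraction_le1 x).
  pose s : seq (term R) := [seq (w ^+ k, (1, k, 0)%N) | k <- index_iota 0 N] ++
    [seq (- w ^+ k.+1, (0, k, 1)%N) | k <- index_iota 0 N].
  have := @von_neumann_terms _ _ A B P s (1 + cmod w ^+ N) tABP _ x.
  rewrite big_cat /= !big_map !big_mkord -big_split /=.
  under eq_bigr do rewrite /term_op /= scaleNr.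
  apply=> z cz; have [z1 _] := closure_tetrablock_disc cz (ltW w1).
  rewrite big_cat /= !big_map !big_mkord -big_split /=.
  under eq_bigr do rewrite /term_eval /= !expr0 !expr1 mulr1 mul1r mulNr.
  by apply: geometric_disc => //; case: (closure_tetrablock_le1 cz).
- apply: geometric_operator => // [x|N x].
    by case: (tetrablock_contraction_le1 x).
  pose s : seq (term R) := [seq (w ^+ k, (k, 1, 0)%N) | k <- index_iota 0 N] ++
    [seq (- w ^+ k.+1, (k, 0, 1)%N) | k <- index_iota 0 N].
  (* [term_op] applies A after B, so the factors are reordered to match [geometric_operator] with A
     and B exchanged. *)
  have iterAB k y : iter k A (B y) = B (iter k A y) by elim: k => //= k ->; rewrite AB.
  have := @von_neumann_terms _ _ A B P s (1 + cmod w ^+ N) tABP _ x.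
  rewrite big_cat /= !big_map !big_mkord -big_split /=.
  under eq_bigr do rewrite /term_op /= scaleNr iterAB.
  apply=> z cz; have [_ z1] := closure_tetrablock_disc cz (ltW w1).
  rewrite big_cat /= !big_map !big_mkord -big_split /=.
  under eq_bigr do rewrite /term_eval /= !expr0 !expr1 !mulr1 mulNr [_ * (z.1.2 : R[i])]mulrC.
  by apply: geometric_disc => //; case: (closure_tetrablock_le1 cz).
Qed.

(** Averaging the squared disc inequalities over w = 1 and w = -1 removes the cross terms; adding
    the two averages cancels |A h|^2 and |B h|^2. *)
Lemma tetrablock_contraction_nrmP h : nrm (P h) <= nrm h.
Proof.
have h1 w := @tetrablock_contraction_disc w h; have w1 : cmod (1 : R[i]) <= 1 by rewrite cmod1.
have w2 : cmod (-1 : R[i]) <= 1 by rewrite cmodN cmod1.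
have [] := h1 _ w1; have [] := h1 _ w2.
rewrite !scale1r !scaleN1r !opprK.
rewrite !nrm_le_sqnorm !sqnormB !sqnormD.
lra.
Qed.

(** Each squared disc inequality bounds twice one of the real parts by |h|^2 - |P h|^2 plus or minus
    (|A h|^2 - |B h|^2), with opposite signs for the two. The right side is |D_P h|^2. *)
Lemma tetrablock_contraction_Re w1 w2 h : cmod w1 = 1 -> cmod w2 = 1 ->
  complex.Re (w1 * dot (A h - adj B (P h)) h) + complex.Re (w2 * dot (B h - adj A (P h)) h)
    <= sqnorm h - sqnorm (P h).
Proof.
have key (S T : bop H H) w : cmod w = 1 -> nrm (S h - w *: P h) <= nrm (h - w *: T h) ->
    2 * complex.Re (w * dot (T h - adj S (P h)) h) <=
    sqnorm h + sqnorm (T h) - sqnorm (S h) - sqnorm (P h).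
  move=> ew; rewrite nrm_le_sqnorm !sqnormB.
  have sqw x : sqnorm (w *: x) = sqnorm x by rewrite -!nrm_sqr nrmZ ew mul1r.
  rewrite !sqw dotBl adjPl mulrBr ReD ReN.
  have -> : complex.Re (dot (S h) (w *: P h)) = complex.Re (w * dot (P h) (S h)).
    by rewrite dotC complexRe_conj dotZl.
  have -> : complex.Re (dot h (w *: T h)) = complex.Re (w * dot (T h) h).
    by rewrite dotC complexRe_conj dotZl.
  lra.
move=> e1 e2; have [|_ h1] := @tetrablock_contraction_disc w1 h; first by rewrite e1.
have [|h2 _] := @tetrablock_contraction_disc w2 h; first by rewrite e2.
have := key B A w1 e1 h1; have := key A B w2 e2 h2; lra.
Qed.

End ContractionInequalities.

(** * Numerical radius of the fundamental operators *)

Section NumericalRadius.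
Context (R : realType) (E : hilbertType R).

Lemma numerical_radius_below (M : bop E E) (z : R[i]) :
  (forall u, cmod (dot (M u) u) <= sqnorm u) -> 1 < cmod z ->
  forall u, (cmod z - 1) * nrm u <= nrm (M u - z *: u).
Proof.
move=> hM z1 u; have [->|un] := eqVneq (nrm u) 0; first by rewrite mulr0 nrm_ge0.
have u0 : 0 < nrm u by rewrite lt0r un nrm_ge0.
rewrite -(ler_pM2r u0) -mulrA -expr2 nrm_sqr.
apply: le_trans (cmod_dot _ _); rewrite dotBl dotZl.
have := cmodB (dot (M u) u) (dot (M u) u - z * dot u u); rewrite subKr cmodM.
rewrite dot_sqnorm {2}/cmod ger0_norm ?ler0c ?sqnorm_ge0//=.
by have := hM u; lra.
Qed.

Lemma contraction_below (B : bop E E) (z : R[i]) : (forall u, nrm (B u) <= nrm u) ->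
  1 < cmod z -> forall u, (cmod z - 1) * nrm u <= nrm (B u - z *: u).
Proof.
move=> B1; apply: numerical_radius_below => u; apply: le_trans (cmod_dot _ _) _.
by rewrite -nrm_sqr expr2 ler_wpM2r ?nrm_ge0.
Qed.

Lemma Re_quadratic_dense (H : hilbertType R) (d : bop H E) (T : bop E E) :
  (forall (y : E) (e : R), 0 < e -> exists x, nrm (y - d x) <= e) ->
  (forall h, 0 <= complex.Re (dot (T (d h)) (d h))) ->
  forall u, 0 <= complex.Re (dot (T u) u).
Proof.
move=> dens hT u; have [M M0 hM] := nrm_bop_le T.
suff h (e : R) : 0 < e -> e <= 1 -> - (e * (M * (2 * nrm u + 1))) <= complex.Re (dot (T u) u).
  rewrite leNgt; apply/negP => neg; set r := complex.Re _ in neg h.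
  have u0 := nrm_ge0 u; set c := M * (2 * nrm u + 1) in h.
  have c0 : 0 <= c by rewrite mulr_ge0// addr_ge0// mulr_ge0.
  have c1 : 0 < c + 1 by lra.
  have m0 : 0 < Num.min 1 (- r / 2 / (c + 1)).
    by rewrite lt_min ltr01 !divr_gt0// oppr_gt0.
  have := h _ m0; rewrite ge_min lexx => /(_ isT).
  have : Num.min 1 (- r / 2 / (c + 1)) * (c + 1) <= - r / 2.
    by rewrite -ler_pdivlMr// ge_min lexx orbT.
  nra.
move=> e0 e1; have [x hx] := dens u e e0; set v := d x in hx.
have vv : 0 <= complex.Re (dot (T v) v) by exact: hT.
have -> : dot (T u) u = dot (T v) v - - dot (T (u - v)) u - - dot (T v) (u - v).
  by rewrite bopB !(dotBl, dotBr); ring.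
rewrite !ReD ReN.
have r1 : complex.Re (- dot (T (u - v)) u) <= nrm (T (u - v)) * nrm u.
  by rewrite -dotNl; apply: le_trans (Re_dot_le _ _) _; rewrite nrmN.
have r2 : complex.Re (- dot (T v) (u - v)) <= nrm (T v) * nrm (u - v).
  by rewrite -dotNl; apply: le_trans (Re_dot_le _ _) _; rewrite nrmN.
have v1 : nrm v <= nrm u + e.
  by rewrite -[v](subKr u); apply: le_trans (nrmB _ _) _; rewrite lerD2l.
have a1 : nrm (T (u - v)) * nrm u <= M * e * nrm u.
  by rewrite ler_wpM2r ?nrm_ge0// (le_trans (hM _))// ler_wpM2l.
have a2 : nrm (T v) * nrm (u - v) <= M * (nrm u + e) * e.
  apply: ler_pM; rewrite ?nrm_ge0//; apply: le_trans (hM _) _; exact: ler_wpM2l.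
have : 0 <= e * M * (1 - e) by rewrite mulr_ge0 ?subr_ge0// mulr_ge0// ltW.
rewrite !ReN in r1 r2 *; lra.
Qed.

End NumericalRadius.

Section FundamentalNumericalRadius.
Context (R : realType) (H E : hilbertType R) (A B P : bop H H) (d : bop H E)
  (F1 F2 : bop E E).
Hypothesis tABP : tetrablock_contraction A B P.
Hypothesis fF : fundamental A B P d F1 F2.
Hypothesis dens : forall (y : E) (e : R), 0 < e -> exists x, nrm (y - d x) <= e.

(** At u = d x this is [tetrablock_contraction_Re], because dot (F1 (d x)) (d x) is the form of A -
    B^* P at x, and likewise for F2; density of the range of [d] does the rest. *)
Lemma fund_Re_le w1 w2 u : cmod w1 = 1 -> cmod w2 = 1 ->
  complex.Re (w1 * dot (F1 u) u) + complex.Re (w2 * dot (F2 u) u) <= sqnorm u.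
Proof.
move=> e1 e2.
have bT : bounded_linear (fun u => u + (- (w1 *: F1 u) - w2 *: F2 u)).
  apply: bounded_linearD; first exact: bounded_linear_id.
  by apply: bounded_linearD; apply/bounded_linearN/bounded_linearZ/bounded_linear_bop.
have := @Re_quadratic_dense _ _ _ d (bop_of bT) dens _ u.
rewrite /= !dotDl !dotNl !dotZl !ReD !ReN -/(sqnorm u) => h.
suff : 0 <= sqnorm u + (- complex.Re (w1 * dot (F1 u) u) - complex.Re (w2 * dot (F2 u) u)) by lra.
apply: h => x; rewrite !dotDl !dotNl !dotZl !ReD !ReN -/(sqnorm _).
rewrite -!adjPl (fund_F1 fF) (fund_F2 fF).
have -> : sqnorm (d x) = sqnorm x - sqnorm (P x).
  by rewrite /sqnorm -adjPl (fund_dd fF) dotBl adjPl ReD ReN.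
have := tetrablock_contraction_Re tABP x e1 e2; lra.
Qed.

Lemma fund_numerical_radius (z : R[i]) u : cmod z = 1 ->
  cmod (dot (F2 u + z *: adj F1 u) u) <= sqnorm u.
Proof.
move=> z1; set s := dot _ _.
have [w w1 ws] := unimodular_phase s.
have -> : cmod s = complex.Re (w * s) by rewrite ws.
(* F1 and F1^* have conjugate quadratic forms, so the phase w z on F1^* becomes its conjugate on
   F1. *)
have := @fund_Re_le ((w * z)^*) w u.
rewrite cmod_conj cmodM w1 z1 mulr1 => /(_ erefl erefl).
rewrite /s dotDl dotZl adjPl mulrDr ReD mulrA [dot u (F1 u)]dotC.
by rewrite -[complex.Re (w * z * _)]complexRe_conj !rmorphM/= conjCK addrC.
Qed.

End FundamentalNumericalRadius.

(** * The distinguished boundary *)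

Lemma differentiable_fst (K : numFieldType) (U V : normedModType K) (z : U * V) :
  differentiable (fst : U * V -> U) z.
Proof. by apply: linear_differentiable => x; exact: cvg_fst. Qed.

Lemma differentiable_snd (K : numFieldType) (U V : normedModType K) (z : U * V) :
  differentiable (snd : U * V -> V) z.
Proof. by apply: linear_differentiable => x; exact: cvg_snd. Qed.

Section DistinguishedBoundary.
Context (R : realType).
Implicit Types z : triC R.

Lemma cmod_sqrC (x : R[i]) : (cmod x ^+ 2)%:C%C = x * x^*.
Proof. by rewrite rmorphXn/= -cmodE normCK. Qed.

Lemma cmodB_sqr (x y : R[i]) :
  cmod (x - y) ^+ 2 = cmod x ^+ 2 + cmod y ^+ 2 - 2 * complex.Re (x^* * y).
Proof. by rewrite !cmod_sqr; case: x y => [a b] [c e] /=; ring. Qed.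

Lemma cmodr (t : R) : 0 <= t -> cmod (t%:C%C : R[i]) = t.
Proof. by move=> t0; rewrite /cmod ger0_norm ?ler0c. Qed.

(** The best phase w in a disc inequality gives 2 |b - conj a p| <= 1 + |b|^2 - |a|^2 - |p|^2; this
    is added to its mirror image in a and b. In particular |p| = 1 forces a = conj b p. *)
Lemma closure_tetrablock_defect z : closure (tetrablock (R := R)) z ->
  cmod ((z.1.1 : R[i]) - (z.1.2 : R[i])^* * z.2) <= 1 - cmod z.2 ^+ 2.
Proof.
case: z => [[a b] p] cz /=; move: (a : R[i]) (b : R[i]) (p : R[i]) cz => {}a {}b {}p cz.
have key (x y : R[i]) : (forall w, cmod w = 1 -> cmod (x - w * p) <= cmod (1 - w * y)) ->
    2 * cmod (y - x^* * p) <= 1 + cmod y ^+ 2 - cmod x ^+ 2 - cmod p ^+ 2.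
  move=> h; have [w w1 ws] := unimodular_phase (y - x^* * p).
  have := h w w1; rewrite -ler_sqr ?nnegrE ?cmod_ge0//.
  have -> : cmod (x - w * p) ^+ 2 =
      cmod x ^+ 2 + cmod p ^+ 2 - 2 * complex.Re (w * (x^* * p)).
    by rewrite cmodB_sqr cmodM w1 mul1r mulrCA.
  have -> : cmod (1 - w * y) ^+ 2 = 1 + cmod y ^+ 2 - 2 * complex.Re (w * y).
    by rewrite cmodB_sqr cmodM w1 mul1r cmod1 expr1n rmorph1 mul1r.
  have := congr1 (@complex.Re R) ws; rewrite mulrBr ReD ReN /=; lra.
have hw w : cmod w = 1 -> cmod (a - w * p) <= cmod (1 - w * b) /\
    cmod (b - w * p) <= cmod (1 - w * a).
  by move=> w1; apply: (closure_tetrablock_disc cz); rewrite w1.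
have := key a b (fun w w1 => (hw w w1).1); have := key b a (fun w w1 => (hw w w1).2).
have := cmod_ge0 (b - a^* * p); lra.
Qed.

(** * Peak points of the closed tetrablock *)

Section Peak.
Variables (b0 p0 : R[i]).
Hypotheses (b0_le1 : cmod b0 <= 1) (p0_1 : cmod p0 = 1).

Let w0 : triC R := (b0^* * p0, b0, p0).

(** The point comes from the unitary matrix with rows (conj b0 p0, - s p0) and (s, b0), where s^2 =
    1 - |b0|^2; its determinant is p0. A factor r < 1 moves it into the open domain. *)
Lemma boundary_closure : closure (tetrablock (R := R)) w0.
Proof.
pose s : R := Num.sqrt (1 - cmod b0 ^+ 2).
have s2 : s ^+ 2 = 1 - cmod b0 ^+ 2.
  by rewrite sqr_sqrtr// subr_ge0 -(expr1n _ 2) ler_sqr ?nnegrE ?cmod_ge0.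
have pp : p0 * p0^* = 1 by rewrite -cmod_sqrC p0_1 expr1n.
have bb : b0 * b0^* = 1 - s%:C%C ^+ 2.
  by rewrite -cmod_sqrC -rmorphXn/= s2 rmorphB/= subKr.
pose M (r : R) : 'M[R[i]]_2 := \matrix_(i, j)
  (r%:C%C * (if i == 0 then if j == 0 then b0^* * p0 else - s%:C%C * p0
             else if j == 0 then s%:C%C else b0)).
have M_iso r v : 0 <= r -> euclid_norm (M r *m v) <= r * euclid_norm v.
  move=> r0; rewrite -ler_sqr ?nnegrE ?mulr_ge0 ?sqrtr_ge0// exprMn !euclid_norm_sqr.
  rewrite !big_ord_recl !big_ord0 !addr0 !mxE !big_ord_recl !big_ord0 !mxE/= !addr0.
  set x := v 0 0; set y := v _ 0.
  rewrite -lecR rmorphM !rmorphD/= !cmod_sqrC.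
  rewrite !(rmorphD, rmorphM, rmorphN)/= !conj_real !conjCK.
  rewrite [leLHS](_ : _ = r%:C%C * r%:C%C * ((p0 * p0^*) *
    (b0 * b0^* * (x * x^*) - s%:C%C * b0^* * (x * y^*) - s%:C%C * b0 * (y * x^*) +
     s%:C%C ^+ 2 * (y * y^*)) + (s%:C%C ^+ 2 * (x * x^*) + s%:C%C * b0^* * (x * y^*) +
     s%:C%C * b0 * (y * x^*) + b0 * b0^* * (y * y^*)))); last by ring.
  rewrite pp mul1r [leLHS](_ : _ = r%:C%C * r%:C%C * ((b0 * b0^* + s%:C%C ^+ 2) *
    (x * x^* + y * y^*))); last by ring.
  by rewrite bb subrK mul1r.
have M_block r : 0 <= r < 1 ->
    tetrablock ((r%:C%C * (b0^* * p0), r%:C%C * b0, r%:C%C ^+ 2 * p0) : triC R).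
  move=> /andP[r0 r1]; exists (M r).
    apply: le_lt_trans r1; apply: ge_sup; first by exists (euclid_norm (M r *m 0)), 0 => //=;
      rewrite /euclid_norm big1 ?sqrtr0// => i _; rewrite mxE normr0 expr0n.
    move=> _ [v /= v1 <-]; apply: le_trans (M_iso r v r0) _.
    by rewrite ler_piMr.
  rewrite det_mx22 !mxE/=; congr (_, _, _).
  have -> : r%:C%C * (b0^* * p0) * (r%:C%C * b0) - r%:C%C * (- s%:C%C * p0) * (r%:C%C * s%:C%C) =
    r%:C%C ^+ 2 * p0 * (b0 * b0^* + s%:C%C ^+ 2) :> R[i] by ring.
  by rewrite bb subrK mulr1.
move=> B /nbhs_ballP[e' /pos_complex[e e0 ->] eB].
(* The third coordinate is scaled by (1 - dl)^2 and so moves by dl (2 - dl) <= e / 2, the largest of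
   the three displacements allowed. *)
pose dl := Num.min (1 / 2) (e / 4).
have dl0 : 0 < dl by rewrite lt_min !divr_gt0.
have [dl1 dl2] : dl <= 1 / 2 /\ dl <= e / 4 by rewrite !ge_min !lexx orbT.
have Tr := M_block (1 - dl).
exists ((1 - dl)%:C%C * (b0^* * p0), (1 - dl)%:C%C * b0, (1 - dl)%:C%C ^+ 2 * p0).
split; first by apply: Tr; lra.
apply: eB; split; first split; apply/cmod_ball.
- rewrite [X in cmod X](_ : _ = dl%:C%C * (b0^* * p0)); last by rewrite rmorphB/=; ring.
  rewrite cmodM cmodr ?(ltW dl0)// cmodM cmod_conj p0_1 mulr1.
  by have := cmod_ge0 b0; nra.
- rewrite [X in cmod X](_ : _ = dl%:C%C * b0); last by rewrite rmorphB/=; ring.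
  by rewrite cmodM cmodr ?(ltW dl0)//; have := cmod_ge0 b0; nra.
- rewrite [X in cmod X](_ : _ = dl%:C%C * (2 - dl)%:C%C * p0); last first.
    by rewrite !rmorphB/= (rmorph_nat (real_complex R) 2); ring.
  rewrite !cmodM p0_1 mulr1 !cmodr ?(ltW dl0)//; last by lra.
  by nra.
Qed.

(* On the set of all (conj b, b, 1) the product (b - b0) (a - conj b0) is
   |b - b0|^2, so it separates the points where 1 + p has modulus 2. *)
Definition peak (z : triC R) : R[i]^o :=
  (1 : R[i]^o) + p0^* *: z.2 - (20^-1)%:C%C *: ((z.1.2 - b0) * (p0^* *: z.1.1 - b0^*)).

Lemma peak_differentiable z : differentiable peak z.
Proof.
have d1 : differentiable (fun z : triC R => z.1.1) z.
  by apply: (@differentiable_comp _ _ _ _ fst fst); exact: differentiable_fst.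
have d2 : differentiable (fun z : triC R => z.1.2) z.
  apply: (@differentiable_comp _ _ _ _ fst snd); first exact: differentiable_fst.
  exact: differentiable_snd.
have d3 : differentiable (fun z : triC R => z.2) z by exact: differentiable_snd.
apply: differentiableB.
  by apply: differentiableD; [exact: differentiable_cst|exact: differentiableZ].
apply: differentiableZ; apply: differentiableM.
  apply: differentiableB => //; exact: differentiable_cst.
by apply: differentiableB; [exact: differentiableZ|exact: differentiable_cst].
Qed.

(** Here be = |b - b0|, t = |p|, m = |1 + p'| and u = |1 - p'| for p' = conj p0 p, the equation
    being the parallelogram law. All errors are absorbed by s and the deficit de = 2 - m: the
    constant 20 is large enough for [h1], [h2], [h3] to leave 2 <= 2 - de / 2 - s / 2. *)
Lemma peak_estimate (be m t u : R) : 0 <= be <= 2 -> 0 <= m <= 2 -> 0 <= u ->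
  0 <= t <= 1 -> m ^+ 2 + u ^+ 2 = 2 + 2 * t ^+ 2 ->
  2 <= (1 - be ^+ 2 / 20) * m + be ^+ 2 / 20 + be * (1 - t ^+ 2) / 20 + be * u / 20 ->
  be = 0 /\ m = 2.
Proof.
move=> /andP[be0 be2] /andP[m0 m2] u0 /andP[t0 t1] e h.
set s := be ^+ 2 / 20 in h; pose de := 2 - m.
have hu : u ^+ 2 <= 4 * de by rewrite /de; nra.
have hg : 1 - t ^+ 2 <= 2 * de by rewrite /de; nra.
have h1 : be * u / 20 <= s / 2 + de / 10.
  have := sqr_ge0 (be - u); rewrite /s; lra.
have h2 : be * (1 - t ^+ 2) / 20 <= de / 5.
  have : be * (1 - t ^+ 2) <= be * (2 * de) by rewrite ler_wpM2l.
  have : be * (2 * de) <= 2 * (2 * de) by rewrite ler_wpM2r// /de; lra.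
  lra.
have h3 : s * de <= de / 5.
  rewrite mulrC ler_wpM2l /de ?subr_ge0// /s.
  have : be ^+ 2 <= 2 ^+ 2 by rewrite ler_sqr ?nnegrE.
  lra.
have hm : (1 - s) * m = 2 - de - 2 * s + s * de by rewrite /de; ring.
have s0 : 0 <= s by rewrite divr_ge0// sqr_ge0.
have de0 : 0 <= de by rewrite /de; lra.
have sz : s = 0 by lra.
have dz : de = 0 by lra.
split; last by move: dz; rewrite /de; lra.
by move/eqP: sz; rewrite mulf_eq0 sqrf_eq0 invr_eq0 pnatr_eq0 orbF => /eqP.
Qed.

Lemma peak_unique z : closure (tetrablock (R := R)) z -> 2 <= cmod (peak z) -> z = w0.
Proof.
move=> cz; have g_le := closure_tetrablock_defect cz; have [_ b_le1] := closure_tetrablock_le1 cz.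
case: z cz g_le b_le1 => [[a b] p] cz /=.
rewrite /peak /w0 /=; move: (a : R[i]) (b : R[i]) (p : R[i]) cz => {}a {}b {}p cz g_le b_le1.
pose p' := p0^* * p; pose g := p0^* * (a - b^* * p); pose be := b - b0.
have pp : p0 * p0^* = 1 by rewrite -cmod_sqrC p0_1 expr1n.
have cp' : cmod p' = cmod p by rewrite cmodM cmod_conj p0_1 mul1r.
have cg : cmod g <= 1 - cmod p ^+ 2 by rewrite cmodM cmod_conj p0_1 mul1r.
set s := cmod be ^+ 2 / 20.
(* Since conj p0 a = g + conj b p', the product equals be g + |be|^2 p' - be conj b0 (1 - p'). The
   terms in g and in 1 - p' are the errors, controlled by 1 - |p|^2 and |1 - p'|. *)
have -> : 1 + p0^* *: p - (20^-1)%:C%C *: ((b - b0) * (p0^* *: a - b0^*)) =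
    (1 - s)%:C%C * (1 + p') + s%:C%C - (20^-1)%:C%C * (be * g)
    + (20^-1)%:C%C * (be * b0^* * (1 - p')) :> R[i].
  have sE : s%:C%C = be * be^* * (20^-1)%:C%C by rewrite /s rmorphM/= cmod_sqrC.
  rewrite rmorphB rmorph1 /= !sE /p' /g /be rmorphB /=.
  rewrite -[p0^* *: p]/(p0^* * p) -[p0^* *: a]/(p0^* * a).
  rewrite -[_ *: ((b - b0) * _)]/((20^-1)%:C%C * ((b - b0) * (p0^* * a - b0^*))); ring.
move=> h2.
have p_le1 : cmod p <= 1.
  by rewrite -(@expr_le1 _ 2) ?cmod_ge0//; have := cmod_ge0 g; lra.
have be2 : cmod be <= 2 by apply: le_trans (cmodB _ _) _; rewrite [leRHS](natrD _ 1 1) lerD.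
have m2 : cmod (1 + p') <= 1 + cmod p by have := cmodD 1 p'; rewrite cmod1 cp'.
have mu : cmod (1 + p') ^+ 2 + cmod (1 - p') ^+ 2 = 2 + 2 * cmod p ^+ 2.
  by rewrite -cp' !cmod_sqr; case: (p') => x y /=; ring.
have s01 : 0 <= s <= 1.
  have : cmod be ^+ 2 <= 4 by have := cmod_ge0 be; nra.
  by rewrite /s; have := sqr_ge0 (cmod be); move=> ? ?; apply/andP; split; lra.
have bound : 2 <= (1 - s) * cmod (1 + p') + s + cmod be * (1 - cmod p ^+ 2) / 20 +
    cmod be * cmod (1 - p') / 20.
  apply: le_trans h2 _.
  set z1 := _ * (1 + p'); set z2 := s%:C%C; set z3 := _ * (be * g); set z4 := _ * (_ * (1 - p')).
  have := cmodD (z1 + z2 - z3) z4; have := cmodB (z1 + z2) z3; have := cmodD z1 z2.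
  have i20 : cmod ((20^-1)%:C%C : R[i]) = 20^-1 by rewrite cmodr// invr_ge0.
  have -> : cmod z1 = (1 - s) * cmod (1 + p').
    by rewrite cmodM cmodr// subr_ge0; case/andP: s01.
  have -> : cmod z2 = s by rewrite cmodr//; case/andP: s01.
  have : cmod z3 <= 20^-1 * (cmod be * (1 - cmod p ^+ 2)).
    by rewrite 2!cmodM i20 ler_pM2l ?invr_gt0// ler_wpM2l ?cmod_ge0.
  have : cmod z4 <= 20^-1 * (cmod be * cmod (1 - p')).
    rewrite /z4 3!cmodM i20 cmod_conj ler_pM2l ?invr_gt0// -mulrA.
    by rewrite ler_wpM2l ?cmod_ge0// ler_piMl ?cmod_ge0.
  lra.
have [||||be0 m_eq] := @peak_estimate (cmod be) (cmod (1 + p')) (cmod p) (cmod (1 - p'))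
   _ _ (cmod_ge0 _) _ mu _.
- by rewrite cmod_ge0.
- by rewrite cmod_ge0 (le_trans m2)//; lra.
- by rewrite cmod_ge0.
- exact: bound.
have p1 : cmod p = 1 by lra.
have u0 : cmod (1 - p') = 0.
  by apply/eqP; rewrite -sqrf_eq0; apply/eqP; move: mu; rewrite m_eq p1; lra.
have pE : p = p0.
  rewrite -[p]mul1r -pp -mulrA -/p'.
  by rewrite -(subr0_eq (cmod_eq0 u0)) mulr1.
have bE : b = b0 by apply/subr0_eq/cmod_eq0.
have aE : a = b^* * p.
  apply/subr0_eq/cmod_eq0/eqP; rewrite eq_le cmod_ge0 andbT.
  by apply: le_trans g_le _; rewrite p1 expr1n subrr.
by rewrite aE bE pE.
Qed.

(** Every closed boundary contains a point where |peak| is at least its value 2 at [w0], and [w0] is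
    the only such point of the closure; so it lies in the intersection of all of them. *)
Lemma distinguished_boundary_mem : distinguished_boundary (R := R) w0.
Proof.
move=> B [[clB subB peakB] _].
have [||w Bw hw] := peakB peak.
- apply: continuous_subspaceT => z; exact/differentiable_continuous/peak_differentiable.
- by move=> z _; exact: peak_differentiable.
have <- // : w = w0.
apply: peak_unique; first exact: subB.
have := hw _ boundary_closure; rewrite !cmodE lecR; apply: le_trans.
rewrite /peak /w0 /= subrr mul0r scaler0 subr0.
have -> : p0^* *: p0 = 1 :> R[i] by rewrite [LHS]mulrC -cmod_sqrC p0_1 expr1n.
by rewrite -(natrD _ 1 1) -(rmorph_nat (real_complex R)) cmodr.
Qed.

End Peak.
End DistinguishedBoundary.

(** * The dilation *)

Section DirectSumNorm.
Context (R : realType) (X Y : hilbertType R).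

Lemma nrm_fst_le (x : hsum X Y) : nrm x.1 <= nrm x.
Proof. by rewrite nrm_le_sqnorm sqnorm_hsum lerDl sqnorm_ge0. Qed.

Lemma nrm_snd_le (x : hsum X Y) : nrm x.2 <= nrm x.
Proof. by rewrite nrm_le_sqnorm sqnorm_hsum lerDr sqnorm_ge0. Qed.

Lemma nrm_hpair_le (x : X) (y : Y) : nrm (hpair x y) <= nrm x + nrm y.
Proof.
rewrite -ler_sqr ?nnegrE ?addr_ge0 ?nrm_ge0// nrm_sqr sqnorm_hsum /= -!nrm_sqr.
by have := nrm_ge0 x; have := nrm_ge0 y; nra.
Qed.

Lemma nrm_hpair0 (x : X) : nrm (hpair x (0 : Y)) = nrm x.
Proof. by apply/eqP; rewrite eq_le !nrm_le_sqnorm sqnorm_hsum /= sqnorm0 addr0 lexx. Qed.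

Lemma nrm_0hpair (y : Y) : nrm (hpair (0 : X) y) = nrm y.
Proof. by apply/eqP; rewrite eq_le !nrm_le_sqnorm sqnorm_hsum /= sqnorm0 add0r lexx. Qed.

End DirectSumNorm.

Section UnitaryDilation.
Context (R : realType) (H E E' : hilbertType R) (A B P : bop H H)
  (d : bop H E) (d' : bop H E') (Q : bop E' E) (F1 F2 : bop E E) (G1 G2 : bop E' E').
Local Notation Ht := (hsum H (l2 E)).
Local Notation K := (hsum Ht (l2 E')).
Hypothesis tABP : tetrablock_contraction A B P.
Hypothesis J : julia P d d' Q.
Hypothesis fF : fundamental A B P d F1 F2.
Hypothesis fG : fundamental (adj A) (adj B) (adj P) d' G1 G2.
Hypothesis dens : forall (y : E) (e : R), 0 < e -> exists x, nrm (y - d x) <= e.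
Hypothesis commF : forall x, F1 (F2 x) = F2 (F1 x).
Hypothesis commF_adj : forall x,
  F1 (adj F1 x) - adj F1 (F1 x) = F2 (adj F2 x) - adj F2 (F2 x).
Variables R1 R2 U : bop K K.
Hypothesis R1E : forall x, R1 x = ext_op d d' Q A F1 F2 G1 G2 x.
Hypothesis R2E : forall x, R2 x = ext_op d d' Q B F2 F1 G2 G1 x.
Hypothesis UE : forall x, U x = ext_unitary P d d' Q x.

Let base : set K := [set x | x.2 = 0].

Let baseP x : base x -> exists h b, x = hpair (hpair h b) 0.
Proof. by case: x => [[h b] a]; rewrite /base /= => ->; exists h, b. Qed.

Lemma ext_U_dot x y : dot (U x) (U y) = dot x y.
Proof. by rewrite !UE (dot_ext_unitary J). Qed.

Lemma ext_U_nrm x : nrm (U x) = nrm x.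
Proof. by apply/eqP; rewrite eq_le !nrm_le_sqnorm /sqnorm ext_U_dot lexx. Qed.

Lemma ext_U_iso x : adj U (U x) = x.
Proof. by apply: eq_dotr => y; rewrite -adjP ext_U_dot. Qed.

Lemma ext_U_coiso x : U (adj U x) = x.
Proof. by rewrite -{1}(ext_unitaryK J x) -UE ext_U_iso UE (ext_unitaryK J). Qed.

Lemma ext_R1U x : R1 (U x) = U (R1 x).
Proof. by rewrite !R1E !UE (ext_op_comm J fF fG). Qed.

Lemma ext_R2U x : R2 (U x) = U (R2 x).
Proof.
by rewrite !R2E !UE (ext_op_comm J (fundamental_swap fF) (fundamental_swap fG)).
Qed.

Lemma ext_base_absorbing k (e : R) : 0 < e ->
  exists n x r, [/\ iter n U k = x + r, base x & nrm r <= e].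
Proof.
move=> e0; have [n hn] := l2_tail_small k.2 e0.
have tailE m : (iter m U k).2 = iter m (@l2_tail R E') k.2.
  by elim: m => //= m <-; rewrite UE.
exists n, (hpair (iter n U k).1 0), (hpair 0 (iter n U k).2); split=> //.
  by apply: injective_projections; rewrite /= ?addr0 ?add0r.
by rewrite nrm_0hpair tailE.
Qed.

Lemma ext_R12 x : R1 (R2 x) = R2 (R1 x).
Proof.
have b12 : bounded_linear (fun x => R1 (R2 x)).
  exact: bounded_linear_comp (bounded_linear_bop _) (bounded_linear_bop _).
have b21 : bounded_linear (fun x => R2 (R1 x)).
  exact: bounded_linear_comp (bounded_linear_bop _) (bounded_linear_bop _).
apply: (@isometry_transfer_eq _ _ U base ext_U_nrm ext_base_absorbing (bop_of b12) (bop_of b21)).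
- by move=> y /=; rewrite ext_R2U ext_R1U.
- by move=> y /=; rewrite ext_R1U ext_R2U.
move=> _ /baseP[h [b ->]] /=; rewrite !R1E !R2E.
exact: (ext_op_ext_opl d' Q G1 G2 fF commF commF_adj).
Qed.

Lemma ext_R1E x : R1 x = adj R2 (U x).
Proof.
have b2U : bounded_linear (fun x => adj R2 (U x)).
  exact: bounded_linear_comp (bounded_linear_bop _) (bounded_linear_bop _).
apply: (@isometry_transfer_eq _ _ U base ext_U_nrm ext_base_absorbing R1 (bop_of b2U)).
- exact: ext_R1U.
- move=> y /=; apply: eq_dotl => z.
  by rewrite adjPl -{1}(ext_U_coiso z) ext_R2U ext_U_dot -adjPl [RHS]adjP.
move=> _ /baseP[h [b ->]] /=; apply: eq_dotl => y.
by rewrite adjPl R1E UE R2E (ext_op_dot J fF fG).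
Qed.

(* On h (+) b, with (e1, e2) = (R2 - z2)(h (+) b) and dl the second component of
   (U - z3)(h (+) b), one has (F2 + z3 F1^* - z2) b = e2 - F1^* dl termwise. *)
Lemma ext_R2_below (z2 z3 : R[i]) : 1 < cmod z2 -> cmod z3 = 1 ->
  exists2 c, 0 < c &
    forall x, c * nrm x <= nrm (R2 x - z2 *: x) + nrm (U x - z3 *: x).
Proof.
move=> z2_gt1 z3_1; pose k := cmod z2 - 1; have k0 : 0 < k by rewrite subr_gt0.
have bM : bounded_linear (fun u => F2 u + z3 *: adj F1 u).
  apply: bounded_linearD; first exact: bounded_linear_bop.
  exact/bounded_linearZ/bounded_linear_bop.
have M_below u : k * nrm u <= nrm (F2 u + z3 *: adj F1 u - z2 *: u).
  apply: (numerical_radius_below (M := bop_of bM)) => // {}u.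
  exact: fund_numerical_radius tABP fF dens z3 u z3_1.
have l2_below (b : l2 E) : k * nrm b <= nrm (l2_map (shifted (bop_of bM) z2) b).
  rewrite -ler_sqr ?nnegrE ?mulr_ge0 ?nrm_ge0 ?(ltW k0)// exprMn !nrm_sqr.
  apply: l2_map_ge => [|u]; first by rewrite exprn_gt0.
  by rewrite -!nrm_sqr -exprMn ler_sqr ?nnegrE ?mulr_ge0 ?nrm_ge0 ?(ltW k0).
have [L L0 hL] := nrm_bop_le (bop_of (bounded_linear_map (adj F1))).
(* k |h| <= |X| by the bound for B and k |b| <= |X| + L |Y| through [e2] and [dl]; the sum is at
   most (2 + L) (|X| + |Y|). *)
have L2 : 0 < 2 + L by lra.
have c0 : 0 < k / (2 + L) by rewrite divr_gt0.
exists (k / (2 + L)) => // x.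
have base_below y : base y ->
    k / (2 + L) * nrm y <= nrm (R2 y - z2 *: y) + nrm (U y - z3 *: y).
  move=> /baseP[h [b ->]]; rewrite R2E UE ext_opl ext_unitaryl.
  pose e2 := l2_map (adj F1) (l2_cons (d h) b) + l2_map F2 b - z2 *: b.
  pose dl := l2_cons (d h) b - z3 *: b.
  set X := hpair (hpair (B h) _) 0 - _; set Y := hpair (hpair (P h) _) 0 - _.
  have n1 : nrm (B h - z2 *: h) <= nrm X := le_trans (nrm_fst_le X.1) (nrm_fst_le X).
  have n2 : nrm e2 <= nrm X := le_trans (nrm_snd_le X.1) (nrm_fst_le X).
  have n3 : nrm dl <= nrm Y := le_trans (nrm_snd_le Y.1) (nrm_fst_le Y).
  have hB : k * nrm h <= nrm (B h - z2 *: h).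
    apply: contraction_below => // u.
    by case: (tetrablock_contraction_le1 tABP u).
  have eb : l2_map (shifted (bop_of bM) z2) b = e2 - l2_map (adj F1) dl.
    apply: l2_ext => n; rewrite /e2 /dl !l2E /= bopB bopZ.
    by apply: eq_dotl => w; rewrite !(dotDl, dotNl, dotZl); ring.
  have hb := l2_below b; rewrite eb in hb.
  have := nrmB e2 (l2_map (adj F1) dl); have := hL dl => /= hdl.
  rewrite mulrAC ler_pdivrMr// nrm_hpair0.
  have := nrm_hpair_le h b; move: hdl hb hB n1 n2 n3 (nrm_ge0 dl) (nrm_ge0 X) (nrm_ge0 Y).
  move: (nrm (hpair h b)) (nrm dl) (nrm e2) (nrm X) (nrm Y) (nrm h) (nrm b).
  move: (nrm (l2_map _ _)) (nrm (_ - _)) (nrm (_ - _)) => p q r.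
  move=> n n0 n1 nX nY nh nb h1 h2 h3 h4 h5 h6 h7 h8 h9 h10 h11.
  have : k * n <= k * (nh + nb) by rewrite ler_pM2l.
  have : L * n0 <= L * nY by rewrite ler_wpM2l.
  have := mulr_ge0 L0 h8; lra.
(* The left side is the norm of a scalar multiple of the identity, so the lower bound is an
   inequality between operators commuting with U. *)
have := @isometry_transfer _ _ U base ext_U_nrm ext_base_absorbing
  (bop_of (bounded_linearZ (k / (2 + L))%:C%C (bounded_linear_id K)))
  (shifted R2 z2) (shifted U z3) _ _ _ _ x.
rewrite /= nrmZr ?(ltW c0)//; apply.
- by move=> y /=; rewrite bopZ.
- by move=> y /=; rewrite bopB bopZ ext_R2U.
- by move=> y /=; rewrite bopB bopZ.
- by move=> y yb /=; rewrite nrmZr ?(ltW c0)//; exact: base_below.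
Qed.

Lemma ext_tetrablock_unitary : tetrablock_unitary R1 R2 U.
Proof.
have n T := unitary_normal ext_R12 ext_R1U ext_R2U ext_U_iso ext_U_coiso ext_R1E (T := T).
split.
- by split; [exact: ext_R12|exact: ext_R1U|exact: ext_R2U].
- by split; apply: n; rewrite !inE eqxx ?orbT.
move=> z /(unitary_taylor_spectrum ext_R12 ext_R1U ext_R2U ext_U_iso ext_U_coiso
  ext_R1E ext_R2_below).
case: z => [[z1 z2] z3] /= [z3_1 z2_1 ->].
exact: distinguished_boundary_mem.
Qed.

(** R1, R2 and U preserve Ht, and there the H-component of the image depends on the H-component
    alone, through A, B or P. A monomial can thus be projected without computing its sequence
    part. *)
Lemma ext_dilation :
  tetrablock_unitary_dilation (fun h : H => hpair (hpair h 0) 0 : K) A B P R1 R2 U.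
Proof.
have iterE (T : bop H H) (N : bop K K) n h b :
    (forall h b, exists b', N (hpair (hpair h b) 0) = hpair (hpair (T h) b') 0) ->
    exists b', iter n N (hpair (hpair h b) 0) = hpair (hpair (iter n T h) b') 0.
  move=> TN; elim: n => [|n [b' IH]]; first by exists b.
  by rewrite /= IH; exact: TN.
split.
- move=> a x y; apply: injective_projections; rewrite /= ?scaler0 ?addr0//.
  by apply: injective_projections; rewrite /= ?scaler0 ?addr0.
- by move=> h; rewrite !nrmE !nrm_hpair0.
- exact: ext_tetrablock_unitary.
move=> m n l h.
have [|b3 ->] := iterE P U l h 0.
  by move=> h1 b1; eexists; rewrite UE ext_unitaryl.
have [|b2 ->] := iterE B R2 n (iter l P h) b3.
  by move=> h1 b1; eexists; rewrite R2E ext_opl.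
have [|b1 ->] := iterE A R1 m (iter n B (iter l P h)) b2.
  by move=> h1 b1; eexists; rewrite R1E ext_opl.
split; first by eexists.
move=> _ [w _ <-]; rewrite dotBl !dot_hpair.
by rewrite !dot0r !addr0 subrr.
Qed.

End UnitaryDilation.

(** * Identification with the operators of the theorem *)

Section BlockMatrices.
Context (R : realType) (H : hilbertType R) (A P : bop H H).
Local Notation d := (clran_cor (defect_op P)).
Local Notation d' := (clran_cor (defect_op (adj P))).
Local Notation Q := (bop_of (bounded_linear_Pstar_restr P)).

(** Once the adjoint of [d'] is rewritten as D_{P^*} on its defect space, the two sides are
    convertible. *)
Lemma block_ut_ext_op (F1 F2 : bop (defect_space P) (defect_space P))
    (G1 G2 : bop (defect_space (adj P)) (defect_space (adj P))) x :
  block_ut (V_op A F1 F2) (C_op F2 G2) (D_op G1 G2) x = ext_op d d' Q A F1 F2 G1 G2 x.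
Proof. by case: x => [[h b] a]; rewrite ext_opE adj_clran_defect. Qed.

Lemma block_ut_ext_unitary x :
  block_ut (V3_op P) (C3_op P) (shift_op (defect_space (adj P))) x = ext_unitary P d d' Q x.
Proof. by case: x => [[h b] a]; rewrite ext_unitaryE adj_clran_defect. Qed.

End BlockMatrices.

Section FundamentalOperators.
Context (R : realType) (H : hilbertType R) (A B P : bop H H).
Hypothesis tABP : tetrablock_contraction A B P.

Lemma tetrablock_julia : julia P (clran_cor (defect_op P))
  (clran_cor (defect_op (adj P))) (bop_of (bounded_linear_Pstar_restr P)).
Proof. exact/defect_julia/(tetrablock_contraction_nrmP tABP). Qed.

Lemma fundamental_operatorsP F1 F2 : fundamental_operators A B (P := P) F1 F2 ->
  fundamental A B P (clran_cor (defect_op P)) F1 F2.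
Proof.
move=> [F1E F2E]; have [[AB AP BP] _ _] := tABP; split=> //.
- exact: julia_dense tetrablock_julia.
- exact: julia_dd tetrablock_julia.
- by move=> h; rewrite F1E adj_clran_defect.
- by move=> h; rewrite F2E adj_clran_defect.
Qed.

Lemma fundamental_operators_adjP G1 G2 :
  fundamental_operators (adj A) (adj B) (P := adj P) G1 G2 ->
  fundamental (adj A) (adj B) (adj P) (clran_cor (defect_op (adj P))) G1 G2.
Proof.
move=> [G1E G2E]; have [[AB AP BP] _ _] := tABP; split.
- exact: adj_comm.
- exact: adj_comm.
- exact: adj_comm.
- exact: julia_dense' tetrablock_julia.
- by move=> h; rewrite (julia_dd' tetrablock_julia) adjK.
- by move=> h; rewrite G1E adj_clran_defect.
- by move=> h; rewrite G2E adj_clran_defect.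
Qed.

End FundamentalOperators.

Theorem theorem4 (R : realType) (H : hilbertType R) (A B P : bop H H)
  (tetraABP : tetrablock_contraction A B P)
  (F1 F2 : bop (defect_space P) (defect_space P))
  (fundF : fundamental_operators A B F1 F2)
  (commF : forall x, commutator F1 F2 x = 0)
  (commF_adj : forall x, commutator F1 (adj F1) x = commutator F2 (adj F2) x)
  (G1 G2 : bop (defect_space (adj P)) (defect_space (adj P)))
  (fundG : fundamental_operators (adj A) (adj B) G1 G2) :
  let R1 := block_ut (V_op A F1 F2) (C_op F2 G2) (D_op G1 G2) in
  let R2 := block_ut (V_op B F2 F1) (C_op F1 G1) (D_op G2 G1) in
  let U := block_ut (V3_op P) (C3_op P) (shift_op (defect_space (adj P))) in
  tetrablock_unitary_dilation (fun h : H => hpair (hpair h 0) 0) A B P R1 R2 U.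
Proof.
exact: (ext_dilation tetraABP (tetrablock_julia tetraABP)
  (fundamental_operatorsP tetraABP fundF) (fundamental_operators_adjP tetraABP fundG)
  (@clran_cor_approx _ _ _ _) (fun x => subr0_eq (commF x)) commF_adj
  (block_ut_ext_op A F1 F2 G1 G2) (block_ut_ext_op B F2 F1 G2 G1)
  (@block_ut_ext_unitary R H P)).
Qed.
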